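(* Let $\mathcal P$ be a clustering spin model on $\mathbb Z^d$ and let $\xi_0,\dots,\xi_d$ be local score functions (each of the form $\xi_i(x,\mu)=h_i(\mu\cap W_k(x))$ for $x\in\mu$, with $h_i:\{0,1\}^{W_k}\to\mathbb R$ for some $k$, and $\xi_i(x,\mu)=0$ for $x\notin\mu$) such that $\sum_{x\in\mu}\xi_i(x,\mu)=V_i(C(\mu))$ for every finite $\mu\subset\mathbb Z^d$, where $V_i$ is the $i$th intrinsic volume. Set $\bar H_n=(V_0(C(\mathcal P_n)),\dots,V_d(C(\mathcal P_n)))$. Then as $n\to\infty$, $$\frac{\bar H_n-\mathbb E(\bar H_n)}{\sqrt{w_n}}\stackrel{d}{\Rightarrow}N(0,\Sigma),$$ where $\Sigma=(\Sigma(i,j))_{0\le i,j\le d}$ with $\Sigma(i,j)=\sum_{z\in\mathbb Z^d}\operatorname{Cov}\bigl(\xi_i(O,\mathcal P),\xi_j(z,\mathcal P)\bigr)$.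
   Context: $\mathbb Z^d$ is the Cayley graph with edges between points at $\ell_1$-distance $1$; $|x|$ is the $\ell_1$-norm, $W_r(x)=\{y\in\mathbb Z^d:|x-y|\le r\}$, $W_r=W_r(O)$ with $O$ the origin, $w_n=|W_n|$. In $h_i(\mu\cap W_k(x))$, the configuration $\mu\cap W_k(x)$ is identified, by translation by $-x$, with an element of $\{0,1\}^{W_k}$. For $\mu\subset\mathbb Z^d$, $C(\mu)=\bigcup_{x\in\mu}(x+[-\tfrac12,\tfrac12]^d)\subset\mathbb R^d$. $V_0,\dots,V_d$ are the intrinsic volumes on the convex ring of $\mathbb R^d$ (finite unions of convex bodies; $V_0$ is the Euler–Poincaré characteristic, $V_d$ is the volume). The Gaussian limit may be degenerate. A spin model is a random element $\mathcal P$ of $\{0,1\}^{\mathbb Z^d}$, identified with a random subset of $\mathbb Z^d$; $\mathcal P_n=\mathcal P\cap W_n$. It is stationary if $\mathcal P+y\stackrel d=\mathcal P$ for all $y\in\mathbb Z^d$, non-degenerate if $\mathbb P(O\in\mathcal P)\in(0,1)$. A function $\phi:[0,\infty)\to[0,\infty)$ is fast decreasing if $\phi\le1$, $\phi$ is decreasing and $\lim_{s\to\infty}s^m\phi(s)=0$ for all $m\ge1$. A stationary non-degenerate $\mathcal P$ is a clustering spin model if there are constants $C_k,c_k\in(0,\infty)$ ($C_k$ non-decreasing, $c_k$ non-increasing in $k$) and a fast decreasing $\phi$ such that for all $p,q\ge1$ and distinct $x_1,\dots,x_{p+q}\in\mathbb Z^d$, $$|\mathbb P(\{x_1,\dots,x_{p+q}\}\subset\mathcal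 P)-\mathbb P(\{x_1,\dots,x_p\}\subset\mathcal P)\mathbb P(\{x_{p+1},\dots,x_{p+q}\}\subset\mathcal P)|\le C_{p+q}\phi(c_{p+q}s),$$ where $s=\min_{1\le i\le p,\,1\le j\le q}|x_i-x_{p+j}|$. *)

(* Defs.v *)
From HB Require Import structures.
From mathcomp Require Import all_boot all_order all_algebra finmap.
From mathcomp Require Import all_classical all_reals all_analysis.

Set Implicit Arguments.
Unset Strict Implicit.
Unset Printing Implicit Defensive.

Import Order.TTheory GRing.Theory Num.Theory.
Import numFieldNormedType.Exports.

Local Open Scope classical_set_scope.
Local Open Scope ring_scope.

(* Points of Z^d are row vectors ['rV[int]_d]; an element of {0,1}^(Z^d) is
   identified with the set of its sites of value 1. *)

Section Lattice.
Variable d : nat.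
Implicit Types (x y : 'rV[int]_d) (mu : set 'rV[int]_d).

Definition l1norm x : nat := (\sum_(i < d) `|x ord0 i|)%N.

Definition W x (r : nat) : set 'rV[int]_d := [set y | (l1norm (x - y) <= r)%N].

Definition wcard (n : nat) : nat := #|` fset_set (W 0 n)|.

Definition translate y mu : set 'rV[int]_d := [set x + y | x in mu].

(* The product sigma-algebra on {0,1}^(Z^d), generated by the coordinates. *)
Definition cylinders : set (set (set 'rV[int]_d)) :=
  range (fun x => [set mu | mu x]).

Definition config := g_sigma_algebraType cylinders.

(* [h] is only applied to subsets of [W 0 k], i.e. to elements of {0,1}^(W_k). *)
Definition local_score (R : realType)
    (xi : 'rV[int]_d -> set 'rV[int]_d -> R) : Prop :=
  exists (k : nat) (h : set 'rV[int]_d -> R), forall x mu,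
    (mu x -> xi x mu = h (translate (- x) (mu `&` W x k))) /\
    (~ mu x -> xi x mu = 0).

End Lattice.

Section SpinModel.
Variables (R : realType) (d : nat) (disp : measure_display).
Variables (Omega : measurableType disp) (Pr : probability Omega R).
Implicit Types calP : {mfun Omega >-> config d}.

Definition stationary calP : Prop :=
  forall (y : 'rV[int]_d) (A : set (config d)), measurable A ->
    Pr [set w | A (translate y (calP w))] = Pr [set w | A (calP w)].

Definition nondegenerate_spin calP : Prop :=
  (0 < Pr [set w | calP w (0 : 'rV[int]_d)%R] < 1)%E.

Definition fast_decreasing (phi : R -> R) : Prop :=
  [/\ forall s : R, 0 <= s -> 0 <= phi s <= 1,
      forall s t : R, 0 <= s -> s <= t -> phi t <= phi s &
      forall m, (1 <= m)%N -> s ^+ m * phi s @[s --> +oo] --> (0 : R)].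

(* The two groups of points are the first [p.+1] and the last [q.+1] values of
   a family; the initial value of the minimum is itself one of the distances. *)
Definition separation (p q : nat) (x : 'I_(p.+1 + q.+1) -> 'rV[int]_d) : nat :=
  let dist ij := l1norm (x (lshift q.+1 ij.1) - x (rshift p.+1 ij.2)) in
  \big[minn/dist (ord0, ord0)]_(ij : 'I_p.+1 * 'I_q.+1) dist ij.

Definition contains calP (I : Type) (x : I -> 'rV[int]_d) : set Omega :=
  [set w | range x `<=` calP w].

Definition clustering_spin_model calP : Prop :=
  [/\ stationary calP, nondegenerate_spin calP &
  exists (C c : nat -> R) (phi : R -> R),
  [/\ forall k, 0 < C k /\ 0 < c k,
      {homo C : k l / (k <= l)%N >-> k <= l},
      {homo c : k l / (k <= l)%N >-> l <= k},
      fast_decreasing phi &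
      forall (p q : nat) (x : 'I_(p.+1 + q.+1) -> 'rV[int]_d), injective x ->
        (`| Pr (contains calP x)
            - Pr (contains calP (x \o @lshift p.+1 q.+1))
              * Pr (contains calP (x \o @rshift p.+1 q.+1)) |
         <= (C (p.+1 + q.+1)%N
             * phi (c (p.+1 + q.+1)%N * (separation x)%:R))%:E)%E]].

End SpinModel.

Section IntrinsicVolumes.
Variable R : realType.

(* n-dimensional Lebesgue measure as an iterated product (Cavalieri): the
   measure of [A] is the integral of the measures of its sections. *)
Fixpoint volume (n : nat) : set 'rV[R]_n -> \bar R :=
  match n with
  | 0 => fun A => (\1_A 0)%:E
  | m.+1 => fun A =>
      (\int[lebesgue_measure]_x
         @volume m [set v : 'rV[R]_m | A (row_mx (x%:M : 'rV_1) v)])%E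
  end.

Definition eball (n : nat) (r : R) : set 'rV[R]_n :=
  [set v | \sum_(i < n) v ord0 i ^+ 2 <= r ^+ 2].

Definition kappa (n : nat) : R := fine (volume (eball 1 : set 'rV[R]_n)).

Variable d : nat.

Definition convex_body (K : set 'rV[R]_d) : Prop :=
  [/\ K !=set0, compact K &
      convex_set (K : set (convex_lmodType 'rV[R]_d))].

Definition convex_ring : set (set 'rV[R]_d) :=
  [set A | exists (n : nat) (K : 'I_n -> set 'rV[R]_d),
     (forall i, convex_body (K i)) /\ A = \bigcup_i K i].

Definition parallel_body (K : set 'rV[R]_d) (r : R) : set 'rV[R]_d :=
  [set u + v | u in K & v in eball r].

(* The intrinsic volumes are given on convex bodies by the Steiner formula and
   on the convex ring by additivity; the extension exists and is unique there
   (Groemer). *)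
Record is_intrinsic_volumes (V : 'I_d.+1 -> set 'rV[R]_d -> R) : Prop := {
  intrinsic_steiner : forall K, convex_body K -> forall r : R, 0 <= r ->
    volume (parallel_body K r)
      = (\sum_(j < d.+1) kappa (d - j) * V j K * r ^+ (d - j))%:E ;
  intrinsic_set0 : forall j, V j set0 = 0 ;
  intrinsic_additive : forall j A B, convex_ring A -> convex_ring B ->
    V j (A `|` B) + V j (A `&` B) = V j A + V j B }.

Definition intrinsic_volume : 'I_d.+1 -> set 'rV[R]_d -> R :=
  xget (fun _ _ => 0) is_intrinsic_volumes.

Definition cubes (mu : set 'rV[int]_d) : set 'rV[R]_d :=
  \bigcup_(x in mu)
    [set v | forall i, `|v ord0 i - (x ord0 i)%:~R| <= 2^-1].

End IntrinsicVolumes.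

Section GaussianLimit.
Variable R : realType.

(* R^m with its Borel sigma-algebra. *)
Definition borel (m : nat) := g_sigma_algebraType (@open 'rV[R]_m).

(* The normal law N(0, v) on R; it is the Dirac mass at 0 when v = 0, a case in
   which [normal_prob 0 0] is not. *)
Definition normal0 (v : R) : set R -> \bar R :=
  if v == 0 then \d_(0 : R) else normal_prob 0 (Num.sqrt v).

(* nu = N(0, Sigma), possibly degenerate: for every t, the law of <t, X> with
   X ~ nu is N(0, t Sigma t^T). *)
Definition is_centered_normal (m : nat) (Sigma : 'M[R]_m)
    (nu : probability (borel m) R) : Prop :=
  Sigma^T = Sigma /\
  forall t : 'rV[R]_m,
    0 <= (t *m Sigma *m t^T) ord0 ord0 /\
    forall B : set R, measurable B ->
      nu [set v : 'rV[R]_m | B ((t *m v^T) ord0 ord0)]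
        = normal0 ((t *m Sigma *m t^T) ord0 ord0) B.

Variables (disp : measure_display) (Omega : measurableType disp).
Variable Pr : probability Omega R.

Definition cvg_in_distribution (m : nat) (X : nat -> Omega -> 'rV[R]_m)
    (nu : probability (borel m) R) : Prop :=
  forall f : 'rV[R]_m -> R, continuous f ->
    (exists M : R, forall v, `|f v| <= M) ->
    'E_Pr[f \o X n]%E @[n --> \oo] --> (\int[nu]_v (f v)%:E)%E.

Definition cvg_to_centered_normal (m : nat) (X : nat -> Omega -> 'rV[R]_m)
    (Sigma : 'M[R]_m) : Prop :=
  exists nu : probability (borel m) R,
    is_centered_normal Sigma nu /\ cvg_in_distribution X nu.

Definition mean_vector (m : nat) (X : Omega -> 'rV[R]_m) : 'rV[R]_m :=
  \row_i fine ('E_Pr[fun w => X w ord0 i])%E.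

End GaussianLimit.

Section Statistics.
Variables (R : realType) (d : nat) (disp : measure_display).
Variables (Omega : measurableType disp) (Pr : probability Omega R).
Variable calP : {mfun Omega >-> config d}.

Definition Hbar (n : nat) (w : Omega) : 'rV[R]_d.+1 :=
  \row_i intrinsic_volume i (cubes (calP w `&` W 0 n)).

Variable xi : 'I_d.+1 -> 'rV[int]_d -> set 'rV[int]_d -> R.

Definition score_cov (i j : 'I_d.+1) (z : 'rV[int]_d) : \bar R :=
  covariance Pr (fun w => xi i 0 (calP w)) (fun w => xi j z (calP w)).

(* [\esum] only sums nonnegative families, hence the positive and negative
   parts. *)
Definition limit_cov : 'M[R]_d.+1 :=
  \matrix_(i, j) fine (\esum_(z in setT) (score_cov i j)^\+ z
                       - \esum_(z in setT) (score_cov i j)^\- z)%E.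

End Statistics.

(* Main.v *)
Require Import Defs.
From HB Require Import structures.
From mathcomp Require Import all_boot all_order all_algebra finmap.
From mathcomp Require Import all_classical all_reals all_analysis.
From mathcomp Require Import measurable_realfun.
From mathcomp Require Import ring lra zify.

Set Implicit Arguments.
Unset Strict Implicit.
Unset Printing Implicit Defensive.

Import Order.TTheory GRing.Theory Num.Theory.
Import numFieldNormedType.Exports.

Local Open Scope classical_set_scope.
Local Open Scope ring_scope.

(** By the Cramer-Wold principle everything is read off the linear statistics U_n = <t, normalized
    Hbar>. Additivity of the scores makes U_n equal to w_n^(-1/2) times a sum over x in W_n of
    bounded centred variables X_x, each depending on the configuration within a fixed distance of x
    ([dotp_normalized_Hbar]). Clustering speaks only of events where a finite set D lies in the spin
    model, but a function of finitely many sites is a finite combination of indicators of such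
    events ([local_expansion]), so covariances of bounded local functions decay faster than any
    power of the distance ([clustering_local]). Hence the sums over y of Cov(X_x, X_y) are close to
    a common limit for x away from the boundary of W_n; the boundary contains a vanishing fraction
    of the sites, so the variance of U_n tends to t Sigma t^T ([linear_statistic_variance]).

    Normality comes from moments, through an asymptotic form of Gaussian integration by parts: E
    U^(m+2) = (m+1) E U^2 E U^m up to a small error ([asymptotic_recursion]). To see it, test
    U^(m+1) against a single X_x and split U = N + V into the contributions of sites near x and far
    from x. The mean of X_x V^(m+1) is tiny because X_x is centred; the first-order term (m+1) X_x N
    V^m factors once V is replaced by a sum over still farther sites; the remainder is quadratic in
    N. The splitting radius is a small power of n: large enough for fast decay to beat every power
    of n, small enough for the square of the number of near sites to be negligible against
    sqrt(w_n). The moments of U_n therefore converge to those of N(0, v) with v = t Sigma t^T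
    ([moments_cvg]).

    Moments determine E cos(U_n + th) through Taylor polynomials, whose even-order remainder has the
    Gaussian limit (v/2)^k / k!, which vanishes as k grows ([Ex_cos_cvg]). The limit law is built by
    induction on the dimension with Schur complements, degenerate directions included
    ([centered_normal_exists]). Finally, a bounded continuous function is a trigonometric polynomial
    up to an error that grows at most quadratically ([trig_approximation]); as second moments stay
    bounded, convergence of the cosines yields convergence in distribution
    ([weak_cvg_criterion]). *)

(** * Expectations and covariances of bounded random variables *)

Section BoundedRandomVariables.
Context disp (T : measurableType disp) (R : realType) (P : probability T R).
Implicit Types X Y : T -> R.

(** Variables built from finitely many sites of the spin model are bounded, so this one class,
    closed under sums, products and powers, settles all integrability conditions on the side of the
    model. *)
Definition bounded_rv X :=
  measurable_fun setT X /\ exists M : R, forall w, `|X w| <= M.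

Definition Ex X : R := \int[P]_w X w.

Lemma bounded_rv_integrable X : bounded_rv X -> P.-integrable setT (EFin \o X).
Proof.
move=> [mX [M XM]]; apply: measurable_bounded_integrable => //.
  by apply: le_lt_trans (ltry 1); rewrite -(probability_setT P).
exists M; split; first exact: num_real.
by move=> x Mx w _ /=; exact: le_trans (XM w) (ltW Mx).
Qed.

(** These integrability rules are for variables that need not be bounded, such as powers of a
    coordinate under the Gaussian law. *)
Lemma integrable_EFinZ (a : R) X : P.-integrable setT (EFin \o X) ->
  P.-integrable setT (EFin \o (fun w => a * X w)).
Proof.
move=> iX; apply: (eq_integrable measurableT _ _ _ (integrableZl measurableT a iX)).
by move=> w _ /=; rewrite EFinM.
Qed.

Lemma integrable_EFinD X Y : P.-integrable setT (EFin \o X) ->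
  P.-integrable setT (EFin \o Y) ->
  P.-integrable setT (EFin \o (fun w => X w + Y w)).
Proof.
move=> iX iY; apply: (eq_integrable measurableT _ _ _ (integrableD measurableT iX iY)).
by move=> w _ /=; rewrite EFinD.
Qed.

Lemma integrable_EFinB X Y : P.-integrable setT (EFin \o X) ->
  P.-integrable setT (EFin \o Y) ->
  P.-integrable setT (EFin \o (fun w => X w - Y w)).
Proof.
move=> iX iY; apply: (eq_integrable measurableT _ _ _ (integrableB measurableT iX iY)).
by move=> w _ /=; rewrite EFinB.
Qed.

Lemma integrable_EFin_sum I (s : seq I) (X : I -> T -> R) :
  (forall i, P.-integrable setT (EFin \o X i)) ->
  P.-integrable setT (EFin \o (fun w => \sum_(i <- s) X i w)) /\
  Ex (fun w => \sum_(i <- s) X i w) = \sum_(i <- s) Ex (X i).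
Proof.
move=> iX; elim: s => [|i s [IH1 IH2]].
  rewrite big_nil (_ : (fun w => _) = fun=> 0); last first.
    by apply/funext => w; rewrite big_nil.
  split; last by rewrite /Ex Rintegral_cst// mul0r.
  by apply: bounded_rv_integrable; split => //; exists 0 => w; rewrite normr0.
rewrite big_cons (_ : (fun w => _) = fun w => X i w + \sum_(j <- s) X j w); last first.
  by apply/funext => w; rewrite big_cons.
split; first exact: integrable_EFinD.
by rewrite -IH2 /Ex RintegralD.
Qed.

Lemma bounded_rv_cst (a : R) : bounded_rv (fun=> a).
Proof. by split => //; exists `|a|. Qed.

Lemma bounded_rvD X Y : bounded_rv X -> bounded_rv Y ->
  bounded_rv (fun w => X w + Y w).
Proof.
move=> [mX [M XM]] [mY [N YN]]; split; first exact: measurable_funD.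
by exists (M + N) => w; rewrite (le_trans (ler_normD _ _))// lerD.
Qed.

Lemma bounded_rvN X : bounded_rv X -> bounded_rv (fun w => - X w).
Proof.
move=> [mX [M XM]]; split; first exact: measurableT_comp.
by exists M => w; rewrite normrN.
Qed.

Lemma bounded_rvB X Y : bounded_rv X -> bounded_rv Y ->
  bounded_rv (fun w => X w - Y w).
Proof. by move=> bX bY; apply: bounded_rvD => //; exact: bounded_rvN. Qed.

Lemma bounded_rvM X Y : bounded_rv X -> bounded_rv Y ->
  bounded_rv (fun w => X w * Y w).
Proof.
move=> [mX [M XM]] [mY [N YN]]; split; first exact: measurable_funM.
by exists (M * N) => w; rewrite normrM ler_pM.
Qed.

Lemma bounded_rvZ (a : R) X : bounded_rv X -> bounded_rv (fun w => a * X w).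
Proof. by move=> bX; apply: bounded_rvM => //; exact: bounded_rv_cst. Qed.

Lemma bounded_rvX X m : bounded_rv X -> bounded_rv (fun w => X w ^+ m).
Proof.
move=> bX; elim: m => [|m IH]; first exact: bounded_rv_cst.
rewrite (_ : (fun w => _) = (fun w => X w * X w ^+ m)).
  exact: bounded_rvM.
by apply/funext => w; rewrite exprS.
Qed.

Lemma bounded_rv_sum I (s : seq I) (Q : pred I) (X : I -> T -> R) :
  (forall i, bounded_rv (X i)) ->
  bounded_rv (fun w => \sum_(i <- s | Q i) X i w).
Proof.
move=> bX; elim: s => [|i s IH].
  by under eq_fun do rewrite big_nil; exact: bounded_rv_cst.
under eq_fun do rewrite big_cons.
by case: (Q i) => //; exact: bounded_rvD.
Qed.

Lemma bounded_rv_prod I (s : seq I) (X : I -> T -> R) :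
  (forall i, bounded_rv (X i)) ->
  bounded_rv (fun w => \prod_(i <- s) X i w).
Proof.
move=> bX; elim: s => [|i s IH].
  by under eq_fun do rewrite big_nil; exact: bounded_rv_cst.
by under eq_fun do rewrite big_cons; exact: bounded_rvM.
Qed.

Lemma bounded_rv_norm X : bounded_rv X -> bounded_rv (fun w => `|X w|).
Proof.
move=> [mX [M XM]]; split; first exact: measurableT_comp.
by exists M => w; rewrite normr_id.
Qed.

Lemma bounded_rv_comp X (f : R -> R) (M : R) : measurable_fun setT X ->
  measurable_fun setT f -> (forall x, `|f x| <= M) -> bounded_rv (fun w => f (X w)).
Proof. by move=> mX mf fM; split; [exact: measurableT_comp|exists M]. Qed.

Lemma bounded_rv_indic (A : set T) : measurable A -> bounded_rv \1_A.
Proof.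
move=> mA; split => //; exists 1 => w.
by rewrite indicE; case: (_ \in _); rewrite ?normr0 ?normr1.
Qed.

Lemma Ex_cst (a : R) : Ex (fun=> a) = a.
Proof. by rewrite /Ex Rintegral_cst// (_ : fine _ = 1) ?mulr1 //; rewrite -[RHS]/(fine 1%E) -(probability_setT P). Qed.

Lemma ExD X Y : bounded_rv X -> bounded_rv Y ->
  Ex (fun w => X w + Y w) = Ex X + Ex Y.
Proof. by move=> bX bY; rewrite /Ex RintegralD//; exact: bounded_rv_integrable. Qed.

Lemma ExZ (a : R) X : bounded_rv X -> Ex (fun w => a * X w) = a * Ex X.
Proof. by move=> bX; rewrite /Ex RintegralZl//; exact: bounded_rv_integrable. Qed.

Lemma ExB X Y : bounded_rv X -> bounded_rv Y ->
  Ex (fun w => X w - Y w) = Ex X - Ex Y.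
Proof. by move=> bX bY; rewrite /Ex RintegralB//; exact: bounded_rv_integrable. Qed.

Lemma Ex_sum I (s : seq I) (Q : pred I) (X : I -> T -> R) :
  (forall i, bounded_rv (X i)) ->
  Ex (fun w => \sum_(i <- s | Q i) X i w) = \sum_(i <- s | Q i) Ex (X i).
Proof.
move=> bX; elim: s => [|i s IH].
  by under eq_fun do rewrite big_nil; rewrite Ex_cst big_nil.
under eq_fun do rewrite big_cons; rewrite big_cons.
by case: (Q i) => //; rewrite ExD ?IH//; exact: bounded_rv_sum.
Qed.

Lemma Ex_le X Y : bounded_rv X -> bounded_rv Y -> (forall w, X w <= Y w) ->
  Ex X <= Ex Y.
Proof.
by move=> bX bY XY; apply: le_Rintegral => //; exact: bounded_rv_integrable.
Qed.

Lemma Ex_ge0 X : (forall w, 0 <= X w) -> 0 <= Ex X.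
Proof. by move=> X0; apply: Rintegral_ge0. Qed.

Lemma Ex_norm X : bounded_rv X -> `|Ex X| <= Ex (fun w => `|X w|).
Proof. by move=> bX; apply: le_normr_Rintegral => //; exact: bounded_rv_integrable. Qed.

Lemma Ex_norm_le X Y : bounded_rv X -> bounded_rv Y ->
  (forall w, `|X w| <= Y w) -> `|Ex X| <= Ex Y.
Proof.
move=> bX bY XY; apply: le_trans (Ex_norm bX) _.
by apply: Ex_le => //; exact: bounded_rv_norm.
Qed.

Lemma Ex_norm_bound X (M : R) : bounded_rv X -> (forall w, `|X w| <= M) ->
  `|Ex X| <= M.
Proof.
move=> bX XM; rewrite -[leRHS]Ex_cst; apply: Ex_norm_le => //.
exact: bounded_rv_cst.
Qed.

Lemma expectationEx X : bounded_rv X -> ('E_P[X] = (Ex X)%:E)%E.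
Proof.
move=> bX; rewrite unlock /Ex /Rintegral fineK//.
by apply: integrable_fin_num => //; exact: bounded_rv_integrable.
Qed.

Lemma Ex_indic (A : set T) : measurable A -> Ex \1_A = fine (P A).
Proof.
move=> mA; rewrite /Ex /Rintegral integral_indic// setIT//.
Qed.

(** The uncentred, real-valued form is the shape in which clustering bounds appear.
    [covarianceE_Cov] links it to the extended real [covariance]. *)
Definition Cov X Y : R := Ex (fun w => X w * Y w) - Ex X * Ex Y.

Lemma CovDl X Y Z : bounded_rv X -> bounded_rv Y -> bounded_rv Z ->
  Cov (fun w => X w + Y w) Z = Cov X Z + Cov Y Z.
Proof.
move=> bX bY bZ; rewrite /Cov.
under [in LHS]eq_fun do rewrite mulrDl.
rewrite !ExD//; try exact: bounded_rvM.
by rewrite mulrDl opprD addrACA.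
Qed.

Lemma CovC X Y : Cov X Y = Cov Y X.
Proof.
rewrite /Cov [Ex X * _]mulrC; congr (Ex _ - _).
by apply/funext => w; rewrite mulrC.
Qed.

Lemma CovDr X Y Z : bounded_rv X -> bounded_rv Y -> bounded_rv Z ->
  Cov X (fun w => Y w + Z w) = Cov X Y + Cov X Z.
Proof. by move=> bX bY bZ; rewrite !(CovC X) CovDl. Qed.

Lemma Cov_cstr X (a : R) : bounded_rv X -> Cov X (fun=> a) = 0.
Proof.
move=> bX; rewrite /Cov Ex_cst.
under eq_fun do rewrite mulrC.
by rewrite ExZ// mulrC subrr.
Qed.

Lemma CovZl (a : R) X Y : bounded_rv X -> bounded_rv Y ->
  Cov (fun w => a * X w) Y = a * Cov X Y.
Proof.
move=> bX bY; rewrite /Cov; under eq_fun do rewrite -mulrA.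
by rewrite !ExZ ?mulrBr ?mulrA//; exact: bounded_rvM.
Qed.

Lemma CovZr (a : R) X Y : bounded_rv X -> bounded_rv Y ->
  Cov X (fun w => a * Y w) = a * Cov X Y.
Proof. by move=> bX bY; rewrite CovC CovZl// CovC. Qed.

Lemma Cov_suml I (s : seq I) (Q : pred I) (X : I -> T -> R) Y :
  (forall i, bounded_rv (X i)) -> bounded_rv Y ->
  Cov (fun w => \sum_(i <- s | Q i) X i w) Y = \sum_(i <- s | Q i) Cov (X i) Y.
Proof.
move=> bX bY; elim: s => [|i s IH].
  by under eq_fun do rewrite big_nil; rewrite CovC Cov_cstr// big_nil.
under eq_fun do rewrite big_cons; rewrite big_cons.
by case: (Q i) => //; rewrite CovDl ?IH//; exact: bounded_rv_sum.
Qed.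

Lemma Cov_sumr I (s : seq I) (Q : pred I) X (Y : I -> T -> R) :
  bounded_rv X -> (forall i, bounded_rv (Y i)) ->
  Cov X (fun w => \sum_(i <- s | Q i) Y i w) = \sum_(i <- s | Q i) Cov X (Y i).
Proof.
move=> bX bY; rewrite CovC Cov_suml//; apply: eq_bigr => i _; exact: CovC.
Qed.

Lemma Cov_centered X Y : bounded_rv X -> bounded_rv Y ->
  Ex (fun w => (X w - Ex X) * (Y w - Ex Y)) = Cov X Y.
Proof.
move=> bX bY.
have -> : (fun w => (X w - Ex X) * (Y w - Ex Y)) =
    (fun w => X w * Y w + ((- Ex Y) * X w + (- Ex X) * Y w + Ex X * Ex Y)).
  by apply/funext => w; ring.
have b1 : bounded_rv (fun w => - Ex Y * X w) by exact: bounded_rvZ.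
have b2 : bounded_rv (fun w => - Ex X * Y w) by exact: bounded_rvZ.
have b3 := bounded_rv_cst (Ex X * Ex Y).
have b4 := bounded_rvD b1 b2.
rewrite ExD; [|exact: bounded_rvM|exact: (bounded_rvD b4 b3)].
rewrite (ExD b4 b3) (ExD b1 b2) (ExZ _ bX) (ExZ _ bY) Ex_cst /Cov; ring.
Qed.

Lemma covarianceE_Cov X Y : bounded_rv X -> bounded_rv Y ->
  covariance P X Y = (Cov X Y)%:E.
Proof.
move=> bX bY; have bXc := bounded_rvB bX (bounded_rv_cst (Ex X)).
have bYc := bounded_rvB bY (bounded_rv_cst (Ex Y)).
have bXY := bounded_rvM bXc bYc.
by rewrite unlock !(expectationEx bX, expectationEx bY) (expectationEx bXY)
  Cov_centered.
Qed.

End BoundedRandomVariables.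

(** * Counting lattice points in balls and shells *)

Section Lattice.
Context (d : nat).
Implicit Types (x y z : 'rV[int]_d) (s : seq 'rV[int]_d).

Lemma l1normN x : l1norm (- x) = l1norm x.
Proof. by apply: eq_bigr => i _; rewrite mxE abszN. Qed.

Lemma l1norm0 : l1norm (0 : 'rV[int]_d) = 0%N.
Proof. by rewrite /l1norm big1// => i _; rewrite mxE. Qed.

Lemma l1norm_triangle x y : (l1norm (x + y)%R <= l1norm x + l1norm y)%N.
Proof.
rewrite /l1norm -big_split/=; apply: leq_sum => i _; rewrite mxE.
by move: (x _ _) (y _ _) => a b; lia.
Qed.

Lemma l1norm_sub_triangle y x z :
  (l1norm (x - z)%R <= l1norm (x - y)%R + l1norm (y - z)%R)%N.
Proof. by rewrite (_ : x - z = (x - y) + (y - z)) ?l1norm_triangle// addrA subrK. Qed.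

Lemma l1normC x y : l1norm (x - y) = l1norm (y - x).
Proof. by rewrite -l1normN opprB. Qed.

Lemma coord_le_l1norm x i : (`|x ord0 i| <= l1norm x)%N.
Proof. by rewrite /l1norm (bigD1 i)//= leq_addr. Qed.

(** Indices 0, ..., 2N shifted by -N enumerate the cube [-N, N]^d, to which finiteness and counting
    are reduced. *)
Definition box_point (N : nat) (f : {ffun 'I_d -> 'I_(N.*2.+1)}) : 'rV[int]_d :=
  \row_i ((f i)%:Z - N%:Z).

Lemma box_point_inj N : injective (@box_point N).
Proof.
move=> f g /rowP fg; apply/ffunP => i; have := fg i; rewrite !mxE.
by move/addIr => [] /val_inj.
Qed.

Lemma box_pointP N x : (forall i, `|x ord0 i| <= N)%N ->
  exists f, x = @box_point N f.
Proof.
move=> xN; exists [ffun i => inord `|(x ord0 i + N%:Z)%R|%N].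
apply/rowP => i; rewrite !mxE ffunE; have := xN i.
by move: (x _ _) => a h; rewrite inordK; lia.
Qed.

Lemma size_in_box N s : uniq s -> (forall x, x \in s -> forall i, `|x ord0 i| <= N)%N ->
  (size s <= N.*2.+1 ^ d)%N.
Proof.
move=> us sN; apply: (@leq_trans (size [seq box_point f | f : {ffun 'I_d -> 'I_(N.*2.+1)}])).
  apply: uniq_leq_size => // x /sN /box_pointP[f ->].
  by apply: map_f; rewrite mem_enum.
by rewrite size_map -cardE card_ffun !card_ord.
Qed.

Lemma finite_W n : finite_set (W (0 : 'rV[int]_d) n).
Proof.
apply: (@sub_finite_set _ _ [set` [seq box_point f | f : {ffun 'I_d -> 'I_(n.*2.+1)}]]).
  move=> x /=; rewrite /W/= sub0r l1normN => xn.
  have [f ->] : exists f, x = @box_point n f.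
    by apply: box_pointP => i; apply: leq_trans (coord_le_l1norm _ _) xn.
  by rewrite /mkset; apply: map_f; rewrite mem_enum.
exact: finite_seq.
Qed.

Definition ball_seq n : seq 'rV[int]_d := fset_set (W (0 : 'rV[int]_d) n).

Lemma mem_ball_seq n x : (x \in ball_seq n) = (l1norm x <= n)%N.
Proof.
rewrite /ball_seq in_fset_set; last exact: finite_W.
by apply/idP/idP => [/set_mem|h]; [|apply/mem_set]; rewrite /W/= sub0r l1normN.
Qed.

Lemma uniq_ball_seq n : uniq (ball_seq n).
Proof. exact: fset_uniq. Qed.

Lemma size_ball_seq n : size (ball_seq n) = wcard d n.
Proof. by []. Qed.

Lemma wcard_ub n : (wcard d n <= n.*2.+1 ^ d)%N.
Proof.
rewrite -size_ball_seq; apply: size_in_box => [|x]; first exact: uniq_ball_seq.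
by rewrite mem_ball_seq => xn i; apply: leq_trans (coord_le_l1norm _ _) xn.
Qed.

Lemma size_near s x L : uniq s ->
  (size [seq y <- s | (l1norm (x - y)%R <= L)%N] <= L.*2.+1 ^ d)%N.
Proof.
move=> us; rewrite -(size_map (fun y => x - y)); apply: size_in_box.
  by rewrite map_inj_uniq ?filter_uniq// => y z /addrI /oppr_inj.
move=> y /mapP[z]; rewrite mem_filter => /andP[xz _] -> i.
exact: leq_trans (coord_le_l1norm _ _) xz.
Qed.

Lemma wcard_gt0 n : (0 < wcard d n)%N.
Proof.
rewrite -size_ball_seq lt0n size_eq0; apply/eqP => h.
by have := mem_ball_seq n 0; rewrite h l1norm0.
Qed.

(** The cube of points with coordinates in 0, ..., n/d lies in W_n, and d (n/d + 1) >= n + 1 by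
    Euclidean division. *)
Lemma wcard_lb n : (0 < d)%N -> (n.+1 ^ d <= d ^ d * wcard d n)%N.
Proof.
move=> d0; apply: (@leq_trans ((d * (n %/ d).+1) ^ d)).
  by rewrite leq_exp2r//; have := divn_eq n d; have := ltn_pmod n d0; lia.
rewrite expnMn leq_mul2l; apply/orP; right.
pose f (g : {ffun 'I_d -> 'I_(n %/ d).+1}) : 'rV[int]_d := \row_i (g i)%:Z.
have finj : injective f.
  by move=> g h /rowP gh; apply/ffunP => i; have := gh i; rewrite !mxE => -[] /val_inj.
rewrite -[leqLHS](_ : size [seq f g | g : {ffun 'I_d -> 'I_(n %/ d).+1}] = _); last first.
  by rewrite size_map -cardE card_ffun !card_ord.
rewrite -size_ball_seq; apply: uniq_leq_size.
  by rewrite map_inj_uniq// enum_uniq.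
move=> x /mapP[g _ ->]; rewrite mem_ball_seq.
apply: (@leq_trans (\sum_(i < d) n %/ d)).
  by apply: leq_sum => i _; rewrite mxE -ltnS; case: (g i).
by rewrite sum_nat_const card_ord mulnC leq_divM.
Qed.

Lemma wcard_lb1 n : (0 < d)%N -> (n.+1 <= d ^ d * wcard d n)%N.
Proof.
move=> d0; apply: leq_trans (wcard_lb n d0).
by rewrite -[leqLHS]expn1 leq_pexp2l.
Qed.

(* On a sphere, a point is determined by all its coordinates but the first and
   the sign of the first. *)
Lemma size_sphere s n : (0 < d)%N -> uniq s -> (forall x, x \in s -> l1norm x = n) ->
  (size s <= 2 * n.*2.+1 ^ d.-1)%N.
Proof.
move=> d0 us sn; pose i0 : 'I_d := Ordinal d0.
pose g x : bool * {ffun 'I_d.-1 -> 'I_(n.*2.+1)} :=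
  (0 <= x ord0 i0, [ffun j => inord `|(x ord0 (lift i0 j) + n%:Z)%R|%N]).
suff ug : uniq (map g s).
  rewrite -(size_map g) -(card_uniqP ug); apply: leq_trans (max_card _) _.
  by rewrite card_prod card_bool card_ffun !card_ord.
rewrite map_inj_in_uniq// => x y xs ys [xy0 /ffunP xy].
have xyj j : x ord0 (lift i0 j) = y ord0 (lift i0 j).
  have := xy j; rewrite !ffunE => /(congr1 val)/=.
  have := coord_le_l1norm x (lift i0 j); have := coord_le_l1norm y (lift i0 j).
  rewrite (sn _ xs) (sn _ ys); move: (x _ _) (y _ _) => a b hx hy.
  by rewrite !inordK; lia.
have e0 : `|x ord0 i0|%N = `|y ord0 i0|%N.
  have := sn _ ys; rewrite -(sn _ xs) /l1norm (bigD1 i0)//= [in RHS](bigD1 i0)//=.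
  rewrite [X in (_ + X)%N = _](eq_bigr (fun i => `|x ord0 i|%N)); last first.
    move=> i; rewrite eq_sym => ii0; have [j ->] := unlift_some ii0.
    by rewrite xyj.
  by move=> /eqP; rewrite eqn_add2r => /eqP.
apply/rowP => i; have [->|] := eqVneq i i0; first by move: xy0 e0; move: (x _ _) (y _ _) => a b; lia.
by rewrite eq_sym => /unlift_some[j ->].
Qed.

Lemma wcardS n : (0 < d)%N ->
  (wcard d n.+1 <= wcard d n + 2 * n.+1.*2.+1 ^ d.-1)%N.
Proof.
move=> d0; rewrite -!size_ball_seq -(count_predC (fun x => l1norm x <= n)%N (ball_seq n.+1)).
rewrite -!size_filter; apply: leq_add.
  apply: uniq_leq_size => [|x]; first by rewrite filter_uniq ?uniq_ball_seq.
  by rewrite mem_filter !mem_ball_seq => /andP[].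
apply: size_sphere => // [|x]; first by rewrite filter_uniq ?uniq_ball_seq.
by rewrite mem_filter mem_ball_seq/= -ltnNge => /andP[? ?]; apply/eqP; rewrite eqn_leq; apply/andP.
Qed.

(** The shell between the radii n - k and n consists of at most k spheres with O(n^(d-1)) points
    each, while w_n is at least of order n^d. This is the division-free form of: the shell is a
    fraction at most k (2d)^d / (n + 1) of W_n. *)
Lemma wcard_boundary n k : (0 < d)%N ->
  (n.+1 * wcard d n <= n.+1 * wcard d (n - k) + k * ((d.*2) ^ d * wcard d n))%N.
Proof.
move=> d0.
have h m j : (j <= m)%N -> (wcard d m <= wcard d (m - j) + j * (2 * m.*2.+1 ^ d.-1))%N.
  elim: j => [_|j IH jm]; first by rewrite subn0 mul0n addn0.
  apply: leq_trans (IH (ltnW jm)) _.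
  rewrite (mulSn j) addnA leq_add2r.
  have -> : (m - j = (m - j.+1).+1)%N by rewrite subnS prednK// subn_gt0.
  apply: leq_trans (wcardS _ d0) _; rewrite leq_add2l leq_mul2l/=.
  by case: (d.-1) => // e; rewrite leq_exp2r// ltnS leq_double -subSn// subSS leq_subr.
have [kn|/ltnW kn] := leqP k n; last first.
  (* For k > n the second term alone dominates the left side. *)
  have D2 : (2 <= d.*2 ^ d)%N.
    by apply: (@leq_trans (d.*2 ^ 1)); [rewrite expn1; lia|rewrite leq_pexp2l//; lia].
  case: k kn => [|k] kn; first by rewrite subn0 leq_addr.
  apply: leq_trans (leq_addl _ _); rewrite mulnA leq_mul2r; apply/orP; right.
  by apply: (@leq_trans (k.+1 * 2)); [lia|rewrite leq_mul2l D2 orbT].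
apply: (@leq_trans (n.+1 * (wcard d (n - k) + k * (2 * n.*2.+1 ^ d.-1)))).
  by rewrite leq_mul2l h.
rewrite mulnDr leq_add2l mulnCA leq_mul2l; apply/orP; right.
apply: (@leq_trans (2 ^ d * n.+1 ^ d)); last first.
  by rewrite -mul2n expnMn -mulnA leq_mul2l wcard_lb ?orbT.
rewrite -expnMn -[X in (_ <= _ ^ X)%N](prednK d0) expnS.
rewrite (mulnCA n.+1) mulnA leq_mul2l; apply/orP; right.
by case: (d.-1) => // e; rewrite leq_exp2r//; lia.
Qed.

End Lattice.

(** * A summable weight on the lattice *)

Section LatticeSums.
Context (R : realType) (d : nat).
Implicit Types (z : 'rV[int]_d) (s : seq 'rV[int]_d).

(** A product over coordinates, so that sums over cubes factor. It is at least (1 + |z|)^(-2d),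
    hence it dominates any decay of that order in the l1-norm. *)
Definition lattice_weight z : R := \prod_(i < d) (`|z ord0 i|.+1%:R ^- 2).

Lemma lattice_weight_gt0 z : 0 < lattice_weight z.
Proof. by apply: prodr_gt0 => i _; rewrite invr_gt0 exprn_gt0. Qed.

Lemma sum_inv_sqr n : \sum_(a < n) (a.+1%:R ^- 2 : R) <= 2.
Proof.
(* Strengthened so that the induction telescopes: 1/(t+1)^2 <= 1/t - 1/(t+1). *)
suff : \sum_(a < n.+1) (a.+1%:R ^- 2 : R) <= 2 - n.+1%:R^-1.
  rewrite big_ord_recr/= => h.
  have h1 : 0 <= n.+1%:R ^- 2 :> R by rewrite invr_ge0 exprn_ge0.
  apply: le_trans (le_trans _ h) _; first by rewrite lerDl.
  by rewrite lerBlDr lerDl.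
elim: n => [|n IH]; first by rewrite big_ord1 expr1n invr1; lra.
rewrite big_ord_recr/=; apply: (le_trans (lerD IH (lexx _))).
have n1 : 0 < n.+1%:R :> R by [].
have n2 : n.+2%:R = n.+1%:R + 1 :> R by rewrite -natr1.
rewrite n2 -addrA lerD2l addrC lerBlDr; set t : R := n.+1%:R in n1 *.
have -> : - (t + 1)^-1 + t^-1 = (t + 1) ^- 2 + t^-1 * (t + 1) ^- 2.
  by field; apply/andP; split; rewrite gt_eqF//; lra.
rewrite lerDl mulr_ge0 ?invr_ge0 ?exprn_ge0//; lra.
Qed.

(** Enlarge the list to a cube, where the sum factors into d one-dimensional sums; each of these
    splits at 0 into two sums bounded by 2. *)
Lemma sum_lattice_weight s : uniq s -> \sum_(z <- s) lattice_weight z <= 4 ^+ d.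
Proof.
move=> us; pose N := (\sum_(z <- s) l1norm z)%N.
pose bs := [seq box_point f | f : {ffun 'I_d -> 'I_(N.*2.+1)}].
apply: (@le_trans _ _ (\sum_(z <- bs) lattice_weight z)).
  have ub : uniq bs by rewrite map_inj_uniq ?enum_uniq//; exact: box_point_inj.
  have -> : \sum_(z <- s) lattice_weight z =
      \sum_(z <- [seq z <- bs | z \in s]) lattice_weight z.
    apply: perm_big; apply: uniq_perm => //; first exact: filter_uniq.
    move=> z; rewrite mem_filter; have [zs/=|//] := boolP (z \in s).
    apply/esym; have [f ->] : exists f, z = @box_point d N f.
      apply: box_pointP => i; apply: leq_trans (coord_le_l1norm _ _) _.
      by rewrite /N (big_rem z)//= leq_addr.
    by apply: map_f; rewrite mem_enum.
  rewrite big_filter [leRHS](bigID (mem s))/= lerDl.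
  by apply: sumr_ge0 => z _; exact/ltW/lattice_weight_gt0.
rewrite big_map big_enum/=.
under eq_bigr do rewrite /lattice_weight.
pose g (a : 'I_(N.*2.+1)) : R := `|a%:Z - N%:Z|.+1%:R ^- 2.
under eq_bigr => f _.
  rewrite (eq_bigr (fun i => g (f i))); last by move=> i _; rewrite mxE.
  over.
rewrite -(bigA_distr_bigA (fun _ => g)) prodr_const card_ord.
rewrite lerXn2r ?nnegrE//; first by apply: sumr_ge0 => a _; rewrite invr_ge0 exprn_ge0.
have -> : \sum_a g a = \sum_(a < N.+1) (a.+1%:R ^- 2) + \sum_(a < N) (a.+2%:R ^- 2).
  rewrite -(big_mkord xpredT (fun a : nat => `|a%:Z - N%:Z|.+1%:R ^- 2)).
  rewrite (@big_cat_nat _ _ _ N.+1)//=; last by rewrite ltnS -addnn leq_addr.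
  congr (_ + _).
    rewrite big_mkord (reindex_inj rev_ord_inj)/=.
    apply: eq_bigr => a _; congr ((_.+1)%:R ^- 2); have := ltn_ord a; lia.
  rewrite -{1}[N.+1]add0n big_addn big_mkord.
  have e : (N.*2.+1 - N.+1 = N)%N by rewrite subSS -addnn addnK.
  by rewrite e; apply: eq_bigr => a _; congr ((_.+1)%:R ^- 2); lia.
have h : \sum_(a < N) (a.+2%:R ^- 2 : R) <= 2.
  apply: le_trans (sum_inv_sqr N.+1); rewrite big_ord_recl/= lerDr invr_ge0.
  by rewrite expr1n.
have := sum_inv_sqr N.+1; lra.
Qed.

Lemma lattice_weight_lb z : (l1norm z).+1%:R ^- (d.*2) <= lattice_weight z.
Proof.
have -> : (l1norm z).+1%:R ^- (d.*2) = \prod_(i < d) ((l1norm z).+1%:R ^- 2) :> R.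
  by rewrite prodr_const card_ord -exprVn -exprVn -exprM mul2n.
apply: ler_prod => i _; rewrite invr_ge0 exprn_ge0//=.
rewrite lef_pV2 ?posrE ?exprn_gt0// lerXn2r ?nnegrE// ler_nat ltnS.
exact: coord_le_l1norm.
Qed.

End LatticeSums.

(** * Local functions of the configuration *)

Section LocalFunctions.
Context (R : realType) (d : nat).
Implicit Types (A B D E : seq 'rV[int]_d) (mu : set 'rV[int]_d)
  (F G : set 'rV[int]_d -> R).

Definition supersets D : set (set 'rV[int]_d) :=
  [set mu | forall x, x \in D -> mu x].

Definition local_on A F := forall mu, F mu = F (mu `&` [set x | x \in A]).

Lemma supersets_nil : supersets [::] = setT.
Proof. by apply/seteqP; split. Qed.

Lemma supersets_cons x D : supersets (x :: D) = [set mu | mu x] `&` supersets D.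
Proof.
apply/seteqP; split => mu /= h.
  split; first by apply: h; rewrite mem_head.
  by move=> y yD; apply: h; rewrite inE yD orbT.
by case: h => h1 h2 y; rewrite inE => /predU1P[->//|/h2].
Qed.

Lemma local_onM A B F G : local_on A F -> local_on B G ->
  local_on (undup (A ++ B)) (fun mu => F mu * G mu).
Proof.
move=> lF lG mu; rewrite lF [in RHS]lF lG [in RHS]lG.
congr (F _ * G _); rewrite -setIA; congr (_ `&` _); apply/seteqP; split => x /=.
- by move=> xA; rewrite mem_undup mem_cat xA.
- by case.
- by move=> xB; rewrite mem_undup mem_cat xB orbT.
- by case.
Qed.

(* Iterating F mu = F (mu \ x) + 1_{x \in mu} (F (mu \/ x) - F (mu \ x)) writes
   a local function as a combination of the indicators of [D \subset mu]. *)
Lemma local_expansion A F (M : R) : uniq A -> local_on A F ->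
    (forall mu, `|F mu| <= M) ->
  exists l : seq (R * seq 'rV[int]_d),
  [/\ forall mu, F mu = \sum_(p <- l) p.1 * \1_(supersets p.2) mu,
      forall p, p \in l -> uniq p.2 /\ {subset p.2 <= A} &
      \sum_(p <- l) `|p.1| <= 3 ^+ size A * M].
Proof.
elim: A F M => [|x A IH] F M /=.
  move=> _ lF FM; exists [:: (F set0, [::])]; split.
  - move=> mu; rewrite big_seq1/= supersets_nil indicT mulr1 lF; congr F.
    by apply/seteqP; split => y //= -[].
  - by move=> p; rewrite inE => /eqP ->.
  - by rewrite big_seq1 expr0 mul1r; exact: FM.
move=> /andP[xA uA] lF FM.
pose Ax := [set y | y \in A].
pose F0 mu := F (mu `&` Ax); pose F1 mu := F ([set x] `|` (mu `&` Ax)).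
have [l0 [F0E l0A l0M]] : exists l : seq (R * seq 'rV[int]_d),
  [/\ forall mu, F0 mu = \sum_(p <- l) p.1 * \1_(supersets p.2) mu,
      forall p, p \in l -> uniq p.2 /\ {subset p.2 <= A} &
      \sum_(p <- l) `|p.1| <= 3 ^+ size A * M].
  apply: IH => // mu; last exact: FM.
  by rewrite /F0 -(setIA mu) setIid.
have [l1 [F1E l1A l1M]] : exists l : seq (R * seq 'rV[int]_d),
  [/\ forall mu, F1 mu - F0 mu = \sum_(p <- l) p.1 * \1_(supersets p.2) mu,
      forall p, p \in l -> uniq p.2 /\ {subset p.2 <= A} &
      \sum_(p <- l) `|p.1| <= 3 ^+ size A * (2 * M)].
  apply: IH => // mu; first by rewrite /F0 /F1 -(setIA mu) setIid.
  by apply: le_trans (ler_normB _ _) _; rewrite mulr_natl mulr2n lerD; rewrite ?FM.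
exists (l0 ++ [seq (p.1, x :: p.2) | p <- l1]); split.
- move=> mu; rewrite big_cat big_map/= -F0E.
  under eq_bigr do rewrite supersets_cons indicI/= mulrCA.
  rewrite -mulr_sumr -F1E indicE.
  have [mux|mux] := pselect (mu x).
    rewrite mem_set//= mul1r addrC subrK lF /F1; congr F.
    apply/seteqP; split => y /=; rewrite inE.
      by move=> [muy /predU1P[->|yA]]; [left|right].
    by move=> [->|[muy yA]]; rewrite ?eqxx ?yA ?orbT.
  rewrite memNset//= mul0r addr0 lF /F0; congr F.
  apply/seteqP; split => y /=; rewrite inE; last by move=> [? ->]; rewrite orbT.
  by move=> [muy /predU1P[yx|//]]; rewrite yx in muy.
- move=> p; rewrite mem_cat => /orP[/l0A[? sub]|/mapP[q /l1A[uq sub] ->]]/=.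
    by split => // y /sub yA; rewrite inE yA orbT.
  split; first by rewrite uq andbT; apply: contra xA => /sub.
  by move=> y; rewrite !inE => /predU1P[->|/sub ->]; rewrite ?eqxx ?orbT.
- rewrite big_cat big_map/= exprS -mulrA.
  rewrite (_ : 3 * _ = 3 ^+ size A * M + 3 ^+ size A * (2 * M)) ?lerD//; ring.
Qed.

End LocalFunctions.

(** * Stationarity and clustering for local functions *)

Section ClusteringLocal.
Context (R : realType) (d : nat) (disp : measure_display).
Context (Omega : measurableType disp) (Pr : probability Omega R).
Context (calP : {mfun Omega >-> config d}).
Implicit Types (A B D E : seq 'rV[int]_d) (F G : set 'rV[int]_d -> R).

Lemma measurable_supersets D : measurable (supersets D : set (config d)).
Proof.
elim: D => [|x D IH]; first by rewrite supersets_nil.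
rewrite supersets_cons; apply: measurableI => //.
by apply: sub_sigma_algebra; exists x.
Qed.

Lemma measurable_site_event D : measurable [set w | supersets D (calP w)].
Proof.
exact: (measurable_funPTI calP (measurable_supersets D)).
Qed.

(** Events of this kind are the ones for which clustering is stated; products of their indicators
    stay in the family by [inclM]. *)
Definition incl D (w : Omega) : R := \1_(supersets D) (calP w).

Lemma inclE D : incl D = \1_[set w | supersets D (calP w)].
Proof. by apply/funext => w; rewrite /incl !indicE; congr (_%:R); rewrite !mem_setE. Qed.

Lemma bounded_rv_incl D : bounded_rv (incl D).
Proof. by rewrite inclE; apply: bounded_rv_indic; exact: measurable_site_event. Qed.

Lemma Ex_incl D : Ex Pr (incl D) = fine (Pr [set w | supersets D (calP w)]).
Proof. by rewrite inclE Ex_indic//; exact: measurable_site_event. Qed.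

Lemma inclM D E w : incl D w * incl E w = incl (D ++ E) w.
Proof.
elim: D => [|x D IH]; first by rewrite /incl supersets_nil indicT mul1r.
by rewrite cat_cons /incl !supersets_cons !indicI/= -mulrA; congr (_ * _).
Qed.

Lemma local_bounded_rv A F (M : R) : uniq A -> local_on A F ->
  (forall mu, `|F mu| <= M) -> bounded_rv (fun w => F (calP w)).
Proof.
move=> uA lF FM; have [l [FE _ _]] := local_expansion uA lF FM.
under eq_fun do rewrite FE.
by apply: bounded_rv_sum => p; apply: bounded_rvZ; exact: bounded_rv_incl.
Qed.

(** [stationary] speaks of laws on measurable sets, so F is first expanded into indicators of
    [supersets D], for which the claim is an equality of probabilities. *)
Lemma local_stationary A F (M : R) (y : 'rV[int]_d) : stationary Pr calP ->
    uniq A -> local_on A F -> (forall mu, `|F mu| <= M) ->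
  Ex Pr (fun w => F (translate y (calP w))) = Ex Pr (fun w => F (calP w)).
Proof.
move=> stP uA lF FM; have [l [FE _ _]] := local_expansion uA lF FM.
pose D' D := [seq x - y | x <- D].
have trP D w : supersets D (translate y (calP w)) <-> supersets (D' D) (calP w).
  split=> h x.
    move=> /mapP[z zD ->]; have [u Pu <-] := h _ zD.
    by rewrite addrK.
  by move=> xD; exists (x - y); [apply: h; exact: map_f|rewrite subrK].
have tr D w : \1_(supersets D) (translate y (calP w)) = incl (D' D) w :> R.
  rewrite /incl !indicE; congr (_%:R); congr (nat_of_bool _).
  by apply/idP/idP => /set_mem/trP/mem_set.
under eq_fun do (rewrite FE; under eq_bigr do rewrite tr).
rewrite Ex_sum; last by move=> p; apply: bounded_rvZ; exact: bounded_rv_incl.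
under [in RHS]eq_fun do rewrite FE.
rewrite [RHS]Ex_sum; last by move=> p; apply: bounded_rvZ; exact: bounded_rv_incl.
apply: eq_bigr => p _; rewrite !ExZ; try exact: bounded_rv_incl.
congr (_ * _); rewrite -[RHS]/(Ex Pr (incl p.2)) !Ex_incl.
rewrite -(stP y _ (measurable_supersets p.2)); congr (fine (Pr _)).
by apply/seteqP; split => w /trP.
Qed.

Section Clustering.
Context (C c : nat -> R) (phi : R -> R).
Hypothesis C0 : forall k, 0 < C k /\ 0 < c k.
Hypothesis Cm : {homo C : k l / (k <= l)%N >-> k <= l}.
Hypothesis cm : {homo c : k l / (k <= l)%N >-> l <= k}.
Hypothesis phi01 : forall s : R, 0 <= s -> 0 <= phi s <= 1.
Hypothesis phim : forall s t : R, 0 <= s -> s <= t -> phi t <= phi s.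
Hypothesis clustering :
  forall (p q : nat) (x : 'I_(p.+1 + q.+1) -> 'rV[int]_d), injective x ->
        (`| Pr (contains calP x)
            - Pr (contains calP (x \o @lshift p.+1 q.+1))
              * Pr (contains calP (x \o @rshift p.+1 q.+1)) |
         <= (C (p.+1 + q.+1)%N
             * phi (c (p.+1 + q.+1)%N * (separation x)%:R))%:E)%E.

Definition decay (K s : nat) : R := C K * phi (c K * s%:R).

Lemma decay_ge0 K s : 0 <= decay K s.
Proof.
rewrite mulr_ge0 ?(ltW (C0 _).1)//.
by have /andP[] := phi01 (mulr_ge0 (ltW (C0 K).2) (ler0n _ s)).
Qed.

(** Allows one bound on the number of points and one lower bound on the distance to serve for all
    terms of an expansion. *)
Lemma decay_le K K' s s' : (K <= K')%N -> (s' <= s)%N -> decay K s <= decay K' s'.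
Proof.
move=> KK ss; have c0 k := ltW (C0 k).2.
have := decay_ge0 K s; rewrite /decay => _.
have p0 : 0 <= phi (c K * s%:R).
  by have /andP[] := phi01 (mulr_ge0 (c0 K) (ler0n _ s)).
apply: ler_pM => //; [exact: ltW (C0 _).1|exact: Cm|].
apply: phim; first by rewrite mulr_ge0.
by rewrite ler_pM ?ler_nat//; exact: cm.
Qed.

(** The clustering inequality concerns two nonempty groups; an empty list gives a constant
    indicator, with covariance zero. As 0 < s the lists are disjoint, so their concatenation is an
    injective family. *)
Lemma clustering_incl D E K s : uniq D -> uniq E -> (size D + size E <= K)%N ->
    (0 < s)%N ->
    (forall x y, x \in D -> y \in E -> (s <= l1norm (x - y)%R)%N) ->
  `|Cov Pr (incl D) (incl E)| <= decay K s.
Proof.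
move=> uD uE DEK s0 sDE.
have incl0 w : incl [::] w = 1 by rewrite /incl supersets_nil indicT.
have [D0|D0] := eqVneq D [::].
  rewrite CovC D0 (_ : incl [::] = fun=> 1); last by apply/funext.
  by rewrite Cov_cstr ?normr0 ?decay_ge0//; exact: bounded_rv_incl.
have [E0|E0] := eqVneq E [::].
  rewrite E0 (_ : incl [::] = fun=> 1); last by apply/funext.
  by rewrite Cov_cstr ?normr0 ?decay_ge0//; exact: bounded_rv_incl.
case: D D0 uD DEK sDE => // d0 D _ uD DEK sDE.
case: E E0 uE DEK sDE => // e0 E _ uE DEK sDE.
pose p := size D; pose q := size E.
pose x (i : 'I_(p.+1 + q.+1)) := nth 0 ((d0 :: D) ++ (e0 :: E)) i.
have xinj : injective x.
  move=> i j /eqP; rewrite /x nth_uniq ?size_cat ?ltn_ord//.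
    by move/eqP/val_inj.
  rewrite cat_uniq uD uE andbT/= -[_ || has _ _]/(has (mem (d0 :: D)) (e0 :: E)).
  apply/hasPn => y yE; apply/negP => yD; have := sDE _ _ yD yE.
  rewrite subrr /l1norm big1 ?leqn0 ?(gtn_eqF s0)//.
  by move=> i' _; rewrite mxE absz0.
have xl i : x (lshift q.+1 i) = nth 0 (d0 :: D) i.
  by rewrite /x nth_cat /= ltn_ord.
have xr i : x (rshift p.+1 i) = nth 0 (e0 :: E) i.
  rewrite /x nth_cat -[size (d0 :: D)]/p.+1.
  by rewrite -[nat_of_ord (rshift _ _)]/(p.+1 + i)%N ltnNge leq_addr/= addKn.
have sepx : (s <= separation x)%N.
  rewrite /separation; apply: (big_ind (fun v => (s <= v)%N)) => [|a b sa sb|ij _] /=.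
  - by rewrite xl xr; apply: sDE; rewrite mem_nth.
  - by rewrite leq_min sa.
  - by rewrite xl xr; apply: sDE; rewrite mem_nth ?ltn_ord.
have cE (L : seq 'rV[int]_d) n (f : 'I_n -> 'rV[int]_d) :
    size L = n -> (forall i, f i = nth 0 L i) ->
  contains calP f = [set w | supersets L (calP w)].
  move=> sL fL; apply/seteqP; split => w /= h.
    move=> y yL; have iL : (index y L < n)%N by rewrite -sL index_mem.
    by apply: h; exists (Ordinal iL) => //; rewrite fL/= nth_index.
  by move=> _ [i _ <-]; rewrite fL; apply: h; rewrite mem_nth// sL.
have := clustering xinj.
rewrite (cE ((d0 :: D) ++ (e0 :: E)) _ x) ?size_cat// (cE (d0 :: D)) ?(cE (e0 :: E))//.
set PDE := Pr _; set PD := Pr [set w | supersets (d0 :: D) _].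
set PE := Pr [set w | supersets (e0 :: E) _].
have fP L : Pr [set w | supersets L (calP w)] \is a fin_num.
  by apply: fin_num_measure; exact: measurable_site_event.
rewrite /PDE /PD /PE -(fineK (fP ((d0 :: D) ++ (e0 :: E)))) -(fineK (fP (d0 :: D))) -(fineK (fP (e0 :: E))).
rewrite -EFinM -EFinB abse_EFin lee_fin => h.
rewrite /Cov; under eq_fun do rewrite inclM.
rewrite !Ex_incl; apply: le_trans h _; exact: decay_le.
Qed.

(** Both functions are expanded by [local_expansion]: the absolute coefficients sum to at most 3^|A|
    M and 3^|B| N, and each pair of indicators contributes at most [decay K s]. *)
Lemma clustering_local A B F G (M N : R) K s : uniq A -> uniq B ->
    local_on A F -> local_on B G ->
    (forall mu, `|F mu| <= M) -> (forall mu, `|G mu| <= N) ->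
    (size A + size B <= K)%N -> (0 < s)%N ->
    (forall x y, x \in A -> y \in B -> (s <= l1norm (x - y)%R)%N) ->
  `|Cov Pr (fun w => F (calP w)) (fun w => G (calP w))|
    <= 3 ^+ K * M * N * decay K s.
Proof.
move=> uA uB lF lG FM GN ABK s0 sAB.
have [l [FE lA lM]] := local_expansion uA lF FM.
have [k [GE kB kN]] := local_expansion uB lG GN.
have M0 : 0 <= M by apply: le_trans (FM set0).
have N0 : 0 <= N by apply: le_trans (GN set0).
under eq_fun do rewrite FE.
under [Y in Cov _ _ Y]eq_fun do rewrite GE.
have bi (p : R * seq 'rV[int]_d) : bounded_rv (fun w => p.1 * incl p.2 w).
  by apply: bounded_rvZ; exact: bounded_rv_incl.
rewrite Cov_suml//; last exact: bounded_rv_sum.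
under eq_bigr do rewrite Cov_sumr//.
apply: (@le_trans _ _ (\sum_(p <- l) \sum_(r <- k) `|p.1| * `|r.1| * decay K s)).
  apply: le_trans (ler_norm_sum _ _ _) _.
  rewrite big_seq [leRHS]big_seq; apply: ler_sum => p pl.
  apply: le_trans (ler_norm_sum _ _ _) _.
  rewrite big_seq [leRHS]big_seq; apply: ler_sum => r rk.
  have [up sp] := lA _ pl; have [ur sr] := kB _ rk.
  rewrite CovZl ?CovZr; try by [exact: bounded_rv_incl|].
  rewrite mulrA !normrM; apply: ler_wpM2l; first by rewrite mulr_ge0.
  apply: clustering_incl => //.
    by apply: leq_trans ABK; rewrite leq_add// uniq_leq_size.
  by move=> x y xp yr; apply: sAB; [exact: sp|exact: sr].
under eq_bigr do rewrite -mulr_suml -mulr_sumr.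
rewrite -mulr_suml -mulr_suml; apply: ler_wpM2r; first exact: decay_ge0.
apply: (@le_trans _ _ ((3 ^+ size A * M) * (3 ^+ size B * N))).
  by apply: ler_pM => //; apply: sumr_ge0.
rewrite (_ : _ * _ * _ = 3 ^+ (size A + size B) * (M * N)); last first.
  by rewrite exprD; ring.
rewrite -mulrA; apply: ler_wpM2r; first exact: mulr_ge0.
by rewrite ler_eXn2l// ltr1n.
Qed.

End Clustering.
End ClusteringLocal.

(** * Perturbation of powers *)

Section PowerBounds.
Context (R : realFieldType).
Implicit Types (u v y e : R) (m : nat).

(** Here y is a common majorant of |u| and |v|, and y >= 1 lets lower powers of y be raised to
    higher ones. It will be 1 + |U|. *)
Lemma expr_sub_le u v y e m : 1 <= y -> `|u| <= y -> `|v| <= y -> `|u - v| <= e ->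
  `|u ^+ m - v ^+ m| <= e * (m%:R * y ^+ m).
Proof.
move=> y1 uy vy uve; have y0 : 0 <= y by lra.
have e0 : 0 <= e by exact: le_trans (normr_ge0 _) uve.
elim: m => [|m IH]; first by rewrite subrr normr0 mul0r mulr0.
have -> : u ^+ m.+1 - v ^+ m.+1 = u * (u ^+ m - v ^+ m) + (u - v) * v ^+ m.
  by rewrite !exprS; ring.
apply: le_trans (ler_normD _ _) _; rewrite !normrM normrX.
have h1 : `|u| * `|u ^+ m - v ^+ m| <= y * (e * (m%:R * y ^+ m)) by exact: ler_pM.
have h2 : `|u - v| * `|v| ^+ m <= e * y ^+ m.
  by apply: ler_pM; rewrite ?exprn_ge0 ?lerXn2r ?nnegrE.
apply: le_trans (lerD h1 h2) _.
have h3 : e * y ^+ m <= e * (y * y ^+ m).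
  by apply: ler_wpM2l => //; rewrite ler_peMl// exprn_ge0.
rewrite exprS -(natr1 m); apply: le_trans (lerD (lexx _) h3) _.
by rewrite le_eqVlt; apply/orP; left; apply/eqP; ring.
Qed.

(** First-order Taylor expansion. The induction step multiplies the remainder by u and adds (m+1)
    (u-v)^2 v^m; the constants close up because (m+1)^2 + (m+1) <= (m+2)^2. *)
Lemma expr_taylor1_le u v y e m : 1 <= y -> `|u| <= y -> `|v| <= y -> `|u - v| <= e ->
  `|u ^+ m.+1 - v ^+ m.+1 - m.+1%:R * (u - v) * v ^+ m|
    <= e ^+ 2 * (m.+1%:R ^+ 2 * y ^+ m).
Proof.
move=> y1 uy vy uve; have y0 : 0 <= y by lra.
have e0 : 0 <= e by exact: le_trans (normr_ge0 _) uve.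
elim: m => [|m IH].
  by rewrite !expr1 expr0 !mulr1 mul1r subrr normr0 expr1n mulr1 exprn_ge0.
have -> : u ^+ m.+2 - v ^+ m.+2 - m.+2%:R * (u - v) * v ^+ m.+1 =
    u * (u ^+ m.+1 - v ^+ m.+1 - m.+1%:R * (u - v) * v ^+ m)
    + m.+1%:R * ((u - v) ^+ 2 * v ^+ m).
  by rewrite !exprS -(natr1 m.+1); ring.
apply: le_trans (ler_normD _ _) _; rewrite !normrM normr_nat !normrX.
have h1 := ler_pM (normr_ge0 u) (normr_ge0 _) uy IH.
have h2 : `|u - v| ^+ 2 * `|v| ^+ m <= e ^+ 2 * y ^+ m.
  by apply: ler_pM; rewrite ?exprn_ge0 ?lerXn2r ?nnegrE.
apply: le_trans (lerD h1 (ler_wpM2l (ler0n _ m.+1) h2)) _.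
have h3 : e ^+ 2 * y ^+ m <= e ^+ 2 * (y * y ^+ m).
  by apply: ler_wpM2l; rewrite ?exprn_ge0// ler_peMl// exprn_ge0.
apply: le_trans (lerD (lexx _) (ler_wpM2l (ler0n _ m.+1) h3)) _.
rewrite [y ^+ m.+1]exprS; set t := e ^+ 2 * (y * y ^+ m).
have t0 : 0 <= t by rewrite !mulr_ge0// exprn_ge0.
have -> : y * (e ^+ 2 * (m.+1%:R ^+ 2 * y ^+ m)) = m.+1%:R ^+ 2 * t by rewrite /t; ring.
have -> : e ^+ 2 * (m.+2%:R ^+ 2 * (y * y ^+ m)) = m.+2%:R ^+ 2 * t by rewrite /t; ring.
rewrite -mulrDl; apply: ler_wpM2r => //.
by rewrite -!natrX -natrD ler_nat; nia.
Qed.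

Lemma sumr_const_seq I (s : seq I) u : \sum_(i <- s) u = (size s)%:R * u.
Proof. by rewrite big_const_seq count_predT iter_addr_0 mulr_natl. Qed.

End PowerBounds.

(** Covariance bound for products of at most m+2 local variables, each seen through at most [a]
    sites, at separation [s]. The factor Q^(m+1) pays for normalized sums over all sites; in the
    application Q is of order sqrt(w_n), which the fast decay has to beat. *)
Definition mixing_error (R : realType) (C c : nat -> R) (phi : R -> R) (a : nat)
    (M Q : R) (s m : nat) : R :=
  3 ^+ (m.+2 * a) * M * Q ^+ m.+1 * decay C c phi (m.+2 * a)%N s.

(** * The moment recursion for a sum of weakly dependent local variables *)

Section MomentRecursion.
Context (R : realType) (d : nat) (disp : measure_display).
Context (Omega : measurableType disp) (Pr : probability Omega R).
Context (calP : {mfun Omega >-> config d}).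
Context (C c : nat -> R) (phi : R -> R).
Hypothesis C0 : forall k, 0 < C k /\ 0 < c k.
Hypothesis Cm : {homo C : k l / (k <= l)%N >-> k <= l}.
Hypothesis cm : {homo c : k l / (k <= l)%N >-> l <= k}.
Hypothesis phi01 : forall s : R, 0 <= s -> 0 <= phi s <= 1.
Hypothesis phim : forall s t : R, 0 <= s -> s <= t -> phi t <= phi s.
Hypothesis clustering :
  forall (p q : nat) (x : 'I_(p.+1 + q.+1) -> 'rV[int]_d), injective x ->
        (`| Pr (contains calP x)
            - Pr (contains calP (x \o @lshift p.+1 q.+1))
              * Pr (contains calP (x \o @rshift p.+1 q.+1)) |
         <= (C (p.+1 + q.+1)%N
             * phi (c (p.+1 + q.+1)%N * (separation x)%:R))%:E)%E.

Variables (A : 'rV[int]_d -> seq 'rV[int]_d) (a : nat).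
Variables (X : 'rV[int]_d -> set 'rV[int]_d -> R) (M : R).
Hypothesis uA : forall x, uniq (A x).
Hypothesis sizeA : forall x, (size (A x) <= a)%N.
Hypothesis locX : forall x, local_on (A x) (X x).
Hypothesis XM : forall x mu, `|X x mu| <= M.

Let M0 : 0 <= M. Proof. exact: le_trans (normr_ge0 _) (XM 0 set0). Qed.

Let bX x : bounded_rv (fun w => X x (calP w)).
Proof. exact: (local_bounded_rv calP (uA x) (locX x) (XM x)). Qed.

Variable (r : R).
Hypothesis r0 : 0 <= r.

Definition partial_sum (J : seq 'rV[int]_d) (w : Omega) : R :=
  r * \sum_(y <- J) X y (calP w).

Lemma bounded_rv_partial_sum J : bounded_rv (partial_sum J).
Proof. by apply: bounded_rvZ; exact: bounded_rv_sum. Qed.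

(** Induction on the power: one factor of the sum is opened and each of its terms is merged into the
    local function G, whose support grows by at most [a] sites. Each opening costs a factor r |J|
    M. *)
Lemma Cov_far_power (B D : seq 'rV[int]_d) (F G : set 'rV[int]_d -> R)
    (MF MG : R) J s K m :
    uniq B -> uniq D -> local_on B F -> local_on D G ->
    (forall mu, `|F mu| <= MF) -> (forall mu, `|G mu| <= MG) -> (0 < s)%N ->
    (size B + size D + m * a <= K)%N ->
    (forall x y, x \in B -> y \in D -> (s <= l1norm (x - y)%R)%N) ->
    (forall x y z, x \in B -> y \in J -> z \in A y -> (s <= l1norm (x - z)%R)%N) ->
  `|Cov Pr (fun w => F (calP w)) (fun w => G (calP w) * partial_sum J w ^+ m)|
    <= 3 ^+ K * MF * MG * (r * (size J)%:R * M) ^+ m * decay C c phi K s.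
Proof.
move=> uB + lF + FM + s0 + + sJ.
have bF : bounded_rv (fun w => F (calP w)) by exact: (local_bounded_rv calP uB lF FM).
elim: m D G MG => [|m IH] D G MG uD lG GM sK sD.
  under [Y in Cov _ _ Y]eq_fun do rewrite expr0 mulr1.
  rewrite expr0 mulr1; apply: (clustering_local C0 Cm cm phi01 phim clustering
    uB uD lF lG) => //.
  by move: sK; rewrite mul0n addn0.
have MF0 : 0 <= MF := le_trans (normr_ge0 _) (FM set0).
have MG0 : 0 <= MG := le_trans (normr_ge0 _) (GM set0).
have bG : bounded_rv (fun w => G (calP w)) by exact: (local_bounded_rv calP uD lG GM).
have -> : (fun w => G (calP w) * partial_sum J w ^+ m.+1) =
  (fun w => r * \sum_(y <- J) (G (calP w) * X y (calP w) * partial_sum J w ^+ m)).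
  apply/funext => w; rewrite -mulr_suml -mulr_sumr exprS.
  have -> : partial_sum J w = r * \sum_(y <- J) X y (calP w) by [].
  by ring.
have bS := bounded_rv_partial_sum J.
have bGX y : bounded_rv (fun w => G (calP w) * X y (calP w) * partial_sum J w ^+ m).
  by apply: bounded_rvM; [exact: bounded_rvM|exact: bounded_rvX].
rewrite CovZr//; last exact: bounded_rv_sum.
rewrite Cov_sumr// normrM ger0_norm//.
apply: (@le_trans _ _ (r * \sum_(y <- J)
  (3 ^+ K * MF * (MG * M) * (r * (size J)%:R * M) ^+ m * decay C c phi K s))).
  apply: ler_wpM2l => //; apply: le_trans (ler_norm_sum _ _ _) _.
  rewrite big_seq [leRHS]big_seq; apply: ler_sum => y yJ.
  apply: (IH (undup (D ++ A y)) (fun mu => G mu * X y mu)).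
  - exact: undup_uniq.
  - exact: local_onM.
  - by move=> mu; rewrite normrM ler_pM.
  - apply: leq_trans sK; rewrite mulSn addnA leq_add2r -addnA leq_add2l.
    by apply: leq_trans (size_undup _) _; rewrite size_cat leq_add2l.
  - move=> x z xB; rewrite mem_undup mem_cat => /orP[zD|zA]; first exact: sD.
    exact: sJ zA.
rewrite sumr_const_seq exprS.
by rewrite le_eqVlt; apply/orP; left; apply/eqP; ring.
Qed.

Variable J : seq 'rV[int]_d.
Hypothesis uJ : uniq J.
Hypothesis centered : forall x, x \in J -> Ex Pr (fun w => X x (calP w)) = 0.
Variables (L s b : nat).
Hypothesis s0 : (0 < s)%N.
Hypothesis sepA : forall x y x' y', (L < l1norm (x - y)%R)%N ->
  x' \in A x -> y' \in A y -> (s <= l1norm (x' - y')%R)%N.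
Hypothesis sizeL : forall x, (size [seq y <- J | (l1norm (x - y)%R <= L.*2)%N] <= b)%N.
Hypothesis rMb1 : r * M * b%:R <= 1.

Let U := partial_sum J.
Let near l x := [seq y <- J | (l1norm (x - y)%R <= l)%N].
Let far l x := [seq y <- J | (l < l1norm (x - y)%R)%N].
Let e := r * M * b%:R.
Let bU : bounded_rv U. Proof. exact: bounded_rv_partial_sum. Qed.

Let U_near_far l x w : U w = partial_sum (near l x) w + partial_sum (far l x) w.
Proof.
rewrite /U /partial_sum -mulrDr; congr (_ * _); rewrite !big_filter.
rewrite (bigID (fun y => l1norm (x - y)%R <= l)%N)/=; congr (_ + _).
by apply: eq_bigl => y; rewrite ltnNge.
Qed.

Let size_nearL x : (size (near L x) <= b)%N.
Proof.
apply: leq_trans (sizeL x); rewrite !size_filter; apply: sub_count => y /= h.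
by apply: leq_trans h _; rewrite -addnn leq_addr.
Qed.

Let near_le l x w : (size (near l x) <= b)%N -> `|partial_sum (near l x) w| <= e.
Proof.
move=> nb; rewrite normrM ger0_norm// /e -mulrA; apply: ler_wpM2l => //.
apply: le_trans (ler_norm_sum _ _ _) _.
apply: (@le_trans _ _ (\sum_(y <- near l x) M)); first exact: ler_sum.
rewrite sumr_const_seq mulrC.
by apply: ler_wpM2l => //; rewrite ler_nat.
Qed.

Let e0 : 0 <= e. Proof. by rewrite !mulr_ge0. Qed.

Let U_far l x w : (size (near l x) <= b)%N -> `|U w - partial_sum (far l x) w| <= e.
Proof. by move=> nb; rewrite (U_near_far l x) addrK near_le. Qed.

(** A common majorant of |U| and of the far sums: dropping the near sites moves U by at most e = r M
    b <= 1. *)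
Let y w := 1 + `|U w|.

Let y1 w : 1 <= y w. Proof. by rewrite lerDl. Qed.

Let Uy w : `|U w| <= y w. Proof. by rewrite lerDr. Qed.

Let far_y l x w : (size (near l x) <= b)%N -> `|partial_sum (far l x) w| <= y w.
Proof.
move=> nb; rewrite -[partial_sum _ _](subKr (U w)).
apply: le_trans (ler_normB _ _) _; rewrite addrC lerD2r.
exact: le_trans (U_far _ nb) rMb1.
Qed.

Let by_ m : bounded_rv (fun w => y w ^+ m).
Proof.
apply: bounded_rvX; apply: bounded_rvD; first exact: bounded_rv_cst.
exact: bounded_rv_norm.
Qed.

Let size_far_le l x : (size (far l x) <= size J)%N.
Proof. by rewrite size_filter count_size. Qed.

Let Q := 1 + r * (size J)%:R * M.

Let farQ l x m n : (m <= n)%N -> (r * (size (far l x))%:R * M) ^+ m <= Q ^+ n.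
Proof.
move=> mn; have Q1 : 1 <= Q by rewrite lerDl !mulr_ge0.
apply: (@le_trans _ _ (Q ^+ m)); last by rewrite ler_weXn2l.
have h : r * (size (far l x))%:R * M <= r * (size J)%:R * M.
  by apply: ler_wpM2r => //; apply: ler_wpM2l => //; rewrite ler_nat.
rewrite lerXn2r ?nnegrE ?mulr_ge0//; first exact: le_trans Q1.
by apply: le_trans h _; rewrite lerDr.
Qed.

Let D := mixing_error C c phi a M Q s.

Let decay0 K : 0 <= decay C c phi K s. Proof. exact: decay_ge0. Qed.

Let Q0 : 0 <= Q. Proof. by rewrite addr_ge0// !mulr_ge0. Qed.

Let D0 m : 0 <= D m.
Proof. by apply: mulr_ge0 (decay0 _); rewrite !mulr_ge0 ?exprn_ge0. Qed.

(* The first split level decorrelates X x from the far sum, the second one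
   decorrelates X x times its near sum. *)
Let far1 x m : x \in J ->
  `|Ex Pr (fun w => X x (calP w) * partial_sum (far L x) w ^+ m.+1)| <= D m.
Proof.
move=> xJ.
have := @Cov_far_power (A x) [::] (X x) (fun=> 1) M 1 (far L x) s (m.+2 * a)%N m.+1
  (uA x) isT (locX x) (fun=> erefl) (XM x).
have n1 : forall mu : set 'rV[int]_d, `|(1 : R)| <= 1 by move=> _; rewrite normr1.
move=> /(_ n1 s0); rewrite /Cov centered// mul0r subr0.
under eq_fun do rewrite mul1r.
move=> h; apply: le_trans (h _ _ _) _ => //.
- by rewrite addn0 [in leqRHS]mulSn leq_add2r.
- move=> x' y' z x'A; rewrite mem_filter => /andP[xy _] zA; exact: sepA xy _ _.
- rewrite mulr1; apply: ler_wpM2r => //; apply: ler_wpM2l; last exact: farQ.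
  by rewrite mulr_ge0// exprn_ge0.
Qed.

Let far2 x m : x \in J ->
  `|Cov Pr (fun w => X x (calP w) * partial_sum (near L x) w)
      (fun w => partial_sum (far L.*2 x) w ^+ m)| <= D m.
Proof.
move=> xJ.
have bS l z : bounded_rv (partial_sum (l z)) by exact: bounded_rv_partial_sum.
have -> : (fun w => X x (calP w) * partial_sum (near L x) w) =
    (fun w => r * \sum_(z <- near L x) (X x (calP w) * X z (calP w))).
  by apply/funext => w; rewrite -mulr_sumr mulrCA.
rewrite CovZl; last 2 first.
- by apply: bounded_rv_sum => z; exact: bounded_rvM.
- by apply: bounded_rvX; exact: bounded_rv_partial_sum.
rewrite Cov_suml; last 2 first.
- by move=> z; exact: bounded_rvM.
- by apply: bounded_rvX; exact: bounded_rv_partial_sum.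
rewrite normrM ger0_norm//.
pose E := 3 ^+ (m.+2 * a) * (M * M) * Q ^+ m.+1 * decay C c phi (m.+2 * a)%N s.
apply: (@le_trans _ _ (r * \sum_(z <- near L x) E)).
  apply: ler_wpM2l => //; apply: le_trans (ler_norm_sum _ _ _) _.
  rewrite big_seq [leRHS]big_seq; apply: ler_sum => z.
  rewrite mem_filter => /andP[xz zJ].
  have n1 : forall mu : set 'rV[int]_d, `|(1 : R)| <= 1 by move=> _; rewrite normr1.
  have := @Cov_far_power (undup (A x ++ A z)) [::] (fun mu => X x mu * X z mu)
    (fun=> 1) (M * M) 1 (far L.*2 x) s (m.+2 * a)%N m (undup_uniq _) isT
    (local_onM (locX x) (locX z)) (fun=> erefl).
  have n2 mu : `|X x mu * X z mu| <= M * M by rewrite normrM ler_pM.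
  move=> /(_ n2 n1 s0).
  under [Y in Cov _ _ Y]eq_fun do rewrite mul1r.
  move=> h; apply: le_trans (h _ _ _) _ => //.
  - rewrite addn0 2!mulSn addnA leq_add2r.
    by apply: leq_trans (size_undup _) _; rewrite size_cat leq_add.
  - move=> x' y' z' + + z'A; rewrite mem_undup mem_cat mem_filter => + /andP[xy _].
    case/orP => x'A; first by apply: (sepA _ x'A z'A); apply: leq_ltn_trans xy; rewrite -addnn leq_addr.
    apply: (sepA _ x'A z'A); rewrite -(ltn_add2l L) addnn; apply: (leq_trans xy).
    by apply: leq_trans (l1norm_sub_triangle z x y') _; rewrite leq_add2r.
  - rewrite mulr1; apply: ler_wpM2r => //; apply: ler_wpM2l; last exact: farQ.
    by rewrite mulr_ge0 ?exprn_ge0// mulr_ge0.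
rewrite sumr_const_seq.
(* Summing over the near sites z costs a factor r M |near|, at most r M b <= 1, so nothing is
   lost. *)
have -> : r * ((size (near L x))%:R * E) = r * M * (size (near L x))%:R * D m.
  by rewrite /E /D /mixing_error; ring.
rewrite -[leRHS]mul1r; apply: ler_wpM2r => //; apply: le_trans rMb1.
by apply: ler_wpM2l; [exact: mulr_ge0|rewrite ler_nat].
Qed.

Let near_term x : x \in J ->
  `|Ex Pr (fun w => X x (calP w) * partial_sum (near L x) w)| <= M * e.
Proof.
move=> xJ; apply: Ex_norm_bound => [|w]; last by rewrite normrM ler_pM// near_le.
by apply: bounded_rvM => //; exact: bounded_rv_partial_sum.
Qed.

(** Let N and V be the near and far sums around x, and expand U^(m+1) = (V + N)^(m+1) to first order
    in N. The mean of X_x V^(m+1) is at most D m because X_x is centred, and the remainder is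
    O(e^2). In (m+1) X_x N V^m the power is replaced by V2^m, where V2 omits all sites within 2L of
    x and thus decorrelates from X_x N. Undoing the replacements leaves (m+1) E(X_x U) E(U^m). *)
Lemma site_recursion x m : x \in J ->
  `|Ex Pr (fun w => X x (calP w) * U w ^+ m.+1)
    - m.+1%:R * Ex Pr (fun w => X x (calP w) * U w) * Ex Pr (fun w => U w ^+ m)|
  <= m.+1%:R ^+ 2 * (4 * (M * e ^+ 2) + 3 * (D m + D 0)) * Ex Pr (fun w => y w ^+ m).
Proof.
move=> xJ.
set N := partial_sum (near L x); set V := partial_sum (far L x).
set V2 := partial_sum (far L.*2 x); set T := Ex Pr (fun w => y w ^+ m).
have bN : bounded_rv N by exact: bounded_rv_partial_sum.
have bV : bounded_rv V by exact: bounded_rv_partial_sum.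
have bV2 : bounded_rv V2 by exact: bounded_rv_partial_sum.
have bx := bX x.
have nL := size_nearL x; have n2L := sizeL x.
have UVN w : U w - V w = N w by rewrite (U_near_far L x) addrK.
have T1 : 1 <= T.
  rewrite -(Ex_cst Pr 1); apply: Ex_le => [||w]; [exact: bounded_rv_cst|exact: by_|].
  by rewrite exprn_ege1.
have bXU n : bounded_rv (fun w => X x (calP w) * U w ^+ n).
  by apply: bounded_rvM => //; exact: bounded_rvX.
have bXV n : bounded_rv (fun w => X x (calP w) * V w ^+ n).
  by apply: bounded_rvM => //; exact: bounded_rvX.
have bXN : bounded_rv (fun w => X x (calP w) * N w) by exact: bounded_rvM.
(* E1 is the quadratic Taylor remainder, E2 the error of replacing V^m by V2^m next to X_x N. *)
pose E1 w := X x (calP w) * (U w ^+ m.+1 - V w ^+ m.+1 - m.+1%:R * (U w - V w) * V w ^+ m).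
pose E2 w := X x (calP w) * N w * (V w ^+ m - V2 w ^+ m).
have bE1 : bounded_rv E1.
  rewrite /E1; apply: bounded_rvM => //; apply: bounded_rvB.
    by apply: bounded_rvB; exact: bounded_rvX.
  by apply: bounded_rvM; [apply: bounded_rvZ; exact: bounded_rvB|exact: bounded_rvX].
have bE2 : bounded_rv E2.
  by rewrite /E2; apply: bounded_rvM => //; apply: bounded_rvB; exact: bounded_rvX.
have bXNV : bounded_rv (fun w => X x (calP w) * N w * V2 w ^+ m).
  by apply: bounded_rvM => //; exact: bounded_rvX.
have hE1 : `|Ex Pr E1| <= M * e ^+ 2 * m.+1%:R ^+ 2 * T.
  rewrite /T -ExZ//; apply: Ex_norm_le => //; first exact: bounded_rvZ.
  move=> w; rewrite normrM -[leRHS]mulrA -[leRHS]mulrA.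
  apply: ler_pM => //.
  by apply: expr_taylor1_le => //; [exact: far_y|exact: U_far].
have hE2 : `|Ex Pr E2| <= M * e ^+ 2 * (2 * m%:R) * T.
  rewrite /T -ExZ//; apply: Ex_norm_le => //; first exact: bounded_rvZ.
  move=> w; rewrite normrM (normrM (X x _)).
  have h1 : `|U w ^+ m - V w ^+ m| <= e * (m%:R * y w ^+ m).
    by apply: expr_sub_le => //; [exact: far_y|exact: U_far].
  have h2 : `|U w ^+ m - V2 w ^+ m| <= e * (m%:R * y w ^+ m).
    by apply: expr_sub_le => //; [exact: far_y|exact: U_far].
  have h3 : `|V w ^+ m - V2 w ^+ m| <= e * (2 * m%:R * y w ^+ m).
    apply: (@le_trans _ _ (`|U w ^+ m - V2 w ^+ m| + `|U w ^+ m - V w ^+ m|)).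
      rewrite [X in `|X|](_ : _ = (U w ^+ m - V2 w ^+ m) - (U w ^+ m - V w ^+ m)); last by ring.
      exact: ler_normB.
    by apply: le_trans (lerD h2 h1) _; rewrite le_eqVlt; apply/orP; left; apply/eqP; ring.
  rewrite (_ : M * e ^+ 2 * (2 * m%:R) * y w ^+ m = M * e * (e * (2 * m%:R * y w ^+ m))); last by ring.
  by apply: ler_pM; rewrite ?mulr_ge0//; apply: ler_pM => //; exact: near_le.
have hU2 : `|Ex Pr (fun w => V2 w ^+ m) - Ex Pr (fun w => U w ^+ m)| <= e * m%:R * T.
  rewrite -ExB; try exact: bounded_rvX.
  rewrite /T -ExZ//; apply: Ex_norm_le; first by apply: bounded_rvB; exact: bounded_rvX.
    exact: bounded_rvZ.
  by move=> w; rewrite distrC -mulrA; apply: expr_sub_le => //; [exact: far_y|exact: U_far].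
have dec1 : Ex Pr (fun w => X x (calP w) * U w ^+ m.+1) =
    Ex Pr (fun w => X x (calP w) * V w ^+ m.+1) + (Ex Pr E1
      + m.+1%:R * (Ex Pr E2 + Ex Pr (fun w => X x (calP w) * N w * V2 w ^+ m))).
  rewrite -(ExD Pr bE2 bXNV) -ExZ; last exact: bounded_rvD.
  rewrite -ExD//; last by apply: bounded_rvZ; exact: bounded_rvD.
  rewrite -ExD//; last by apply: bounded_rvD => //; apply: bounded_rvZ; exact: bounded_rvD.
  by congr Ex; apply/funext => w; rewrite /E1 /E2 -UVN; ring.
have dec2 : Ex Pr (fun w => X x (calP w) * U w) =
    Ex Pr (fun w => X x (calP w) * V w) + Ex Pr (fun w => X x (calP w) * N w).
  rewrite -ExD//; last exact: bounded_rvM.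
  by congr Ex; apply/funext => w; rewrite -UVN; ring.
have f1 := far1 m xJ; have f10 := far1 0 xJ; have f2 := far2 m xJ; have nt := near_term xJ.
rewrite -/N -/V -/V2 in f1 f10 f2 nt.
have f10' : `|Ex Pr (fun w => X x (calP w) * V w)| <= D 0 by exact: f10.
rewrite /Cov in f2; rewrite dec1 dec2.
have hUT : `|Ex Pr (fun w => U w ^+ m)| <= T.
  apply: Ex_norm_le => //; first exact: bounded_rvX.
  by move=> w; rewrite normrX lerXn2r ?nnegrE//; exact: le_trans (y1 w).
(* From here on the expectations are plain real numbers, and six error terms are bounded separately
   and added. *)
move: (Ex Pr E1) (Ex Pr E2) hE1 hE2 f1 f2 nt hU2 f10' hUT => a1 a2.
move: (Ex Pr (fun w => X x (calP w) * V w ^+ m.+1)) => a3.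
move: (Ex Pr (fun w => X x (calP w) * N w * V2 w ^+ m)) => a4.
move: (Ex Pr (fun w => X x (calP w) * N w)) => a5.
move: (Ex Pr (fun w => V2 w ^+ m)) (Ex Pr (fun w => U w ^+ m)) => a6 a7.
move: (Ex Pr (fun w => X x (calP w) * V w)) => a8.
move=> hE1 hE2 f1 f2 nt hU2 f10' hUT.
pose k : R := m.+1%:R.
have k1 : 1 <= k by rewrite ler1n.
have mk : m%:R <= k by rewrite ler_nat.
rewrite -/k.
have -> : a3 + (a1 + k * (a2 + a4)) - k * (a8 + a5) * a7 =
   a3 + a1 + k * a2 + k * (a4 - a5 * a6) + k * (a5 * (a6 - a7)) - k * (a8 * a7) by ring.
have T0 : 0 <= T by lra.
have Me0 : 0 <= M * e ^+ 2 by rewrite mulr_ge0// exprn_ge0.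
have b3 : `|a3| <= k ^+ 2 * D m * T.
  apply: le_trans f1 _; rewrite -[leLHS]mul1r -[leLHS]mulr1.
  apply: ler_pM => //; first by rewrite mul1r.
  by apply: ler_wpM2r => //; rewrite exprn_ege1.
have b4 : `|k * (a4 - a5 * a6)| <= k ^+ 2 * D m * T.
  rewrite normrM ger0_norm; last lra.
  apply: (@le_trans _ _ (k * D m)); first by apply: ler_wpM2l => //; lra.
  rewrite -[leLHS]mulr1; apply: ler_pM => //; first by rewrite mulr_ge0//; lra.
  by apply: ler_wpM2r => //; rewrite expr2 ler_peMl//; lra.
have b5 : `|k * (a5 * (a6 - a7))| <= k ^+ 2 * (M * e ^+ 2) * T.
  rewrite !normrM (@ger0_norm _ k); last lra.
  apply: (@le_trans _ _ (k * ((M * e) * (e * m%:R * T)))).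
    by apply: ler_wpM2l; [lra|exact: ler_pM].
  rewrite (_ : k * _ = k * m%:R * (M * e ^+ 2) * T); last by ring.
  apply: ler_wpM2r => //; apply: ler_wpM2r => //; rewrite expr2.
  by apply: ler_wpM2l => //; lra.
have b8 : `|k * (a8 * a7)| <= k ^+ 2 * D 0 * T.
  rewrite !normrM (@ger0_norm _ k); last lra.
  apply: (@le_trans _ _ (k * (D 0 * T))).
    by apply: ler_wpM2l; [lra|exact: ler_pM].
  rewrite mulrA; apply: ler_wpM2r => //; apply: ler_wpM2r => //.
  by rewrite expr2 ler_peMl//; lra.
have b2 : `|k * a2| <= k ^+ 2 * (2 * (M * e ^+ 2)) * T.
  rewrite !normrM (@ger0_norm _ k); last lra.
  apply: (@le_trans _ _ (k * (M * e ^+ 2 * (2 * m%:R) * T))).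
    by apply: ler_wpM2l; [lra|].
  rewrite (_ : k * _ = k * m%:R * (2 * (M * e ^+ 2)) * T); last by ring.
  apply: ler_wpM2r => //; apply: ler_wpM2r => //; first by rewrite mulr_ge0.
  by rewrite expr2 ler_wpM2l//; lra.
have b1 : `|a1| <= k ^+ 2 * (M * e ^+ 2) * T.
  by rewrite (_ : _ * _ * T = M * e ^+ 2 * k ^+ 2 * T)//; ring.
apply: (@le_trans _ _ (`|a3| + `|a1| + `|k * a2| + `|k * (a4 - a5 * a6)|
    + `|k * (a5 * (a6 - a7))| + `|k * (a8 * a7)|)).
  apply: le_trans (ler_normB _ _) _; rewrite lerD2r.
  apply: le_trans (ler_normD _ _) _; rewrite lerD2r.
  apply: le_trans (ler_normD _ _) _; rewrite lerD2r.
  apply: le_trans (ler_normD _ _) _; rewrite lerD2r.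
  exact: ler_normD.
apply: le_trans (lerD (lerD (lerD (lerD (lerD b3 b1) b2) b4) b5) b8) _.
have d1 : 0 <= k ^+ 2 * D m * T.
  by apply: mulr_ge0 => //; apply: mulr_ge0 (D0 m); rewrite exprn_ge0//; lra.
have d2 : 0 <= k ^+ 2 * D 0 * T.
  by apply: mulr_ge0 => //; apply: mulr_ge0 (D0 0); rewrite exprn_ge0//; lra.
(* The six bounds use D m twice and D 0 once; the remaining terms are slack that makes the constant
   symmetric. *)
rewrite (_ : k ^+ 2 * (4 * (M * e ^+ 2) + 3 * (D m + D 0)) * T =
  k ^+ 2 * D m * T + k ^+ 2 * (M * e ^+ 2) * T + k ^+ 2 * (2 * (M * e ^+ 2)) * T
  + k ^+ 2 * D m * T + k ^+ 2 * (M * e ^+ 2) * T + k ^+ 2 * D 0 * T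
  + (k ^+ 2 * D m * T + 2 * (k ^+ 2 * D 0 * T))); last by ring.
rewrite lerDl; lra.
Qed.

(** One factor of U^(m+2) is written as r times the sum of the X_x, and [site_recursion] is summed
    over x. For a centred Gaussian variable the left side is zero: this is integration by parts for
    moments. *)
Lemma moment_recursion m :
  `|Ex Pr (fun w => U w ^+ m.+2)
    - m.+1%:R * Ex Pr (fun w => U w ^+ 2) * Ex Pr (fun w => U w ^+ m)|
  <= r * (size J)%:R * (m.+1%:R ^+ 2 * (4 * (M * (r * M * b%:R) ^+ 2)
       + 3 * (mixing_error C c phi a M (1 + r * (size J)%:R * M) s m
              + mixing_error C c phi a M (1 + r * (size J)%:R * M) s 0)))
     * Ex Pr (fun w => (1 + `|U w|) ^+ m).
Proof.
have sumU n : Ex Pr (fun w => U w ^+ n.+1) =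
    r * \sum_(x <- J) Ex Pr (fun w => X x (calP w) * U w ^+ n).
  have bXU x : bounded_rv (fun w => X x (calP w) * U w ^+ n).
    by apply: bounded_rvM => //; exact: bounded_rvX.
  rewrite -Ex_sum// -ExZ; last exact: bounded_rv_sum.
  congr Ex; apply/funext => w; rewrite exprS {1}/U /partial_sum -mulrA mulr_suml.
  by [].
rewrite (sumU m.+1) (sumU 1).
rewrite (_ : _ - _ = r * \sum_(x <- J) (Ex Pr (fun w => X x (calP w) * U w ^+ m.+1)
    - m.+1%:R * Ex Pr (fun w => X x (calP w) * U w) * Ex Pr (fun w => U w ^+ m))); last first.
  rewrite sumrB mulrBr; congr (_ - _).
  by rewrite -mulr_suml -mulr_sumr; ring.
rewrite normrM ger0_norm// -[leRHS]mulrA -[leRHS]mulrA; apply: ler_wpM2l => //.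
apply: le_trans (ler_norm_sum _ _ _) _.
set G := _ * Ex _ _.
apply: (@le_trans _ _ (\sum_(x <- J) G)).
  rewrite big_seq [leRHS]big_seq; apply: ler_sum => x xJ.
  exact: site_recursion.
by rewrite sumr_const_seq.
Qed.

End MomentRecursion.

(** * Choice of the splitting radius and asymptotics of the recursion *)

Section FastDecrease.
Context (R : realType).

(** For s > k one has s + 1 <= (k + 2) (s - k), so the shift by k and the scaling by c cost only the
    constant B. One extra power of s + 1 is inserted because fast decrease is stated for exponents
    at least 1. *)
Lemma fast_decreasing_natP (phi : R -> R) (c : R) k P : fast_decreasing phi -> 0 < c ->
  s.+1%:R ^+ P * phi (c * (s - k)%:R) @[s --> \oo] --> (0 : R).
Proof.
move=> [phi01 phim fast] c0.
have phi0 (s : nat) : 0 <= phi (c * s%:R).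
  by have /andP[] := phi01 _ (mulr_ge0 (ltW c0) (ler0n _ s)).
pose B : R := (k.+2%:R / c) ^+ P.+1.
have B0 : 0 < B by rewrite exprn_gt0// divr_gt0.
apply/cvgrPdist_le => e e0.
have /cvgrPdist_le /(_ _ (divr_gt0 e0 B0)) [A [Ar hA]] := fast P.+1 isT.
near=> s.
have s1 : (k.+1 <= s)%N by near: s; exact: nbhs_infty_ge.
rewrite sub0r normrN ger0_norm; last by rewrite mulr_ge0// exprn_ge0.
have As : A < c * (s - k)%:R.
  rewrite -ltr_pdivrMl// natrB; last exact: ltnW.
  by rewrite ltrBrDr; near: s; exact: nbhs_infty_gtr.
have /= := hA _ As; rewrite sub0r normrN => /(le_trans (ler_norm _)).
rewrite ler_pdivlMr// => h; apply: le_trans h.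
rewrite mulrAC; apply: ler_wpM2r => //.
rewrite /B -exprMn [_ * (_ / c)](_ : _ = (s - k)%:R * k.+2%:R); last first.
  by field; rewrite gt_eqF.
apply: (@le_trans _ _ (s.+1%:R ^+ P.+1)).
  by rewrite ler_weXn2l// ler1n.
by rewrite lerXn2r ?nnegrE ?mulr_ge0// -natrM ler_nat; nia.
Unshelve. all: by end_near. Qed.

End FastDecrease.

Section AsymptoticRecursion.
Context (R : realType) (d : nat) (disp : measure_display).
Context (Omega : measurableType disp) (Pr : probability Omega R).
Context (calP : {mfun Omega >-> config d}).
Context (C c : nat -> R) (phi : R -> R).
Hypothesis d0 : (0 < d)%N.
Hypothesis C0 : forall k, 0 < C k /\ 0 < c k.
Hypothesis Cm : {homo C : k l / (k <= l)%N >-> k <= l}.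
Hypothesis cm : {homo c : k l / (k <= l)%N >-> l <= k}.
Hypothesis fast : fast_decreasing phi.
Hypothesis clustering :
  forall (p q : nat) (x : 'I_(p.+1 + q.+1) -> 'rV[int]_d), injective x ->
        (`| Pr (contains calP x)
            - Pr (contains calP (x \o @lshift p.+1 q.+1))
              * Pr (contains calP (x \o @rshift p.+1 q.+1)) |
         <= (C (p.+1 + q.+1)%N
             * phi (c (p.+1 + q.+1)%N * (separation x)%:R))%:E)%E.

Variables (A : 'rV[int]_d -> seq 'rV[int]_d) (a k : nat) (M : R).
Variable X : nat -> 'rV[int]_d -> set 'rV[int]_d -> R.
Hypothesis uA : forall x, uniq (A x).
Hypothesis sizeA : forall x, (size (A x) <= a)%N.
Hypothesis radA : forall x y, y \in A x -> (l1norm (x - y)%R <= k)%N.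
Hypothesis locX : forall n x, local_on (A x) (X n x).
Hypothesis XM : forall n x mu, `|X n x mu| <= M.
Hypothesis centered : forall n x, Ex Pr (fun w => X n x (calP w)) = 0.

Definition normalized_sum n : Omega -> R :=
  partial_sum calP (X n) (Num.sqrt (wcard d n)%:R)^-1 (ball_seq d n).

Lemma bounded_rv_normalized_sum n : bounded_rv (normalized_sum n).
Proof. exact: (bounded_rv_partial_sum calP uA (locX n) (XM n)). Qed.

Let M0 : 0 <= M. Proof. exact: le_trans (normr_ge0 _) (XM 0 0 set0). Qed.

Let phi01 : forall s : R, 0 <= s -> 0 <= phi s <= 1. Proof. by case: fast. Qed.
Let phim : forall s t : R, 0 <= s -> s <= t -> phi t <= phi s.
Proof. by case: fast. Qed.

(** The splitting radius l is the integer with l^q <= n + 1 < (l + 1)^q. As w_n is at least of order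
    n, sqrt(w_n) is at least of order l^(2d+1), which beats the square of the number O(l^d) of near
    sites; and every power of w_n is still bounded by a power of l + 1. *)
Let q := (2 * d.*2.+1)%N.

Let root_ex n : exists l, (l ^ q <= n.+1 < l.+1 ^ q)%N.
Proof.
have q0 : (0 < q)%N by [].
have ex0 : exists l, (l ^ q <= n.+1)%N by exists 0%N; rewrite exp0n.
have ub l : (l ^ q <= n.+1)%N -> (l <= n.+1)%N.
  by move=> h; apply: leq_trans h; rewrite -[leqLHS]expn1; case: l => [|l]; rewrite ?exp0n// leq_pexp2l.
case: (ex_maxnP ex0 ub) => l lq lmax; exists l; rewrite lq/= ltnNge.
by apply/negP => /lmax; rewrite ltnn.
Qed.

(** [moment_recursion] on W_n with r = w_n^(-1/2). Summed over all sites, the Taylor errors are of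
    order b^2 / sqrt(w_n) = O(1/l), and the mixing errors are a power of w_n times the decay at
    distance of order l. *)
Lemma asymptotic_recursion m : exists eps : nat -> R,
  eps @ \oo --> (0 : R) /\
  \forall n \near \oo,
  `|Ex Pr (fun w => normalized_sum n w ^+ m.+2)
    - m.+1%:R * Ex Pr (fun w => normalized_sum n w ^+ 2)
      * Ex Pr (fun w => normalized_sum n w ^+ m)|
  <= eps n * Ex Pr (fun w => (1 + `|normalized_sum n w|) ^+ m).
Proof.
have [l lP] := choice root_ex.
have l_gt0 n : (0 < l n)%N.
  by case: (l n) (lP n) => //; rewrite exp1n ltnS ltn0 andbF.
have l_infty : l n @[n --> \oo] --> \oo.
  apply/cvgnyPge => N; near=> n.
  rewrite leqNgt; apply/negP => lN; have /andP[_] := lP n.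
  rewrite ltnNge => /negP; apply; apply: (@leq_trans (N ^ q)).
    by rewrite leq_exp2r.
  by apply: leqW; near: n; exact: nbhs_infty_ge.
pose w n : R := (wcard d n)%:R; pose r n := (Num.sqrt (w n))^-1.
have w1 n : 1 <= w n by rewrite ler1n wcard_gt0.
have sw1 n : 1 <= Num.sqrt (w n) by rewrite -[leLHS]sqrtr1 ler_sqrt// (lt_le_trans _ (w1 n)).
have r0 n : 0 <= r n by rewrite invr_ge0.
have rw n : r n * w n = Num.sqrt (w n).
  rewrite /r -[X in _ * X](@sqr_sqrtr _ (w n)); last exact: le_trans (w1 n).
  by rewrite expr2 mulKf// gt_eqF// (lt_le_trans _ (sw1 n)).
have sw_le n : Num.sqrt (w n) <= w n.
  by rewrite -{2}(@sqr_sqrtr _ (w n)) ?expr2 ?ler_peMl.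
pose b n := ((l n).*2.*2.+1 ^ d)%N.
have w_lb n : (l n)%:R ^+ (d.*2.+1) <= (d ^ d)%:R * Num.sqrt (w n).
  have dd1 : (1 <= d ^ d)%N by rewrite expn_gt0 d0.
  have h : ((l n)%:R ^+ d.*2.+1) ^+ 2 <= (d ^ d)%:R * w n.
    rewrite -exprM mulnC -natrX -natrM ler_nat.
    have /andP[h _] := lP n; apply: leq_trans h _; exact: wcard_lb1.
  rewrite -(@ler_pXn2r _ 2)// ?nnegrE ?mulr_ge0 ?exprn_ge0//.
  apply: (le_trans h); rewrite exprMn sqr_sqrtr; last exact: le_trans (w1 n).
  by apply: ler_wpM2r; [exact: le_trans (w1 n)|rewrite -natrX ler_nat leq_pmulr].
have w_ub n : w n <= 2 ^+ d * (l n).+1%:R ^+ (q * d).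
  rewrite /w -!natrX -natrM ler_nat; apply: leq_trans (wcard_ub _ _) _.
  rewrite expnM -expnMn leq_exp2r//; have /andP[_ h] := lP n; lia.
have b1 n : 1 <= (b n)%:R :> R by rewrite ler1n expn_gt0.
have b_ub n : (b n)%:R ^+ 2 * r n <= (25 ^ d * d ^ d)%:R / (l n)%:R.
  have ln0 : 0 < (l n)%:R :> R by rewrite ltr0n.
  rewrite ler_pdivlMr// mulrAC ler_pdivrMr; last exact: lt_le_trans (sw1 n).
  apply: (@le_trans _ _ ((25 ^ d)%:R * (l n)%:R ^+ d.*2.+1)).
    rewrite -!natrX -!natrM ler_nat [in leqRHS]expnSr mulnA leq_mul2r; apply/orP; right.
    rewrite /b -expnM (mulnC d) expnM -[in leqRHS]mul2n [in leqRHS]expnM -expnMn leq_exp2r//.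
    rewrite (_ : 25 = 5 ^ 2)%N// -expnMn leq_exp2r//; have := l_gt0 n; lia.
  by rewrite natrM -mulrA; apply: ler_wpM2l.
have b_cvg : (b n)%:R ^+ 2 * r n @[n --> \oo] --> (0 : R).
  apply: (@squeeze_cvgr _ _ _ _ (fun=> 0 : R) (fun n => (25 ^ d * d ^ d)%:R / (l n)%:R)).
  - by near=> n; rewrite b_ub mulr_ge0 ?exprn_ge0.
  - exact: cvg_cst.
  - rewrite -[X in _ --> X](mulr0 (25 ^ d * d ^ d)%:R); apply: cvgMr.
    apply: (@cvg_comp _ _ _ l (fun n : nat => n%:R^-1)); first exact: l_infty.
    apply/gtr0_cvgV0; last exact: cvgr_idn.
    by near=> n; rewrite ltr0n; near: n; exact: nbhs_infty_gt.
(* Sites more than l apart have supports of radius k, hence at distance at least l - 2k. *)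
pose s n := (l n - k.*2)%N.
pose Q n := 1 + r n * w n * M.
have Q0 n : 0 <= Q n by rewrite addr_ge0// !mulr_ge0// (le_trans _ (w1 n)).
have me_cvg j : Num.sqrt (w n) * mixing_error C c phi a M (Q n) (s n) j @[n --> \oo] --> (0 : R).
  pose K := (j.+2 * a)%N.
  (* Since Q <= (1 + M) w and w <= 2^d (l+1)^(q d), the product sqrt(w) Q^(j+1) is at most a
     constant times (l+1)^(q d (j+2)). *)
  pose K1 := 3 ^+ K * M * ((1 + M) ^+ j.+1 * (2 ^+ d) ^+ j.+2) * C K.
  have K10 : 0 <= K1.
    apply: mulr_ge0 (ltW (C0 K).1); apply: mulr_ge0; first by rewrite mulr_ge0 ?exprn_ge0.
    by apply: mulr_ge0; rewrite exprn_ge0 ?exprn_ge0 ?addr_ge0.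
  apply: (@squeeze_cvgr _ _ _ _ (fun=> 0 : R)
    (fun n => K1 * ((l n).+1%:R ^+ (q * d * j.+2) * phi (c K * (l n - k.*2)%:R)))).
  - near=> n; have ph0 : 0 <= phi (c K * (l n - k.*2)%:R).
      by have /andP[] := phi01 (mulr_ge0 (ltW (C0 K).2) (ler0n _ (l n - k.*2)%N)).
    have sw0 : 0 <= Num.sqrt (w n) by [].
    apply/andP; split.
      rewrite /mixing_error /decay mulr_ge0// mulr_ge0//; last by rewrite mulr_ge0// (ltW (C0 K).1).
      by rewrite !mulr_ge0 ?exprn_ge0.
    rewrite /mixing_error /decay -/K.
    rewrite [leLHS](_ : _ = 3 ^+ K * M * (Num.sqrt (w n) * Q n ^+ j.+1) * C K * phi (c K * (s n)%:R)); last by ring.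
    rewrite mulrA; apply: ler_wpM2r => //.
    rewrite /K1 [leRHS]mulrAC; apply: ler_wpM2r; first exact: ltW (C0 K).1.
    rewrite -[leRHS]mulrA; apply: ler_wpM2l; first by rewrite mulr_ge0// exprn_ge0.
    apply: (@le_trans _ _ (w n * ((1 + M) * w n) ^+ j.+1)).
      apply: ler_pM => //; first exact: exprn_ge0.
      rewrite lerXn2r ?nnegrE//; last first.
        rewrite /Q rw mulrDl mul1r; apply: lerD => //.
        by rewrite mulrC; apply: ler_wpM2l.
      by rewrite mulr_ge0 ?addr_ge0// (le_trans _ (w1 n)).
    rewrite exprMn mulrCA -exprS -mulrA; apply: ler_wpM2l.
      by rewrite exprn_ge0// addr_ge0.
    by rewrite exprM -exprMn lerXn2r ?nnegrE// ?mulr_ge0 ?exprn_ge0.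
  - exact: cvg_cst.
  - rewrite -[X in _ --> X](mulr0 K1); apply: cvgMr.
    apply: (@cvg_comp _ _ _ l (fun i : nat => i.+1%:R ^+ (q * d * j.+2) * phi (c K * (i - k.*2)%:R))).
      exact: l_infty.
    by apply: fast_decreasing_natP => //; exact: (C0 K).2.
exists (fun n => r n * w n * (m.+1%:R ^+ 2 * (4 * (M * (r n * M * (b n)%:R) ^+ 2)
       + 3 * (mixing_error C c phi a M (Q n) (s n) m
              + mixing_error C c phi a M (Q n) (s n) 0)))); split.
  rewrite (_ : (fun n => _) = (fun n => m.+1%:R ^+ 2 * (4 * M ^+ 3 * ((b n)%:R ^+ 2 * r n)
    + 3 * (Num.sqrt (w n) * mixing_error C c phi a M (Q n) (s n) m
    + Num.sqrt (w n) * mixing_error C c phi a M (Q n) (s n) 0)))); last first.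
    apply/funext => n; rewrite -rw.
    have rwr : r n * w n * r n ^+ 2 = r n.
      by rewrite rw /r expr2 mulVKf// gt_eqF// (lt_le_trans _ (sw1 n)).
    rewrite (_ : r n * w n * (_ * _) = m.+1%:R ^+ 2 * (4 * M ^+ 3 *
      ((b n)%:R ^+ 2 * (r n * w n * r n ^+ 2))
    + 3 * (r n * w n * mixing_error C c phi a M (Q n) (s n) m
    + r n * w n * mixing_error C c phi a M (Q n) (s n) 0))); last by ring.
    by rewrite rwr.
  rewrite -[X in _ --> X](mulr0 (m.+1%:R ^+ 2)); apply: cvgMr.
  rewrite -[X in _ --> X](_ : 4 * M ^+ 3 * 0 + 3 * (0 + 0) = 0); last by ring.
  by apply: cvgD; apply: cvgMr => //; apply: cvgD.
have rMb_near : \forall n \near \oo, M * ((b n)%:R ^+ 2 * r n) <= 1.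
  have h : M * ((b n)%:R ^+ 2 * r n) @[n --> \oo] --> (0 : R).
    by rewrite -[X in _ --> X](mulr0 M); exact: cvgMr.
  exact: (cvgr_le _ h _ ltr01).
near=> n.
apply: (moment_recursion C0 Cm cm phi01 phim clustering uA sizeA (locX n) (XM n)
  (r0 n) (J := ball_seq d n) (fun x _ => centered n x) (L := l n)).
- by rewrite subn_gt0; near: n; move/cvgnyPge: l_infty => /(_ k.*2.+1).
- move=> x y x' y' xy x'A y'A; rewrite /s leq_subLR.
  have h1 := radA x'A; have h2 := radA y'A; rewrite l1normC in h2.
  have h3 := l1norm_sub_triangle x' x y; have h4 := l1norm_sub_triangle y' x' y.
  move: (l1norm _) (l1norm _) (l1norm _) (l1norm _) (l1norm _) xy h1 h2 h3 h4.
  by move=> *; lia.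
- by move=> x; apply: size_near; exact: uniq_ball_seq.
- apply: (@le_trans _ _ (M * ((b n)%:R ^+ 2 * r n))).
    rewrite -mulrA mulrCA [r n * _]mulrC; apply: ler_wpM2l => //; apply: ler_wpM2r => //.
    by rewrite expr2 ler_peMl// (le_trans _ (b1 n)).
  by near: n; exact: rMb_near.
Unshelve. all: by end_near. Qed.

End AsymptoticRecursion.

(** * From the recursion to convergence of all moments *)

Section MomentLimits.
Context (R : realType).

(** The moments of N(0, v), in the recursive form that the moment recursion reproduces in the
    limit. *)
Fixpoint gauss_moment (v : R) (m : nat) : R :=
  match m with
  | 0 => 1
  | 1 => 0
  | m'.+2 => m'.+1%:R * v * gauss_moment v m'
  end.

Context (disp : measure_display) (T : measurableType disp) (P : probability T R).
Variables (U : nat -> T -> R) (v : R).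
Hypothesis bU : forall n, bounded_rv (U n).
Hypothesis U1 : forall n, Ex P (U n) = 0.
Hypothesis U2 : Ex P (fun w => U n w ^+ 2) @[n --> \oo] --> v.
Hypothesis recU : forall m, exists eps : nat -> R,
  eps @ \oo --> (0 : R) /\
  \forall n \near \oo,
  `|Ex P (fun w => U n w ^+ m.+2)
    - m.+1%:R * Ex P (fun w => U n w ^+ 2) * Ex P (fun w => U n w ^+ m)|
  <= eps n * Ex P (fun w => (1 + `|U n w|) ^+ m).

Let bUm n m : bounded_rv (fun w => U n w ^+ m).
Proof. exact: bounded_rvX. Qed.

Let bY n m : bounded_rv (fun w => (1 + `|U n w|) ^+ m).
Proof.
apply: bounded_rvX; apply: bounded_rvD; first exact: bounded_rv_cst.
exact: bounded_rv_norm.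
Qed.

Let Y0 n m : 0 <= Ex P (fun w => (1 + `|U n w|) ^+ m).
Proof. by apply: Ex_ge0 => w; rewrite exprn_ge0// addr_ge0. Qed.

(** Absolute moments are controlled by an even one, where |U| and U have the same power; the two
    cases compare |U| with 1. *)
Let Y_le n k m : (m <= k.*2)%N ->
  Ex P (fun w => (1 + `|U n w|) ^+ m)
    <= 2 ^+ k.*2 * (1 + Ex P (fun w => U n w ^+ k.*2)).
Proof.
move=> mk.
have -> : 1 + Ex P (fun w => U n w ^+ k.*2) = Ex P (fun w => 1 + U n w ^+ k.*2).
  by rewrite ExD ?Ex_cst//; exact: bounded_rv_cst.
have b2 : bounded_rv (fun w => 1 + U n w ^+ k.*2).
  by apply: bounded_rvD => //; exact: bounded_rv_cst.
rewrite -ExZ//; apply: Ex_le => // [|w]; first exact: bounded_rvZ.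
apply: (@le_trans _ _ ((1 + `|U n w|) ^+ k.*2)).
  by rewrite ler_weXn2l// lerDl.
have ev : U n w ^+ k.*2 = `|U n w| ^+ k.*2.
  by rewrite -normrX ger0_norm// -mul2n exprM exprn_ge0// sqr_ge0.
rewrite ev; have [u1|u1] := leP `|U n w| 1.
  apply: (@le_trans _ _ (2 ^+ k.*2 * 1)).
    by rewrite mulr1 lerXn2r ?nnegrE ?addr_ge0//; lra.
  by apply: ler_wpM2l; rewrite ?exprn_ge0// lerDl exprn_ge0.
apply: (@le_trans _ _ (2 ^+ k.*2 * `|U n w| ^+ k.*2)).
  by rewrite -exprMn lerXn2r ?nnegrE ?addr_ge0 ?mulr_ge0//; lra.
by apply: ler_wpM2l; rewrite ?exprn_ge0// lerDr.
Qed.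

(** The recursion bounds the moment of order 2k + 2 through the one of order 2k, because by [Y_le]
    its error also involves order 2k only. *)
Let even_moment_bounded k :
  exists B, 0 <= B /\ \forall n \near \oo, Ex P (fun w => U n w ^+ k.*2) <= B.
Proof.
elim: k => [|k [B [B0 hB]]].
  exists 1; split => //; near=> n.
  under eq_fun do rewrite expr0.
  by rewrite Ex_cst.
have [eps [eps0 rec]] := recU k.*2.
pose B' := k.*2.+1%:R * (`|v| + 1) * B + 1 * (2 ^+ k.*2 * (1 + B)).
have U2b : \forall n \near \oo, Ex P (fun w => U n w ^+ 2) <= `|v| + 1.
  by apply: (cvgr_le _ U2); rewrite (le_lt_trans (ler_norm v))// ltrDl.
have epsb : \forall n \near \oo, eps n <= 1 by exact: (cvgr_le _ eps0).
exists B'; split.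
  by rewrite addr_ge0// !mulr_ge0 ?addr_ge0// ?exprn_ge0.
near=> n.
have ek : 0 <= Ex P (fun w => U n w ^+ k.*2).
  by apply: Ex_ge0 => w; rewrite -mul2n exprM exprn_ge0// sqr_ge0.
have hBn : Ex P (fun w => U n w ^+ k.*2) <= B by near: n.
have hrec : `|Ex P (fun w => U n w ^+ k.*2.+2)
    - k.*2.+1%:R * Ex P (fun w => U n w ^+ 2) * Ex P (fun w => U n w ^+ k.*2)|
  <= eps n * Ex P (fun w => (1 + `|U n w|) ^+ k.*2) by near: n.
rewrite doubleS; set E2 := Ex P _; rewrite -/E2 in hrec.
have -> : E2 = (k.*2.+1%:R * Ex P (fun w => U n w ^+ 2) * Ex P (fun w => U n w ^+ k.*2))
  + (E2 - k.*2.+1%:R * Ex P (fun w => U n w ^+ 2) * Ex P (fun w => U n w ^+ k.*2)) by ring.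
apply: lerD; last first.
  apply: le_trans (ler_norm _) (le_trans hrec _).
  apply: (@le_trans _ _ (1 * Ex P (fun w => (1 + `|U n w|) ^+ k.*2))).
    by apply: ler_wpM2r => //; near: n.
  apply: ler_wpM2l => //; apply: le_trans (Y_le n (leqnn _)) _.
  by apply: ler_wpM2l; rewrite ?exprn_ge0// lerD2l.
have e20 : 0 <= Ex P (fun w => U n w ^+ 2) by apply: Ex_ge0 => w; exact: sqr_ge0.
apply: ler_pM => //; first by rewrite mulr_ge0.
by apply: ler_wpM2l => //; near: n.
Unshelve. all: by end_near. Qed.

(** Strong induction in steps of two. The error is eps times an absolute moment of order m, which is
    bounded through the even order 2m. *)
Lemma moments_cvg m : Ex P (fun w => U n w ^+ m) @[n --> \oo] --> gauss_moment v m.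
Proof.
elim/ltn_ind: m => -[|[|m]] IH.
- rewrite (_ : (fun n => _) = fun=> 1); first exact: cvg_cst.
  by apply/funext => n; under eq_fun do rewrite expr0; rewrite Ex_cst.
- rewrite (_ : (fun n => _) = fun=> 0); first exact: cvg_cst.
  by apply/funext => n; under eq_fun do rewrite expr1; rewrite U1.
have [eps [eps0 rec]] := recU m.
have [B [B0 hB]] := even_moment_bounded m.
pose D n := Ex P (fun w => U n w ^+ m.+2)
  - m.+1%:R * Ex P (fun w => U n w ^+ 2) * Ex P (fun w => U n w ^+ m).
have D0 : D @ \oo --> (0 : R).
  apply/norm_cvg0P.
  apply: (@squeeze_cvgr _ _ _ _ (fun=> 0 : R) (fun n => `|eps n| * (2 ^+ m.*2 * (1 + B)))).
  - near=> n; rewrite normr_ge0/=.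
    have h : `|D n| <= eps n * Ex P (fun w => (1 + `|U n w|) ^+ m) by near: n.
    apply: (le_trans h).
    apply: (@le_trans _ _ (`|eps n| * Ex P (fun w => (1 + `|U n w|) ^+ m))).
      by apply: ler_wpM2r => //; exact: ler_norm.
    apply: ler_wpM2l => //; apply: le_trans (Y_le n (_ : m <= m.*2)%N) _.
      by rewrite -addnn leq_addr.
    apply: ler_wpM2l; rewrite ?exprn_ge0// lerD2l.
    by near: n.
  - exact: cvg_cst.
  - rewrite -[X in _ --> X](mul0r (2 ^+ m.*2 * (1 + B))); apply: cvgMl.
    by apply/norm_cvg0P; exact: eps0.
rewrite (_ : (fun n => _) = (fun n => D n + m.+1%:R * Ex P (fun w => U n w ^+ 2) * Ex P (fun w => U n w ^+ m))).
  rewrite -[X in _ --> X]add0r /=; apply: cvgD => //.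
  apply: cvgM; last exact: IH.
  by apply: cvgMr.
by apply/funext => n; rewrite /D subrK.
Unshelve. all: by end_near. Qed.

End MomentLimits.

(** * Taylor bounds for the cosine, and cosines from moments *)

Section CosTaylor.
Context (R : realType).
Implicit Types u th : R.

(** The Taylor polynomial at 0 of u |-> cos(u + th): differentiating the cosine shifts its phase by
    pi/2. The free phase th covers the sine and keeps the family closed under differentiation. *)
Definition cos_taylor n th u : R :=
  \sum_(j < n) cos (th + j%:R * (pi / 2)) * (j`!%:R^-1 * u ^+ j).

Lemma is_derive_monomial n u :
  is_derive u 1 (fun x : R => n.+1`!%:R^-1 * x ^+ n.+1) (n`!%:R^-1 * u ^+ n).
Proof.
have h : is_derive u 1 (n.+1`!%:R^-1 \*: (@id R ^+ n.+1))
   (n.+1`!%:R^-1 *: ((n.+1%:R * u ^+ n) *: 1)).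
  by apply: is_deriveZ; apply: is_deriveX; exact: is_derive_id.
rewrite (_ : (fun x => _) = n.+1`!%:R^-1 \*: (@id R ^+ n.+1)).
  apply: is_derive_eq h _; rewrite /GRing.scale/= mulr1 mulrA factS natrM; congr (_ * _).
  by rewrite invfM mulrAC mulVf ?mul1r.
by apply/funext => x; rewrite /= fctE.
Qed.

Lemma is_derive_cos_taylor n th u :
  is_derive u 1 (cos_taylor n.+1 th) (cos_taylor n (th + pi / 2) u).
Proof.
elim: n => [|n IH].
  rewrite (_ : cos_taylor 1 th = cst (cos th)).
    by rewrite /cos_taylor big_ord0; exact: is_derive_cst.
  by apply/funext => x; rewrite /cos_taylor big_ord1 mul0r addr0 fact0 invr1 expr0 !mulr1.
rewrite (_ : cos_taylor n.+2 th = cos_taylor n.+1 th \+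
   (cos (th + n.+1%:R * (pi / 2)) \*: (fun x => n.+1`!%:R^-1 * x ^+ n.+1))); last first.
  by apply/funext => x; rewrite /cos_taylor big_ord_recr.
rewrite (_ : cos_taylor n.+1 (th + pi / 2) u = cos_taylor n (th + pi / 2) u +
    cos (th + n.+1%:R * (pi / 2)) *: (n`!%:R^-1 * u ^+ n)).
  exact: (is_deriveD IH (is_deriveZ _ (is_derive_monomial n u))).
rewrite {1}/cos_taylor big_ord_recr/=; congr (_ + cos _ * _).
by rewrite -natr1; ring.
Qed.

Lemma is_derive_cosD th u :
  is_derive u 1 (fun x => cos (x + th)) (cos (u + (th + pi / 2))).
Proof.
rewrite addrA cosDpihalf -[- sin _]mulr1.
have h : is_derive u 1 (fun x => x + th) (1 + 0).
  exact: (is_deriveD (is_derive_id u 1) (is_derive_cst th u 1)).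
rewrite addr0 in h.
exact: (@is_derive1_comp _ cos (fun x => x + th) u _ _ (is_derive_cos (u + th)) h).
Qed.

Let is_derive_continuous (f df : R -> R) (A : set R) :
  (forall x : R, is_derive x 1 f (df x)) -> {within A, continuous f}.
Proof.
move=> fdf; apply: continuous_subspaceT => x.
by apply/differentiable_continuous/derivable1_diffP; exact: ex_derive.
Qed.

Let ge0_of_derive (f df : R -> R) : (forall x : R, is_derive x 1 f (df x)) ->
  f 0 = 0 -> (forall x, 0 <= x -> 0 <= df x) -> forall x, 0 <= x -> 0 <= f x.
Proof.
move=> fdf f0 df0 x x0.
have [c] := MVT_segment x0 (fun y _ => fdf y) (@is_derive_continuous f df _ fdf).
rewrite in_itv/= f0 !subr0 => /andP[c0 _] ->.
by rewrite mulr_ge0// df0.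
Qed.

(** Induction on the order: the remainder vanishes at 0, and its derivative is the remainder of one
    order less with phase th + pi/2. So the monomial plus or minus the remainder is nondecreasing on
    u >= 0. *)
Let cos_taylor_bound_ge0 n th u : 0 <= u ->
  `|cos (u + th) - cos_taylor n th u| <= n`!%:R^-1 * u ^+ n.
Proof.
elim: n th u => [|n IH] th u u0.
  rewrite /cos_taylor big_ord0 subr0 fact0 invr1 expr0 mulr1 ler_norml.
  by rewrite cos_geN1 cos_le1.
have t0 : cos (0 + th) - cos_taylor n.+1 th 0 = 0.
  rewrite /cos_taylor big_ord_recl/= big1 => [|i _].
    by rewrite mul0r !addr0 add0r fact0 invr1 expr0 !mulr1 subrr.
  by rewrite exprS mul0r !mulr0.
have dm (x : R) := is_derive_monomial n x.
have dr (x : R) : is_derive x 1 (fun x => cos (x + th) - cos_taylor n.+1 th x)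
    (cos (x + (th + pi / 2)) - cos_taylor n (th + pi / 2) x).
  by apply: is_deriveB; [exact: is_derive_cosD|exact: is_derive_cos_taylor].
rewrite ler_norml; apply/andP; split.
  rewrite -subr_ge0 opprK addrC.
  pose f x := n.+1`!%:R^-1 * x ^+ n.+1 + (cos (x + th) - cos_taylor n.+1 th x).
  apply: (@ge0_of_derive f _ (fun x => is_deriveD (dm x) (dr x)) _ _ u u0) => [|x x0].
    by rewrite /f t0 addr0 exprS mul0r mulr0.
  by have := IH (th + pi / 2) x x0; rewrite ler_norml => /andP[h _]; rewrite -lerBlDl sub0r.
rewrite -subr_ge0.
pose f x := n.+1`!%:R^-1 * x ^+ n.+1 - (cos (x + th) - cos_taylor n.+1 th x).
apply: (@ge0_of_derive f _ (fun x => is_deriveB (dm x) (dr x)) _ _ u u0) => [|x x0].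
  by rewrite /f t0 subr0 exprS mul0r mulr0.
by have := IH (th + pi / 2) x x0; rewrite ler_norml subr_ge0 => /andP[].
Qed.

Lemma cos_taylor_bound n th u :
  `|cos (u + th) - cos_taylor n th u| <= n`!%:R^-1 * `|u| ^+ n.
Proof.
have [u0|u0] := leP 0 u.
  by rewrite (ger0_norm u0); exact: cos_taylor_bound_ge0.
have nu0 : 0 <= - u by rewrite oppr_ge0 ltW.
have := @cos_taylor_bound_ge0 n (- th) (- u) nu0.
rewrite (ltr0_norm u0) -opprD cosN (_ : cos_taylor n (- th) (- u) = cos_taylor n th u)//.
rewrite /cos_taylor; apply: eq_bigr => -[j /= _] _.
rewrite exprNn [_^-1 * _]mulrCA [LHS]mulrA; congr (_ * _).
(* Reflecting both u and th leaves each term unchanged. Two consecutive indices are carried because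
   the recurrence, a shift by pi, has step two. *)
suff : cos (- th + j%:R * (pi / 2)) * (- 1) ^+ j = cos (th + j%:R * (pi / 2)) /\
  cos (- th + j.+1%:R * (pi / 2)) * (- 1) ^+ j.+1 = cos (th + j.+1%:R * (pi / 2)) by case.
have e k x : x + k.+1%:R * (pi / 2) = x + k%:R * (pi / 2) + pi / 2 :> R.
  by rewrite -natr1; ring.
elim: j => [|j [IH1 IH2]].
  rewrite !e !mul0r !addr0 cosN expr0 mulr1 expr1 mulrN1; split => //.
  by rewrite !cosDpihalf sinN opprK.
split => //; rewrite !(e j.+1) !(e j) !cosDpihalf !sinDpihalf -IH1 !exprS.
by ring.
Qed.


End CosTaylor.
Section CosMoments.
Context (R : realType).

(** Rules the Taylor remainders: the right side is a term of the exponential series, so it tends to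
    zero for every v. *)
Lemma gauss_moment_even (v : R) k :
  (k.*2)`!%:R^-1 * gauss_moment v k.*2 = (v / 2) ^+ k / k`!%:R.
Proof.
elim: k => [|k IH]; first by rewrite /= expr0 fact0 invr1 mulr1.
have n0 (n : nat) : n.+1%:R != 0 :> R by [].
rewrite doubleS /= !factS !natrM !invfM exprS.
rewrite (_ : k.*2.+2%:R^-1 * _ * _ = (k.*2.+1%:R^-1 * k.*2.+1%:R) * k.*2.+2%:R^-1 * v *
  ((k.*2)`!%:R^-1 * gauss_moment v k.*2)); last by ring.
rewrite IH mulVf// (_ : k.*2.+2%:R = 2 * k.+1%:R); last first.
  by rewrite -natrM mul2n.
by rewrite invfM; ring.
Qed.

Lemma gauss_moment_coeff_cvg (v : R) :
  (k.*2)`!%:R^-1 * gauss_moment v k.*2 @[k --> \oo] --> (0 : R).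
Proof. under eq_fun do rewrite gauss_moment_even; exact: (cvg_exp_coeff (v / 2)). Qed.

Definition cos_moment_sum n th (m : nat -> R) : R :=
  \sum_(j < n) cos (th + j%:R * (pi / 2)) * (j`!%:R^-1 * m j).

Context (disp : measure_display) (T : measurableType disp) (P : probability T R).

Let cos_integrable (X : T -> R) (th : R) : measurable_fun setT X ->
  P.-integrable setT (EFin \o (fun w => cos (X w + th))).
Proof.
move=> mX; apply: bounded_rv_integrable.
apply: (bounded_rv_comp (f := fun x => cos (x + th)) (M := 1) mX).
  apply: continuous_measurable_fun => x.
  apply: continuous_comp; last exact: continuous_cos.
  by apply: cvgD; [exact: cvg_id|exact: cvg_cst].
by move=> x; rewrite ler_norml cos_geN1 cos_le1.
Qed.

(** The order is even so that |X|^(2k) is itself a power of X. Integrable powers are assumed instead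
    of boundedness, so that the bound applies to the Gaussian law as well as to the linear
    statistics. *)
Lemma Ex_cos_taylor (X : T -> R) k th : measurable_fun setT X ->
  (forall j, P.-integrable setT (EFin \o (fun w => X w ^+ j))) ->
  `|Ex P (fun w => cos (X w + th)) - cos_moment_sum k.*2 th (fun j => Ex P (fun w => X w ^+ j))|
    <= (k.*2)`!%:R^-1 * Ex P (fun w => X w ^+ k.*2).
Proof.
move=> mX iX.
have iZ (a : R) j : P.-integrable setT (EFin \o (fun w => a * X w ^+ j)).
  exact: integrable_EFinZ.
have iS n : P.-integrable setT (EFin \o (fun w => cos_taylor n th (X w))) /\
    Ex P (fun w => cos_taylor n th (X w)) =
    cos_moment_sum n th (fun j => Ex P (fun w => X w ^+ j)).
  elim: n => [|n [IH1 IH2]].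
    rewrite /cos_taylor /cos_moment_sum big_ord0; under eq_fun do rewrite big_ord0.
    by rewrite Ex_cst; split => //; apply: bounded_rv_integrable; exact: bounded_rv_cst.
  have eT : (fun w => cos_taylor n.+1 th (X w)) = fun w => cos_taylor n th (X w)
      + cos (th + n%:R * (pi / 2)) * n`!%:R^-1 * X w ^+ n.
    by apply/funext => w; rewrite /cos_taylor big_ord_recr/=; congr (_ + _); ring.
  rewrite eT; split; first exact: integrable_EFinD.
  rewrite /Ex RintegralD// RintegralZl// /cos_moment_sum big_ord_recr/=; congr (_ + _).
    exact: IH2.
  by rewrite /Ex; ring.
rewrite -(iS k.*2).2 /Ex -RintegralB//; [|exact: cos_integrable|exact: (iS _).1].
rewrite -RintegralZl//.
have iB : P.-integrable setT (EFin \o (fun w => cos (X w + th) - cos_taylor k.*2 th (X w))).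
  by apply: integrable_EFinB; [exact: cos_integrable|exact: (iS _).1].
apply: (le_trans (le_normr_Rintegral _ iB)) => //.
apply: le_Rintegral => //.
  exact: (eq_integrable measurableT _ _ (fun w _ => erefl) (integrable_abse iB)).
move=> w _; apply: le_trans (cos_taylor_bound _ _ _) _.
by rewrite -normrX ger0_norm// -mul2n exprM exprn_ge0// sqr_ge0.
Qed.

(** The expectations and l are both within a Taylor remainder of a sum of moments. First k is fixed
    with Gaussian remainder at most e/4, then n grows for this k. *)
Lemma Ex_cos_cvg (U : nat -> T -> R) v th (l : R) :
  (forall n, bounded_rv (U n)) ->
  (forall m, Ex P (fun w => U n w ^+ m) @[n --> \oo] --> gauss_moment v m) ->
  (forall k, `|l - cos_moment_sum k.*2 th (gauss_moment v)|
     <= (k.*2)`!%:R^-1 * gauss_moment v k.*2) ->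
  Ex P (fun w => cos (U n w + th)) @[n --> \oo] --> l.
Proof.
move=> bU Um lP; apply/cvgrPdist_le => e e0.
have e4 : 0 < e / 4 by rewrite divr_gt0.
have [k gk] : exists k, (k.*2)`!%:R^-1 * gauss_moment v k.*2 <= e / 4.
  have [N _ hN] := cvgr_le _ (gauss_moment_coeff_cvg v) _ e4.
  by exists N; apply: hN => /=.
have h1 : (k.*2)`!%:R^-1 * Ex P (fun w => U n w ^+ k.*2) @[n --> \oo] -->
    (k.*2)`!%:R^-1 * gauss_moment v k.*2 by exact: cvgMr.
have h2 K : cos_moment_sum K th (fun j => Ex P (fun w => U n w ^+ j)) @[n --> \oo] -->
    cos_moment_sum K th (gauss_moment v).
  rewrite /cos_moment_sum; elim: K => [|K IH].
    by rewrite big_ord0; under eq_fun do rewrite big_ord0; exact: cvg_cst.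
  rewrite big_ord_recr/=; under eq_fun do rewrite big_ord_recr/=.
  by apply: cvgD => //; apply: cvgMr; exact: cvgMr.
set S := cos_moment_sum k.*2 th (gauss_moment v).
near=> n.
set Sn := cos_moment_sum k.*2 th (fun j => Ex P (fun w => U n w ^+ j)).
have a1 : `|l - S| <= e / 4 by exact: le_trans (lP k) gk.
have a2 : `|S - Sn| <= e / 4.
  by rewrite /Sn {Sn}; near: n; move/cvgrPdist_le : (h2 k.*2) => /(_ _ e4).
have a3 : (k.*2)`!%:R^-1 * Ex P (fun w => U n w ^+ k.*2) <= e / 2.
  near: n; apply: (cvgr_le _ h1); apply: le_lt_trans gk _.
  by rewrite ltr_pM2l// ltf_pV2 ?posrE// ltr_nat.
have a4 : `|Ex P (fun w => cos (U n w + th)) - Sn| <= e / 2.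
  apply: le_trans a3; apply: Ex_cos_taylor; first by case: (bU n).
  by move=> j; apply: bounded_rv_integrable; exact: bounded_rvX.
rewrite (_ : l - _ = (l - S) + (S - Sn) - (Ex P (fun w => cos (U n w + th)) - Sn)); last by ring.
apply: le_trans (ler_normB _ _) _; apply: le_trans (lerD (ler_normD _ _) a4) _.
apply: le_trans (lerD (lerD a1 a2) (lexx _)) _; lra.
Unshelve. all: by end_near. Qed.

End CosMoments.

(** * Binomial weights *)

Section Bernstein.
Context (R : realType).
Implicit Types (p : R) (N : nat).

Definition bern_weight N p k : R := 'C(N, k)%:R * (p ^+ k * (1 - p) ^+ (N - k)).

Definition bern_mean N p (f : nat -> R) : R := \sum_(k < N.+1) bern_weight N p k * f k.

(** Pascal's rule, read as conditioning on the outcome of one trial; mean and variance of the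
    binomial law follow by induction. *)
Lemma bern_meanS N p f :
  bern_mean N.+1 p f = p * bern_mean N p (f \o S) + (1 - p) * bern_mean N p f.
Proof.
rewrite /bern_mean !mulr_sumr.
rewrite [X in _ = _ + X](_ : _ = \sum_(k < N.+2) (1 - p) * (bern_weight N p k * f k)); last first.
  by rewrite [RHS]big_ord_recr/= /bern_weight bin_small// !mul0r mulr0 addr0.
rewrite big_ord_recl [X in _ = _ + X]big_ord_recl/= addrCA; congr (_ + _).
  by rewrite /bern_weight !bin0 !subn0 expr0 exprS; ring.
rewrite -big_split/=; apply: eq_bigr => -[k /= kN] _.
rewrite /bern_weight /bump/= !add1n binS natrD subSS.
have [kN1|kN1] := ltnP k N.
  rewrite (_ : N - k = (N - k.+1).+1)%N; last by rewrite subnSK.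
  by rewrite !exprS; ring.
rewrite (@bin_small N k.+1)//.
by rewrite exprS; ring.
Qed.

Lemma bern_mean_cst N p (a : R) : bern_mean N p (fun=> a) = a.
Proof.
elim: N => [|N IH]; last by rewrite bern_meanS IH; ring.
by rewrite /bern_mean big_ord1 /bern_weight bin0 subn0 !expr0; ring.
Qed.

Lemma bern_meanD N p f g :
  bern_mean N p (fun k => f k + g k) = bern_mean N p f + bern_mean N p g.
Proof.
by rewrite /bern_mean -big_split/=; apply: eq_bigr => k _; rewrite mulrDr.
Qed.

Lemma bern_meanZ N p (a : R) f :
  bern_mean N p (fun k => a * f k) = a * bern_mean N p f.
Proof. by rewrite /bern_mean mulr_sumr; apply: eq_bigr => k _; rewrite mulrCA. Qed.

Lemma bern_mean_centered N p : bern_mean N p (fun k => k%:R - N%:R * p) = 0.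
Proof.
elim: N => [|N IH].
  by rewrite /bern_mean big_ord1 !mul0r subr0 mulr0.
have h (e : R) : bern_mean N p (fun k => (k%:R - N%:R * p) + e) = e.
  by rewrite bern_meanD IH bern_mean_cst add0r.
rewrite bern_meanS.
rewrite (_ : _ \o S = fun k => (k%:R - N%:R * p) + (1 - p)); last first.
  by apply/funext => k /=; rewrite -!natr1; ring.
rewrite h (_ : (fun k => _) = fun k => (k%:R - N%:R * p) + (- p)); last first.
  by apply/funext => k /=; rewrite -!natr1; ring.
by rewrite h; ring.
Qed.

Lemma bern_mean_variance N p :
  bern_mean N p (fun k => (k%:R - N%:R * p) ^+ 2) = N%:R * (p * (1 - p)).
Proof.
elim: N => [|N IH].
  by rewrite /bern_mean big_ord1 !mul0r subr0 expr0n mulr0.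
have h (e : R) : bern_mean N p (fun k => (k%:R - N%:R * p) ^+ 2 +
    ((2 * e) * (k%:R - N%:R * p) + e ^+ 2)) = N%:R * (p * (1 - p)) + e ^+ 2.
  by rewrite !bern_meanD IH bern_meanZ bern_mean_centered bern_mean_cst; ring.
rewrite bern_meanS.
rewrite (_ : _ \o S = fun k => (k%:R - N%:R * p) ^+ 2 +
    ((2 * (1 - p)) * (k%:R - N%:R * p) + (1 - p) ^+ 2)); last first.
  by apply/funext => k /=; rewrite -!natr1; ring.
rewrite h (_ : (fun k => _) = fun k => (k%:R - N%:R * p) ^+ 2 +
    ((2 * (- p)) * (k%:R - N%:R * p) + (- p) ^+ 2)); last first.
  by apply/funext => k /=; rewrite -!natr1; ring.
by rewrite h -natr1; ring.
Qed.

Context (m : nat).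

(** The joint law of independent binomial variables, one per coordinate. *)
Definition bern_weightn N (p : 'I_m -> R) (k : {ffun 'I_m -> 'I_N.+1}) : R :=
  \prod_i bern_weight N (p i) (k i).

Lemma sum_bern_weightn N (p : 'I_m -> R) : \sum_k @bern_weightn N p k = 1.
Proof.
rewrite -(bigA_distr_bigA (fun i (j : 'I_N.+1) => bern_weight N (p i) j)).
apply: big1 => i _; rewrite -[RHS](bern_mean_cst N (p i) 1).
by apply: eq_bigr => k _; rewrite mulr1.
Qed.

Lemma sum_bern_weightn_coord N (p : 'I_m -> R) i (f : nat -> R) :
  \sum_k @bern_weightn N p k * f (k i) = bern_mean N (p i) f.
Proof.
pose w j (k : 'I_N.+1) := bern_weight N (p j) k * (if j == i then f k else 1).
transitivity (\sum_(k : {ffun 'I_m -> 'I_N.+1}) \prod_j w j (k j)).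
  apply: eq_bigr => k _; rewrite big_split/=; congr (_ * _).
  by rewrite (bigD1 i)//= eqxx big1 ?mulr1// => j /negPf ->.
rewrite -bigA_distr_bigA (bigD1 i)//= [X in _ * X]big1 ?mulr1.
  by apply: eq_bigr => k _; rewrite /w eqxx.
move=> j ji; rewrite -[RHS](bern_mean_cst N (p j) 1).
by apply: eq_bigr => k _; rewrite /w (negPf ji).
Qed.

Lemma bern_weightn_ge0 N (p : 'I_m -> R) k : (forall i, 0 <= p i <= 1) -> 0 <= @bern_weightn N p k.
Proof.
move=> p01; apply: prodr_ge0 => i _; have /andP[p0 p1] := p01 i.
by rewrite mulr_ge0// mulr_ge0 ?exprn_ge0// subr_ge0.
Qed.

End Bernstein.

(** * Approximation by trigonometric polynomials *)

Section TrigonometricPolynomials.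
Context (R : realType) (m : nat).
Implicit Types (t v : 'rV[R]_m) (f g : 'rV[R]_m -> R).

Definition dotp t v : R := (t *m v^T) ord0 ord0.

Lemma dotpDl t t' v : dotp (t + t') v = dotp t v + dotp t' v.
Proof. by rewrite /dotp mulmxDl mxE. Qed.

Lemma dotpNl t v : dotp (- t) v = - dotp t v.
Proof. by rewrite /dotp mulNmx mxE. Qed.

Lemma dotpZl a t v : dotp (a *: t) v = a * dotp t v.
Proof. by rewrite /dotp -scalemxAl mxE. Qed.

Lemma dotpE t v : dotp t v = \sum_i t ord0 i * v ord0 i.
Proof. by rewrite /dotp mxE; apply: eq_bigr => i _; rewrite mxE. Qed.

Lemma dotp_delta i v : dotp (delta_mx 0 i) v = v ord0 i.
Proof.
rewrite dotpE (bigD1 i)//= mxE !eqxx mul1r big1 ?addr0// => j ji.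
by rewrite mxE (negPf ji) andbF mul0r.
Qed.

(** Each term is an amplitude with a frequency vector and a phase. Phases provide the sines and
    constants, and the product-to-sum formula keeps products in the family. *)
Definition trig_poly f := exists s : seq (R * ('rV[R]_m * R)),
  forall v, f v = \sum_(p <- s) p.1 * cos (dotp p.2.1 v + p.2.2).

Lemma trig_poly_cos t th : trig_poly (fun v => cos (dotp t v + th)).
Proof. by exists [:: (1, (t, th))] => v; rewrite big_seq1 mul1r. Qed.

Lemma trig_polyD f g : trig_poly f -> trig_poly g -> trig_poly (fun v => f v + g v).
Proof. by move=> [s fs] [r gr]; exists (s ++ r) => v; rewrite big_cat/= fs gr. Qed.

Lemma trig_polyZ a f : trig_poly f -> trig_poly (fun v => a * f v).
Proof.
move=> [s fs]; exists [seq (a * p.1, p.2) | p <- s] => v.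
by rewrite big_map fs mulr_sumr; apply: eq_bigr => p _; rewrite mulrA.
Qed.

Lemma trig_poly_cst a : trig_poly (fun=> a).
Proof.
by exists [:: (a, (0, 0))] => v; rewrite big_seq1/= /dotp mul0mx mxE addr0 cos0 mulr1.
Qed.

Lemma trig_poly_sum I (s : seq I) (F : I -> 'rV[R]_m -> R) :
  (forall i, trig_poly (F i)) -> trig_poly (fun v => \sum_(i <- s) F i v).
Proof.
move=> tF; elim: s => [|i s IH].
  by under eq_fun do rewrite big_nil; exact: trig_poly_cst.
by under eq_fun do rewrite big_cons; exact: trig_polyD.
Qed.

Lemma trig_polyM f g : trig_poly f -> trig_poly g -> trig_poly (fun v => f v * g v).
Proof.
move=> [s fs] [r gr].
rewrite (_ : (fun v => _) = fun v => \sum_(p <- s) \sum_(q <- r)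
   (2^-1 * p.1 * q.1) * (cos (dotp (p.2.1 + q.2.1) v + (p.2.2 + q.2.2))
                      + cos (dotp (p.2.1 - q.2.1) v + (p.2.2 - q.2.2)))).
  apply: trig_poly_sum => p; apply: trig_poly_sum => q; apply: trig_polyZ.
  by apply: trig_polyD; exact: trig_poly_cos.
apply/funext => v; rewrite fs gr mulr_suml; apply: eq_bigr => p _.
rewrite mulr_sumr; apply: eq_bigr => q _.
rewrite !dotpDl dotpNl.
rewrite [in X in _ = _ * (X + _)](_ : _ + _ = (dotp p.2.1 v + p.2.2) + (dotp q.2.1 v + q.2.2)); last by ring.
rewrite [in X in _ = _ * (_ + X)](_ : _ + _ = (dotp p.2.1 v + p.2.2) - (dotp q.2.1 v + q.2.2)); last by ring.
rewrite (cosD (dotp p.2.1 v + p.2.2)) (cosB (dotp p.2.1 v + p.2.2)); by field.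
Qed.

Lemma trig_poly_prod I (s : seq I) (F : I -> 'rV[R]_m -> R) :
  (forall i, trig_poly (F i)) -> trig_poly (fun v => \prod_(i <- s) F i v).
Proof.
move=> tF; elim: s => [|i s IH].
  by under eq_fun do rewrite big_nil; exact: trig_poly_cst.
by under eq_fun do rewrite big_cons; exact: trig_polyM.
Qed.

Lemma trig_polyX n f : trig_poly f -> trig_poly (fun v => f v ^+ n).
Proof.
move=> tf; elim: n => [|n IH].
  by under eq_fun do rewrite expr0; exact: trig_poly_cst.
by under eq_fun do rewrite exprS; exact: trig_polyM.
Qed.

Lemma trig_poly_sin_coord c i : trig_poly (fun v => sin (c * v ord0 i)).
Proof.
rewrite (_ : (fun v => _) = fun v => cos (dotp (c *: delta_mx 0 i) v + (- (pi / 2)))).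
  exact: trig_poly_cos.
by apply/funext => v; rewrite dotpZl dotp_delta cosBpihalf.
Qed.

Lemma compact_box (rho : R) : compact [set v : 'rV[R]_m | forall i, `|v ord0 i| <= rho].
Proof.
have := @rV_compact R m (fun=> `[- rho, rho]%classic) (fun=> @segment_compact _ _ _).
congr compact; apply/seteqP; split => v /= h i; have := h i.
  by rewrite /= in_itv/= ler_norml.
by rewrite /= in_itv/= ler_norml.
Qed.

(** Uniform continuity in which only one of the two points has to lie in the box. Compactness is
    used in its filter form, with del tending to 0 from the right. *)
Lemma box_unif_continuous f (rho e : R) : continuous f -> 0 < e ->
  exists2 del : R, 0 < del & forall u v : 'rV[R]_m, (forall i, `|u ord0 i| <= rho) ->
    (forall i, `|u ord0 i - v ord0 i| < del) -> `|f u - f v| <= e.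
Proof.
move=> cf e0; have /compact_near_coveringP := @compact_box rho.
move=> /(_ _ (0 : R)^'+ (fun del (u : 'rV[R]_m) => forall v : 'rV[R]_m,
  (forall i, `|u ord0 i - v ord0 i| < del) -> `|f u - f v| <= e)).
case=> [u _|].
  have /cvgrPdist_lt /(_ _ (divr_gt0 e0 (ltr0n _ 2))) := cf u.
  move=> /nbhs_ballP[eta /= eta0 heta].
  exists (ball u (eta / 2), `]-oo, eta / 2[%classic).
    by split => /=; [apply: nbhsx_ballx|apply: nbhs_right_lt]; rewrite divr_gt0.
  move=> [u' del] /= [uu' dele] v u'v.
    have du i : `|u ord0 i - u' ord0 i| < eta / 2 by case: uu' => _; exact.
    have h1 : `|f u - f u'| < e / 2.
      apply: heta; split => // i j; rewrite ord1; apply: lt_le_trans (du j) _.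
      by have : 0 < eta by []; lra.
    have h2 : `|f u - f v| < e / 2.
      apply: heta; split => // i j; rewrite ord1 /ball/=.
      rewrite (_ : u ord0 j - v ord0 j = (u ord0 j - u' ord0 j) + (u' ord0 j - v ord0 j)); last by ring.
      apply: le_lt_trans (ler_normD _ _) _; rewrite [ltRHS](splitr eta); apply: ltrD => //.
      apply: lt_le_trans (u'v j) _; by apply: ltW; move: dele; rewrite in_itv/=.
    rewrite [X in `|X|](_ : _ = (f u - f v) - (f u - f u')); last by rewrite /=; ring.
    apply: le_trans (ler_normB _ _) _; rewrite [leRHS](splitr e); apply: lerD; exact: ltW.
move=> del /= del0 hdel.
exists (del / 2); first by rewrite divr_gt0.
move=> u v ur uv; apply: (hdel (del / 2) _ _ u ur v uv).
- by rewrite /ball_/= sub0r normrN gtr0_norm ?divr_gt0// ltr_pdivrMr// ltr_pMr// ltr1n.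
- by rewrite divr_gt0.
Qed.

(* f is replaced by v |-> f (sin (c v) / c), which is bounded and close to f on
   compact sets for small c, and is a continuous function of the numbers
   (1 + sin (c v_i)) / 2 in [0, 1], to which Bernstein's theorem applies. *)
Lemma trig_approximation f (M T e : R) : continuous f -> (forall v, `|f v| <= M) ->
  0 < T -> 0 < e ->
  exists2 g, trig_poly g &
    forall v, `|f v - g v| <= e + 2 * M * \sum_i (v ord0 i ^+ 2 / T ^+ 2).
Proof.
move=> cf fM T0 e0.
have M0 : 0 <= M by exact: le_trans (normr_ge0 _) (fM 0).
have e2 : 0 < e / 3 by rewrite divr_gt0.
have [del del0 hdel] := box_unif_continuous T cf e2.
have T20 : 0 < T ^+ 2 by rewrite exprn_gt0.
(* With this c, |sin(c x)/c - x| <= c x^2/2 <= del/2 for |x| <= T. *)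
have [c [c0 cE]] : exists c, 0 < c /\ c * T ^+ 2 = del.
  by exists (del / T ^+ 2); rewrite divr_gt0// divfK// gt_eqF.
have [eta eta0 heta] := box_unif_continuous c^-1 cf e2.
have c0' := ltW c0; have eta0' := ltW eta0.
(* K/N is the Chebyshev error: at distance eta or more the difference of values is at most 2M, and
   each of the m coordinates of a random node has variance at most 4/(c^2 N). *)
pose K := 2 * M / eta ^+ 2 * (4 / c ^+ 2) * m%:R.
have K0 : 0 <= K by rewrite !mulr_ge0 ?invr_ge0 ?exprn_ge0.
pose N := (Num.truncn (K / (e / 3))).+1.
have NK : K / N%:R <= e / 3.
  rewrite ler_pdivrMr// mulrC -ler_pdivrMr//; apply: ltW.
  exact: truncnS_gt.
have N0 : 0 < N%:R :> R by [].
pose p v i := 2^-1 * (1 + sin (c * v ord0 i)).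
pose node (k : {ffun 'I_m -> 'I_N.+1}) : 'rV[R]_m := \row_i ((2 * ((k i)%:R / N%:R) - 1) / c).
pose g v := \sum_k bern_weightn (p v) k * f (node k).
pose fc v := f (\row_i (sin (c * v ord0 i) / c)).
have p01 v i : 0 <= p v i <= 1.
  have := sin_geN1 (c * v ord0 i); have := sin_le1 (c * v ord0 i).
  by rewrite /p => h1 h2; apply/andP; split; lra.
exists g.
  rewrite /g; under eq_fun do rewrite /bern_weightn.
  apply: trig_poly_sum => k.
  under eq_fun do rewrite mulrC; apply: trig_polyZ.
  apply: trig_poly_prod => i; apply: trig_polyZ.
  have tp : trig_poly (fun v => p v i).
    by apply: trig_polyZ; apply: trig_polyD; [exact: trig_poly_cst|exact: trig_poly_sin_coord].
  apply: trig_polyM; first exact: trig_polyX.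
  apply: trig_polyX; rewrite (_ : (fun v => _) = fun v => 1 + (-1) * p v i).
    by apply: trig_polyD; [exact: trig_poly_cst|exact: trig_polyZ].
  by apply/funext => v; rewrite mulN1r.
have fg v : `|fc v - g v| <= e / 3 + e / 3.
  rewrite -[fc v]mul1r -(sum_bern_weightn N (p v)) mulr_suml -sumrB.
  apply: le_trans (ler_norm_sum _ _ _) _.
  pose b (k : {ffun 'I_m -> 'I_N.+1}) := bern_weightn (p v) k.
  pose S (k : {ffun 'I_m -> 'I_N.+1}) := \sum_i ((k i)%:R - N%:R * p v i) ^+ 2.
  pose B := 2 * M / eta ^+ 2 * (4 / (c ^+ 2 * N%:R ^+ 2)).
  have B0 : 0 <= B by rewrite !mulr_ge0 ?invr_ge0 ?mulr_ge0 ?exprn_ge0.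
  apply: (@le_trans _ _ (\sum_k b k * (e / 3 + B * S k))).
    apply: ler_sum => k _; rewrite -mulrBr normrM ger0_norm; last exact: bern_weightn_ge0.
    apply: ler_wpM2l; first exact: bern_weightn_ge0.
    have S0 : 0 <= S k by apply: sumr_ge0 => i _; exact: sqr_ge0.
    have df i : (\row_i (sin (c * v ord0 i) / c)) ord0 i - node k ord0 i
      = (- (2 / (c * N%:R))) * ((k i)%:R - N%:R * p v i).
      by rewrite !mxE /p; field; rewrite !gt_eqF.
    have [h|h] := pselect (forall i, `|(\row_i (sin (c * v ord0 i) / c)) ord0 i - node k ord0 i| < eta).
      apply: (@le_trans _ _ (e / 3)); last by rewrite lerDl mulr_ge0.
      apply: heta => // i; rewrite mxE normrM [X in _ * X]gtr0_norm ?invr_gt0//.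
      by rewrite ler_piMl ?invr_ge0// ler_norml sin_geN1 sin_le1.
    have [i /negP] : exists i, ~ `|(\row_i (sin (c * v ord0 i) / c)) ord0 i - node k ord0 i| < eta.
      by apply/existsNP.
    rewrite -leNgt df => hi.
    apply: (@le_trans _ _ (2 * M)).
      apply: le_trans (ler_normB _ _) _; rewrite mulr_natl mulr2n; apply: lerD; exact: fM.
    apply: (@le_trans _ _ (B * S k)); last by rewrite lerDr ltW.
    have hi2 : eta ^+ 2 <= 4 / (c ^+ 2 * N%:R ^+ 2) * S k.
      apply: (@le_trans _ _ (4 / (c ^+ 2 * N%:R ^+ 2) * ((k i)%:R - N%:R * p v i) ^+ 2)).
        rewrite (_ : 4 / _ * _ = `|- (2 / (c * N%:R)) * ((k i)%:R - N%:R * p v i)| ^+ 2).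
          by rewrite lerXn2r ?nnegrE// ltW.
        by rewrite real_normK ?num_real//; field; rewrite !gt_eqF.
      apply: ler_wpM2l; first by rewrite mulr_ge0 ?invr_ge0 ?mulr_ge0 ?exprn_ge0.
      by rewrite /S (bigD1 i)//= lerDl; apply: sumr_ge0 => j _; exact: sqr_ge0.
    rewrite /B -mulrA -[leLHS]mulr1 -[2 * M / _ * _]mulrA; apply: ler_wpM2l; first by rewrite mulr_ge0.
    by rewrite mulrC ler_pdivlMr ?exprn_gt0// mul1r.
  under eq_bigr do rewrite mulrDr.
  rewrite big_split/= -mulr_suml sum_bern_weightn mul1r; apply: lerD => //.
  have -> : \sum_k b k * (B * S k) = B * \sum_i \sum_k b k * ((k i)%:R - N%:R * p v i) ^+ 2.
    rewrite exchange_big/= mulr_sumr; apply: eq_bigr => k _.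
    by rewrite mulrCA mulr_sumr.
  have hv i : \sum_k b k * ((k i)%:R - N%:R * p v i) ^+ 2 <= N%:R.
    rewrite (sum_bern_weightn_coord N (p v) i (fun k => (k%:R - N%:R * p v i) ^+ 2)).
    rewrite bern_mean_variance ler_piMr//; have /andP[? ?] := p01 v i.
    by rewrite mulr_ile1// ?subr_ge0// lerBlDr lerDl.
  apply: le_trans NK.
  apply: (@le_trans _ _ (B * \sum_(i < m) N%:R)).
    by apply: ler_wpM2l => //; apply: ler_sum => i _; exact: hv.
  rewrite sumr_const card_ord -[_ *+ m]mulr_natr /B /K le_eqVlt; apply/orP; left; apply/eqP.
  by field; rewrite !gt_eqF// exprn_gt0.
move=> v.
rewrite (_ : f v - g v = (f v - fc v) + (fc v - g v)); last by ring.
apply: le_trans (ler_normD _ _) _.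
have S0 : 0 <= \sum_i (v ord0 i ^+ 2 / T ^+ 2).
  by apply: sumr_ge0 => i _; rewrite divr_ge0 ?sqr_ge0.
suff : `|f v - fc v| <= e / 3 + 2 * M * \sum_i (v ord0 i ^+ 2 / T ^+ 2).
  move=> h; apply: le_trans (lerD h (fg v)) _; lra.
have [h|/existsNP[i /negP]] := pselect (forall i, `|v ord0 i| <= T).
  apply: (@le_trans _ _ (e / 3)); last by rewrite lerDl !mulr_ge0.
  apply: hdel => // i; rewrite mxE.
  (* Order two with phase -pi/2 is the inequality |sin x - x| <= x^2/2. *)
  have := cos_taylor_bound 2 (- (pi / 2)) (c * v ord0 i).
  rewrite cosBpihalf /cos_taylor !big_ord_recl big_ord0/= mul0r addr0 cosN cos_pihalf mul0r.
  rewrite /bump/= addn0 mul1r addNr cos0 mul1r invr1 mul1r expr1 addr0 add0r => hs.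
  rewrite (_ : v ord0 i - _ = - ((sin (c * v ord0 i) - c * v ord0 i) / c)); last first.
    by field; rewrite gt_eqF.
  rewrite normrN normrM [X in _ * X]gtr0_norm ?invr_gt0// ltr_pdivrMr//.
  apply: le_lt_trans hs _; rewrite normrM exprMn gtr0_norm//.
  have vT : `|v ord0 i| ^+ 2 <= T ^+ 2 by rewrite lerXn2r ?nnegrE// ltW.
  apply: (@le_lt_trans _ _ (2^-1 * (c ^+ 2 * T ^+ 2))).
    by rewrite ler_pM2l//; apply: ler_wpM2l => //; rewrite exprn_ge0// ltW.
  rewrite (_ : c ^+ 2 * T ^+ 2 = del * c); last first.
    by rewrite -cE; ring.
  have : 0 < del * c by rewrite mulr_gt0.
  lra.
(* Outside the box some v_i^2 / T^2 exceeds 1, and the trivial bound 2M suffices. *)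
rewrite -ltNge => hi; apply: (@le_trans _ _ (2 * M)).
  by apply: le_trans (ler_normB _ _) _; rewrite mulr_natl mulr2n; apply: lerD; exact: fM.
apply: (@le_trans _ _ (2 * M * \sum_i (v ord0 i ^+ 2 / T ^+ 2))); last by rewrite lerDr ltW.
rewrite -[leLHS]mulr1; apply: ler_wpM2l; first by rewrite mulr_ge0.
apply: (@le_trans _ _ (v ord0 i ^+ 2 / T ^+ 2)).
  by rewrite ler_pdivlMr// mul1r -[leRHS]real_normK ?num_real// lerXn2r ?nnegrE// ltW.
rewrite [leRHS](bigD1 i)//= lerDl; apply: sumr_ge0 => j _.
by rewrite divr_ge0 ?sqr_ge0.
Qed.

End TrigonometricPolynomials.

(** * Borel measurability of vectors and a criterion for weak convergence *)

Section BorelRowVectors.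
Context (R : realType) (m : nat).

Lemma continuous_measurable_borel (f : 'rV[R]_m -> R) : continuous f ->
  measurable_fun setT (f : borel R m -> R).
Proof.
move=> cf; apply: (measurability _ (RGenOInfty.measurableE R)) => _ [_ [a ->] <-].
rewrite setTI; apply: sub_sigma_algebra.
have /continuousP := cf; apply.
by rewrite set_itvE; exact: open_gt.
Qed.

Lemma continuous_coord (i : 'I_m) : continuous (fun v : 'rV[R]_m => v ord0 i).
Proof. exact: coord_continuous. Qed.

Lemma continuous_dotp (t : 'rV[R]_m) : continuous (dotp t).
Proof.
rewrite (_ : dotp t = fun v => \sum_i t ord0 i * v ord0 i); last first.
  by apply/funext => u; rewrite dotpE.
apply: (@continuous_big R _ +%R 0 xpredT) => [|i _]; first exact: add_continuous.
move=> v.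
apply: (@continuousM R _ (cst (t ord0 i)) (fun v : 'rV[R]_m => v ord0 i) v); [exact: cst_continuous|exact: coord_continuous].
Qed.
Lemma trig_poly_continuous (g : 'rV[R]_m -> R) : trig_poly g -> continuous g.
Proof.
move=> [s gs]; rewrite (funext gs).
apply: (@continuous_big R _ +%R 0 xpredT) => [|p _ v]; first exact: add_continuous.
apply: (@continuousM R _ (cst p.1) (fun v => cos (dotp p.2.1 v + p.2.2)) v).
  exact: cst_continuous.
apply: (@continuous_comp _ _ _ (fun v => dotp p.2.1 v + p.2.2) cos); last exact: continuous_cos.
by apply: (@continuousD R _ _ (dotp p.2.1) (cst p.2.2) v); [exact: continuous_dotp|exact: cst_continuous].
Qed.

(** [borel] is generated by open sets, while the hypothesis is coordinatewise. An open set is the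
    countable union of the cubes with rational centre and radius 1/(r+1) that it contains. *)
Lemma measurable_to_borel disp (T : measurableType disp) (X : T -> 'rV[R]_m) :
  (forall i, measurable_fun setT (fun w => X w ord0 i)) ->
  measurable_fun setT (X : T -> borel R m).
Proof.
move=> mX; apply: (@measurability _ _ T (borel R m) setT X (@open 'rV[R]_m) erefl) => _ [U oU <-].
rewrite setTI.
pose box (q : 'rV[rat]_m * nat) : set 'rV[R]_m :=
  [set v | forall i, `|v ord0 i - ratr (q.1 ord0 i)| < q.2.+1%:R^-1].
pose F (q : 'rV[rat]_m * nat) : set T :=
  if pselect (box q `<=` U) then X @^-1` box q else set0.
rewrite (_ : X @^-1` U = \bigcup_q F q).
  apply: countable_bigcupT_measurable; first exact: countableP.
  move=> q; rewrite /F; case: pselect => [qU|qU] /=; last exact: measurable0.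
  rewrite (_ : X @^-1` box q = \bigcap_(i in [set: 'I_m])
    [set w | `|X w ord0 i - ratr (q.1 ord0 i)| < q.2.+1%:R^-1]); last first.
    by apply/seteqP; split => w /= h i => [_|]; exact: h.
  apply: fin_bigcap_measurable => // i _.
  have mf : measurable_fun setT (fun w => `|X w ord0 i - ratr (q.1 ord0 i)|).
    by apply: measurableT_comp => //; exact: measurable_funB.
  rewrite -[X in measurable X]setTI.
  have := mf measurableT _ (measurable_itv `]-oo, (q.2.+1%:R^-1 : R)[).
  by congr (measurable (_ `&` _)); apply/seteqP; split => w /=; rewrite in_itv.
apply/seteqP; split => [w /= Uw|w [q _]]; last first.
  by rewrite /F; case: pselect => [qU|qU] //= h; exact: qU.
have /nbhs_ballP[e /= e0 eU] := open_nbhs_nbhs (conj oU Uw).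
pose r := Num.truncn (2 / e).
have re : 2 * r.+1%:R^-1 < e.
  by rewrite ltr_pdivrMr// mulrC -ltr_pdivrMr//; exact: truncnS_gt.
have r0 : 0 < r.+1%:R^-1 :> R by [].
have qex i : exists q : rat, `|X w ord0 i - ratr q| < r.+1%:R^-1.
  have hlt : X w ord0 i - r.+1%:R^-1 < X w ord0 i + r.+1%:R^-1.
    by rewrite ltrBlDr -addrA ltrDl addr_gt0.
  have [q] := rat_in_itvoo hlt.
  by rewrite in_itv/= -ltr_distlC => h; exists q.
have [q qP] := choice qex.
exists (\row_i q i, r) => //; rewrite /F.
have bU : box (\row_i q i, r) `<=` U.
  move=> v vb; apply: eU; split => // i j; rewrite ord1 /ball/=.
  have := vb j; have := qP j; rewrite mxE /=; move: (ratr _) (v _ _) (X _ _ _) => a b c h1 h2.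
  rewrite (_ : c - b = (c - a) - (b - a)); last by ring.
  apply: le_lt_trans (ler_normB _ _) _; apply: lt_trans (ltrD h1 h2) _.
  by move: re; rewrite mulr_natl mulr2n.
by case: pselect => [qU|//] /= i; rewrite mxE; exact: qP.
Qed.

End BorelRowVectors.

Section WeakConvergence.
Context (R : realType) (m : nat) (disp : measure_display).
Context (Omega : measurableType disp) (Pr : probability Omega R).
Context (X : nat -> Omega -> 'rV[R]_m) (nu : probability (borel R m) R).
Hypothesis bX : forall n i, bounded_rv (fun w => X n w ord0 i).
Hypothesis cos_cvg : forall t th,
  Ex Pr (fun w => cos (dotp t (X n w) + th)) @[n --> \oo] -->
  Ex nu (fun v => cos (dotp t v + th)).
Hypothesis tightX : forall i, exists B : R, \forall n \near \oo,
  Ex Pr (fun w => X n w ord0 i ^+ 2) <= B.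
Hypothesis nu2 : forall i, nu.-integrable setT (EFin \o (fun v : 'rV[R]_m => v ord0 i ^+ 2)).

(** Convergence of cosines extends by linearity to trigonometric polynomials. The quadratic error of
    [trig_approximation] is integrated against second moments, eventually bounded along X_n and
    finite under nu, and is made small by a large T; this plays the role of tightness. *)
Lemma weak_cvg_criterion : cvg_in_distribution Pr X nu.
Proof.
move=> f cf [M fM].
have mX n : measurable_fun setT (X n : Omega -> borel R m).
  by apply: measurable_to_borel => i; case: (bX n i).
have bfX (g : 'rV[R]_m -> R) (N : R) n : continuous g -> (forall v, `|g v| <= N) ->
    bounded_rv (fun w => g (X n w)).
  move=> cg gN; split; last by exists N => w; exact: gN.
  by apply: (@measurableT_comp _ _ _ _ (borel R m) _ g _ (X n)) => //; exact: continuous_measurable_borel.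
have bfnu (g : 'rV[R]_m -> R) (N : R) : continuous g -> (forall v, `|g v| <= N) ->
    bounded_rv (g : borel R m -> R).
  by move=> cg gN; split; [exact: continuous_measurable_borel|exists N].
have cos_le1' (x : R) : `|cos x| <= 1 by rewrite ler_norml cos_geN1 cos_le1.
have ccos t th : continuous (fun v : 'rV[R]_m => cos (dotp t v + th)).
  by apply: trig_poly_continuous; exact: trig_poly_cos.
have trig_cvg (g : 'rV[R]_m -> R) : trig_poly g -> Ex Pr (fun w => g (X n w)) @[n --> \oo] --> Ex nu g.
  move=> [s gs].
  have bc n p : bounded_rv (fun w => p.1 * cos (dotp p.2.1 (X n w) + p.2.2)).
    by apply: bounded_rvZ; exact: (bfX (fun v => cos (dotp p.2.1 v + p.2.2)) 1).
  have bcn (p : R * ('rV[R]_m * R)) : bounded_rv ((fun v => p.1 * cos (dotp p.2.1 v + p.2.2)) : borel R m -> R).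
    by apply: bounded_rvZ; exact: (bfnu (fun v => cos (dotp p.2.1 v + p.2.2)) 1).
  rewrite (_ : Ex nu g = \sum_(p <- s) p.1 * Ex nu (fun v => cos (dotp p.2.1 v + p.2.2))); last first.
    rewrite (funext gs) (@Ex_sum _ (borel R m))//; apply: eq_bigr => p _; rewrite ExZ//.
    exact: (bfnu (fun v => cos (dotp p.2.1 v + p.2.2)) 1).
  rewrite (_ : (fun n => _) = fun n => \sum_(p <- s) p.1 * Ex Pr (fun w => cos (dotp p.2.1 (X n w) + p.2.2))); last first.
    apply/funext => n; under eq_fun do rewrite gs.
    rewrite Ex_sum//; apply: eq_bigr => p _; rewrite ExZ//.
    exact: (bfX (fun v => cos (dotp p.2.1 v + p.2.2)) 1).
  apply: (@cvg_big R _ +%R 0 xpredT) => [|p _].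
    exact: add_continuous.
  by apply: cvgM; [exact: cvg_cst|exact: cos_cvg].
have bounded_trig (g : 'rV[R]_m -> R) : trig_poly g -> exists N : R, forall v, `|g v| <= N.
  move=> [s gs]; exists (\sum_(p <- s) `|p.1|) => v; rewrite gs.
  apply: le_trans (ler_norm_sum _ _ _) _; apply: ler_sum => p _.
  by rewrite normrM ler_piMr// ler_norml cos_geN1 cos_le1.
have [BX hBX] := choice tightX.
pose Bnu i := Ex nu (fun v => v ord0 i ^+ 2).
pose B := \sum_i (`|BX i| + `|Bnu i|).
have B0 : 0 <= B by apply: sumr_ge0 => i _; rewrite addr_ge0.
have M0 : 0 <= M by exact: le_trans (normr_ge0 _) (fM 0).
rewrite (_ : (fun n => 'E_Pr[f \o X n]%E) = fun n => (Ex Pr (fun w => f (X n w)))%:E); last first.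
  by apply/funext => n; rewrite expectationEx//; exact: bfX.
rewrite (_ : (\int[nu]_v (f v)%:E)%E = (Ex nu f)%:E); last first.
  rewrite /Ex /Rintegral fineK//; apply: integrable_fin_num => //.
  exact/bounded_rv_integrable/bfnu.
apply: cvg_EFin; first by near=> n.
apply/cvgrPdist_le => e e0.
have e4 : 0 < e / 6 by rewrite divr_gt0.
(* B dominates the total second moments under nu and, eventually, along X_n. With T >= 1 one has T
   <= T^2, so 2 M B / T^2 <= e/6 without a square root. *)
pose T := 1 + 2 * M * B / (e / 6).
have T1 : 1 <= T by rewrite lerDl divr_ge0 ?mulr_ge0// ltW.
have T0 : 0 < T by exact: lt_le_trans T1.
have TB : 2 * M * (B / T ^+ 2) <= e / 6.
  rewrite mulrA ler_pdivrMr ?exprn_gt0// [leRHS]mulrC -ler_pdivrMr//.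
  apply: (@le_trans _ _ T); first by rewrite /T lerDr.
  by rewrite expr2 ler_peMl// ltW.
have TBE : 2 * M * (B / T ^+ 2) = 2 * M / T ^+ 2 * B by rewrite mulrA mulrAC.
have MT0 : 0 <= 2 * M / T ^+ 2 by rewrite divr_ge0 ?mulr_ge0 ?exprn_ge0// ltW.
have [g tg fg] := trig_approximation cf fM T0 e4.
have [N gN] := bounded_trig g tg.
have cg := trig_poly_continuous tg.
have dnu : `|Ex nu f - Ex nu g| <= e / 6 + e / 6.
  have i1 : nu.-integrable setT (EFin \o f) by exact/bounded_rv_integrable/bfnu.
  have i2 : nu.-integrable setT (EFin \o g) by exact/bounded_rv_integrable/(bfnu _ N).
  pose h (v : borel R m) := \sum_i 2 * M / T ^+ 2 * v ord0 i ^+ 2.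
  have [ih Eh] := integrable_EFin_sum (index_enum 'I_m)
    (fun i => integrable_EFinZ (2 * M / T ^+ 2) (nu2 i)).
  have ie : nu.-integrable setT (EFin \o (fun v => e / 6 + h v)).
    by apply: integrable_EFinD => //; apply: bounded_rv_integrable; exact: bounded_rv_cst.
  rewrite /Ex -RintegralB//.
  apply: le_trans (le_normr_Rintegral _ _) _ => //; first exact: integrable_EFinB.
  apply: (@le_trans _ _ (Ex nu (fun v => e / 6 + h v))).
    apply: le_Rintegral => //.
      exact: (eq_integrable measurableT _ _ (fun w _ => erefl) (integrable_abse (integrable_EFinB i1 i2))).
    move=> v _; apply: le_trans (fg v) _; rewrite lerD2l /h mulr_sumr.
    by apply: ler_sum => i _; rewrite mulrCA mulrC mulrA.
  rewrite /Ex RintegralD//; last by apply: bounded_rv_integrable; exact: bounded_rv_cst.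
  rewrite -!/(Ex nu _) Ex_cst lerD2l Eh.
  apply: le_trans TB; rewrite TBE /B mulr_sumr; apply: ler_sum => i _.
  rewrite /Ex RintegralZl//; apply: ler_wpM2l => //.
  by apply: le_trans (ler_norm _) _; rewrite lerDr.
have [K _ hK] : \forall n \near \oo, forall i, Ex Pr (fun w => X n w ord0 i ^+ 2) <= BX i.
  exact: filter_forall.
near=> n.
have hn i : Ex Pr (fun w => X n w ord0 i ^+ 2) <= BX i.
  by apply: hK; near: n; exact: nbhs_infty_ge.
have dPr : `|Ex Pr (fun w => f (X n w)) - Ex Pr (fun w => g (X n w))| <= e / 6 + e / 6.
  pose h w := \sum_i 2 * M / T ^+ 2 * X n w ord0 i ^+ 2.
  have bh i : bounded_rv (fun w => 2 * M / T ^+ 2 * X n w ord0 i ^+ 2).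
    by apply: bounded_rvZ; apply: bounded_rvX; exact: bX.
  have b1 : bounded_rv (fun w => f (X n w)) by exact: bfX.
  have b2 : bounded_rv (fun w => g (X n w)) by exact: (bfX _ N).
  have bH : bounded_rv h by exact: bounded_rv_sum.
  rewrite -ExB//; apply: (@le_trans _ _ (Ex Pr (fun w => e / 6 + h w))).
    apply: Ex_norm_le; first exact: bounded_rvB.
      by apply: bounded_rvD => //; exact: bounded_rv_cst.
    move=> w; apply: le_trans (fg (X n w)) _; rewrite lerD2l /h mulr_sumr.
    by apply: ler_sum => i _; rewrite mulrCA mulrC mulrA.
  rewrite ExD ?Ex_cst//; last exact: bounded_rv_cst.
  rewrite lerD2l /h Ex_sum//; apply: le_trans TB; rewrite TBE /B mulr_sumr.
  apply: ler_sum => i _; rewrite ExZ; last by apply: bounded_rvX; exact: bX.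
  apply: ler_wpM2l => //; apply: le_trans (hn i) _.
  by apply: le_trans (ler_norm _) _; rewrite lerDl.
have dg : `|Ex nu g - Ex Pr (fun w => g (X n w))| <= e / 6.
  by near: n; move/cvgrPdist_le : (trig_cvg g tg) => /(_ _ e4).
apply: le_trans (ler_distD (Ex nu g) _ _) _.
apply: le_trans (lerD dnu (ler_distD (Ex Pr (fun w => g (X n w))) _ _)) _.
rewrite distrC in dPr; apply: le_trans (lerD (lexx _) (lerD dg dPr)) _; lra.
Unshelve. all: by end_near. Qed.




End WeakConvergence.

(** * Gaussian laws on the line: convolution, moments, scaling *)

Section GaussianDensity.
Context (R : realType).
Implicit Types (s v x : R).
Notation mu := (@lebesgue_measure R).

(* Change of measure with the density of the normal law. *)
Lemma ge0_integral_normal_prob m s (f : R -> \bar R) (B : set R) :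
    (forall x, 0 <= f x)%E -> measurable B -> measurable_fun setT f ->
  (\int[normal_prob m s]_(x in B) f x = \int[mu]_(x in B) (f x * (normal_pdf m s x)%:E))%E.
Proof.
move=> f0 mB mf; have dom := @normal_prob_dominates R m s.
have mfB : measurable_fun B f by exact: measurable_funTS.
rewrite -(Radon_Nikodym_SigmaFinite.change_of_variables dom f0 mB mfB).
have mp : measurable_fun B (fun x => (normal_pdf m s x)%:E).
  by apply: measurable_funTS; apply/measurable_EFinP; exact: measurable_normal_pdf.
have iRN := Radon_Nikodym_SigmaFinite.f_integrable dom.
have mRN : measurable_fun B (Radon_Nikodym_SigmaFinite.f (normal_prob m s) mu).
  by apply: measurable_funTS; exact: measurable_int iRN.
apply: ae_eq_integral => //; [exact: emeasurable_funM|exact: emeasurable_funM|].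
apply: ae_eqe_mul2l.
apply: integral_ae_eq => //.
- exact: integrableS iRN.
- by move=> E EB mE; rewrite -(Radon_Nikodym_SigmaFinite.f_integral dom).
Qed.

(** By uniqueness of Lebesgue measure it is enough to compare both sides on half-open intervals. *)
Lemma lebesgue_measure_translate x (A : set R) : measurable A ->
  mu [set y | A (x + y)] = mu A.
Proof.
have mt : measurable_fun setT (fun y : R => x + y) by exact: measurable_funD.
move=> mA; apply/esym.
pose tr (y : measurableTypeR R) : measurableTypeR R := x + y.
have mtr : measurable_fun setT tr by [].
apply: (@lebesgue_measure_unique R (pushforward mu tr)) => // _ [[a b] /= _ <-].
rewrite /pushforward /=.
rewrite (_ : _ @^-1` _ = `]a - x, b - x]%classic).
  rewrite !lebesgue_measure_itv/= !lte_fin ltrD2r.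
  by case: ifPn => // _; rewrite -!EFinB; congr (_%:E); ring.
by apply/seteqP; split => y /=; rewrite !in_itv/= ltrBlDl lerBrDl.
Qed.

Lemma normal_prob_translate x s (B : set R) : s != 0 -> measurable B ->
  normal_prob 0 s [set y | B (x + y)] = normal_prob x s B.
Proof.
move=> s0 mB; rewrite /normal_prob.
pose tr (y : measurableTypeR R) : measurableTypeR R := x + y.
have mtr : measurable_fun setT tr by exact: measurable_funD.
have -> : (\int[mu]_(z in B) (normal_pdf x s z)%:E =
    \int[pushforward mu tr]_(z in B) (normal_pdf x s z)%:E)%E.
  apply: eq_measure_integral => A mA _; apply/esym.
  exact: lebesgue_measure_translate.
rewrite ge0_integral_pushforward//.
- apply: eq_integral => y _ /=; rewrite !normal_pdfE//.
  by rewrite /normal_fun /tr addrAC subrr add0r subr0.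
- by apply: measurable_funTS; apply/measurable_EFinP; exact: measurable_normal_pdf.
- by move=> y _; rewrite lee_fin normal_pdf_ge0.
Qed.

(** Completing the square in x. For independent X, Y of variances a, b and Z = X + Y, the joint
    density of X and Z is the density of Z times the conditional density of X given Z. *)
Lemma normal_pdf_conv (a b x z : R) : 0 < a -> 0 < b ->
  normal_pdf x (Num.sqrt b) z * normal_pdf 0 (Num.sqrt a) x =
  normal_pdf 0 (Num.sqrt (a + b)) z *
    normal_pdf (z * a / (a + b)) (Num.sqrt (a * b / (a + b))) x.
Proof.
move=> a0 b0; have ab0 : 0 < a + b by exact: addr_gt0.
have c0 : 0 < a * b / (a + b) by rewrite divr_gt0// mulr_gt0.
have sn (t : R) : 0 < t -> Num.sqrt t != 0 by move=> t0; rewrite gt_eqF// sqrtr_gt0.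
rewrite !normal_pdfE ?sn// mulrACA [RHS]mulrACA; congr (_ * _).
  rewrite /normal_peak !sqr_sqrtr ?ltW// -!invfM; congr (_^-1).
  have t0 (t : R) : 0 < t -> 0 <= t * pi *+ 2 by move=> t0; rewrite mulrn_wge0// mulr_ge0 ?pi_ge0// ltW.
  rewrite -sqrtrM ?t0// -sqrtrM ?t0//; congr (Num.sqrt _).
  by rewrite !mulr2n; field; rewrite gt_eqF.
rewrite /normal_fun !sqr_sqrtr ?ltW// -!expRD; congr expR.
rewrite !mulr2n; field.
by rewrite !gt_eqF ?addr_gt0 ?mulr_gt0.
Qed.

(** Tonelli exchanges the integrals; by [normal_pdf_conv] the inner integral over x is then that of
    a normal density, which is 1. *)
Lemma normal_prob_conv (a b : R) (B : set R) : 0 < a -> 0 < b -> measurable B ->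
  (\int[normal_prob 0 (Num.sqrt a)]_x normal_prob 0 (Num.sqrt b) [set y | B (x + y)]%R =
   normal_prob 0 (Num.sqrt (a + b)) B)%E.
Proof.
move=> a0 b0 mB.
have ab0 : 0 < a + b by exact: addr_gt0.
pose F (p : R * R) : \bar R :=
  ((\1_B p.2 * normal_pdf p.1 (Num.sqrt b) p.2) * normal_pdf 0 (Num.sqrt a) p.1)%:E.
have sb0 : Num.sqrt b != 0 by rewrite gt_eqF// sqrtr_gt0.
have mpdf : measurable_fun setT
    (fun p : measurableTypeR R * measurableTypeR R => normal_pdf p.1 (Num.sqrt b) p.2).
  under eq_fun do rewrite normal_pdfE//.
  apply: measurable_funM => //; apply: measurableT_comp => //.
  apply: measurable_funM => //; apply: measurableT_comp => //.
  by apply: measurable_funX; apply: measurable_funB.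
have mG : measurable_fun setT (fun p : measurableTypeR R * measurableTypeR R =>
    (\1_B p.2 * normal_pdf p.1 (Num.sqrt b) p.2)%:E).
  apply/measurable_EFinP; apply: measurable_funM => //.
  by apply: measurableT_comp => //; exact: measurable_indic.
have mF : measurable_fun setT (F : measurableTypeR R * measurableTypeR R -> _).
  apply/measurable_EFinP; apply: measurable_funM.
    exact/measurable_EFinP.
  by apply: measurableT_comp => //; exact: measurable_normal_pdf.
have F0 p : (0 <= F p)%E.
  by rewrite lee_fin !mulr_ge0 ?normal_pdf_ge0// indicE.
under eq_integral do rewrite normal_prob_translate//.
have inner x : normal_prob x (Num.sqrt b) B =
   (\int[mu]_z (\1_B z * normal_pdf x (Num.sqrt b) z)%:E)%E.
  rewrite /normal_prob integral_mkcond; apply: eq_integral => z _.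
  by rewrite patchE indicE; case: ifPn => _; rewrite ?mul1r ?mul0r.
have G0 p : (0 <= (\1_B p.2 * normal_pdf p.1 (Num.sqrt b) p.2)%:E)%E.
  by rewrite lee_fin mulr_ge0 ?normal_pdf_ge0// indicE.
rewrite ge0_integral_normal_prob//; last first.
  under eq_fun do rewrite inner.
  exact: (measurable_fun_fubini_tonelli_F (m2 := mu) _ mG G0).
transitivity (\int[mu]_x \int[mu]_z F (x, z))%E.
  apply: eq_integral => x _; rewrite inner -ge0_integralZr//.
  - exact: (measurableT_comp mG (measurable_pair1 x)).
  - by move=> z _; exact: (G0 (x, z)).
  - by rewrite lee_fin normal_pdf_ge0.
rewrite (@fubini_tonelli _ _ _ _ R mu mu F mF F0).
rewrite /normal_prob [RHS]integral_mkcond; apply: eq_integral => z _.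
rewrite patchE.
transitivity (\int[mu]_x ((\1_B z * normal_pdf 0 (Num.sqrt (a + b)) z)%:E
   * (normal_pdf (z * a / (a + b)) (Num.sqrt (a * b / (a + b))) x)%:E))%E.
  by apply: eq_integral => x _; rewrite /F/= -mulrA normal_pdf_conv// mulrA EFinM.
rewrite ge0_integralZl//.
- rewrite integral_normal_pdf mule1 indicE; case: ifPn => _; rewrite ?mul1r ?mul0r//.
- by apply/measurable_EFinP; exact: measurable_normal_pdf.
- by move=> x _; rewrite lee_fin normal_pdf_ge0.
- by rewrite lee_fin mulr_ge0 ?normal_pdf_ge0// indicE.
Qed.

End GaussianDensity.

Section GaussianMoments.
Context (R : realType).
Notation mu := (@lebesgue_measure R).

(** [normal0] bundled as a probability, so that integrals and product measures can be formed from
    it. *)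
Definition gauss (v : R) : probability (measurableTypeR R) R :=
  if v == 0 then (\d_(0 : measurableTypeR R) : probability (measurableTypeR R) R)
  else (normal_prob 0 (Num.sqrt v) : probability (measurableTypeR R) R).

Lemma gaussE v : gauss v = normal0 v :> (set R -> \bar R).
Proof. by rewrite /gauss /normal0; case: ifPn. Qed.

Lemma measurable_gauss_translate b (B : set R) : measurable B ->
  measurable_fun setT (fun x : measurableTypeR R => gauss b [set y | B (x + y)]).
Proof.
move=> mB.
pose A := [set q : measurableTypeR R * measurableTypeR R | B (q.1 + q.2)].
have mA : measurable A.
  rewrite -[A]setTI; apply: (_ : measurable_fun setT (fun q : measurableTypeR R * measurableTypeR R => (q.1 + q.2 : measurableTypeR R))) => //.
  exact: measurable_funD.
rewrite (_ : (fun x => _) = gauss b \o xsection A); first exact: measurable_fun_xsection.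
apply/funext => x /=; congr (gauss b _).
by apply/seteqP; split => y /=; [move=> h; apply/mem_set|move/set_mem].
Qed.

(** A summand with the Dirac law at 0 changes nothing; when both variances are positive the
    densities convolve. *)
Lemma gauss_conv (a b : R) (B : set R) : 0 <= a -> 0 <= b -> measurable B ->
  (\int[gauss a]_x gauss b [set y | B (x + y)%R] = gauss (a + b) B)%E.
Proof.
move=> a0 b0 mB; rewrite {2}/gauss; case: ifPn => [/eqP ->|bn0].
  rewrite addr0 -[in RHS](setIT B) -(integral_indic (gauss a) measurableT mB).
  apply: eq_integral => x _; rewrite /= diracE indicE; congr (_%:R%:E); congr nat_of_bool.
  by apply/idP/idP => [/set_mem|/set_mem Bx]; [rewrite /= addr0 => /mem_set|apply/mem_set; rewrite /= addr0].
rewrite {1}/gauss; case: ifPn => [/eqP ->|an0].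
  have := measurable_gauss_translate b mB; rewrite /gauss (negPf bn0) => mg.
  rewrite integral_dirac// diracT mul1e add0r (_ : [set y | B (0 + y)] = B) ?(negPf bn0)//.
  by apply/funext => y /=; rewrite add0r.
rewrite /gauss gt_eqF; last by rewrite ltr_pwDl// lt_neqAle eq_sym an0.
by apply: normal_prob_conv; rewrite // lt_neqAle eq_sym ?an0 ?bn0.
Qed.

Section Positive.
Variable v : R.
Hypothesis v0 : 0 < v.
Let s := Num.sqrt v.
Let s0 : s != 0. Proof. by rewrite gt_eqF// sqrtr_gt0. Qed.
Let p := normal_pdf 0 s.
Let ball n : set R := `[- n.+1%:R, n.+1%:R]%classic.
Let cp : continuous p. Proof. exact: continuous_normal_pdf. Qed.

Let I (f : R -> R) n := \int[mu]_(x in ball n) (f x * p x).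

Let integrable_ball (f : R -> R) n : continuous f ->
  mu.-integrable (ball n) (EFin \o (fun x => f x * p x)).
Proof.
move=> cf; apply: continuous_compact_integrable; first exact: segment_compact.
by apply: continuous_subspaceT => x; apply: cvgM; [exact: cf|exact: cp].
Qed.

Let bigcup_ball : \bigcup_n ball n = setT.
Proof.
apply/seteqP; split => // x _; exists (Num.truncn `|x|) => //=.
by rewrite /ball/= in_itv/= -ler_norml; apply: ltW; exact: truncnS_gt.
Qed.

Let integral_cvg (f : R -> R) (l : R) : continuous f -> (forall x, 0 <= f x) ->
  I f @ \oo --> l -> (\int[normal_prob 0 s]_x (f x)%:E = l%:E)%E.
Proof.
move=> cf f0 Il.
have mf : measurable_fun setT f by exact: continuous_measurable_fun.
rewrite ge0_integral_normal_prob//; last exact/measurable_EFinP.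
have mfp : measurable_fun setT (fun x => (f x * p x)%:E).
  by apply/measurable_EFinP; apply: measurable_funM => //; exact: measurable_normal_pdf.
have h : (\int[mu]_(x in ball i) (f x * p x)%:E)%E @[i --> \oo] -->
    (\int[mu]_x (f x * p x)%:E)%E.
  rewrite -bigcup_ball; apply: ge0_nondecreasing_set_cvg_integral.
  - apply/nondecreasing_seqP => n; apply/subsetPset => x; rewrite /ball/= !in_itv/= -!ler_norml.
    by move=> /le_trans; apply; rewrite ler_nat.
  - by move=> i; exact: measurable_itv.
  - by move=> i; exact: measurable_funTS.
  - by move=> i x _; rewrite lee_fin mulr_ge0// normal_pdf_ge0.
apply: (cvg_unique _ h) => //.
rewrite (_ : (fun i => _) = fun i => (I f i)%:E).
  by apply: cvg_EFin => //; near=> i.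
apply/funext => i; rewrite /I /Rintegral fineK//.
apply: integrable_fin_num => //; first exact: measurable_itv.
exact: integrable_ball.
Unshelve. all: by end_near. Qed.

(** As p' = -(x/v) p, the derivative of F k is x^(k+1) p - k v x^(k-1) p. Integrating it over an
    interval gives the recursion of [gauss_moment] up to boundary terms. *)
Let F k (x : R) := - v * (x ^+ k * p x).

Let pE : p = fun x => normal_peak s * expR (- (v *+ 2)^-1 * x ^+ 2).
Proof.
apply/funext => x; rewrite /p normal_pdfE// /normal_fun subr0 /s sqr_sqrtr ?ltW//.
by congr (_ * expR _); rewrite !mulNr [in RHS]mulrC.
Qed.

Let is_derive_p (x : R) : is_derive x 1 p (- (x / v) * p x).
Proof.
have hq : is_derive x 1 (- (v *+ 2)^-1 \*: (@id R ^+ 2)) (- (v *+ 2)^-1 *: ((2 * x ^+ 1) *: 1)).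
  by apply: is_deriveZ; apply: is_deriveX; exact: is_derive_id.
have he := @is_derive1_comp _ expR _ x _ _ (is_derive_expR _) hq.
have := is_deriveZ (normal_peak s) he.
rewrite pE => h; apply: is_derive_eq h _.
rewrite /GRing.scale/= !fctE /GRing.scale/= expr1 mulr1.
by rewrite mulr2n; field; rewrite !gt_eqF ?addr_gt0.
Qed.

Let is_derive_F k (x : R) :
  is_derive x 1 (F k) (x ^+ k.+1 * p x - k%:R * v * (x ^+ k.-1 * p x)).
Proof.
have hX : is_derive x 1 (@id R ^+ k) ((k%:R * x ^+ k.-1) *: 1).
  by apply: is_deriveX; exact: is_derive_id.
have h := is_deriveZ (- v) (is_deriveM hX (is_derive_p x)).
rewrite (_ : F k = - v \*: ((@id R ^+ k) * p)); last by apply/funext => y; rewrite /= !fctE.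
apply: is_derive_eq h _.
rewrite /GRing.scale/= !fctE exprS mulr1.
by field; rewrite gt_eqF.
Qed.

Let FTC k n : I (fun x => x ^+ k.+1) n - k%:R * v * I (fun x => x ^+ k.-1) n
  = F k n.+1%:R - F k (- n.+1%:R).
Proof.
have cX j : continuous (fun x : R => x ^+ j) by move=> x; exact: exprn_continuous.
have mB : measurable (ball n : set (measurableTypeR R)) by exact: measurable_itv.
have i1 := @integrable_ball _ n (cX k.+1).
have i2 := @integrable_ball _ n (cX k.-1).
have i3 : mu.-integrable (ball n) (EFin \o (fun x => k%:R * v * (x ^+ k.-1 * p x))).
  apply: (eq_integrable mB _ _ _ (integrableZl mB (k%:R * v) i2)).
  by move=> x _ /=; rewrite EFinM.
rewrite /I -RintegralZl// -RintegralB// /Rintegral /ball.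
have cF : continuous (F k).
  move=> x; apply/differentiable_continuous/derivable1_diffP.
  by have [] := is_derive_F k x.
rewrite (@continuous_FTC2 _ _ (F k)) //.
- rewrite (@lt_trans _ _ 0)// oppr_lt0//.
- apply: continuous_subspaceT => x; apply: cvgB.
    by apply: cvgM; [exact: cX|exact: cp].
  by apply: cvgM; [exact: cvg_cst|apply: cvgM; [exact: cX|exact: cp]].
- split; [by move=> x _; have [] := is_derive_F k x| |].
    exact/cvg_at_right_filter/cF.
  exact/cvg_at_left_filter/cF.
- by move=> x _; rewrite derive1E; have [_ ->] := is_derive_F k x.
Qed.

Let tail k : F k n.+1%:R @[n --> \oo] --> (0 : R).
Proof.
(* From e^y >= y^(k+1)/(k+1)! with y = x^2/(2v) one gets x^k p(x) <= c/x at x = n + 1. *)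
pose c := normal_peak s * ((v *+ 2) ^+ k.+1 * (k.+1)`!%:R).
have c0 : 0 <= c by rewrite !mulr_ge0 ?normal_peak_ge0// exprn_ge0// mulrn_wge0// ltW.
apply/norm_cvg0P.
apply: (@squeeze_cvgr _ _ _ _ (fun=> 0 : R) (fun n => v * c * n.+1%:R^-1)).
- near=> n; rewrite normr_ge0/= /F mulNr normrN normrM (gtr0_norm v0) -mulrA.
  apply: ler_wpM2l; first exact: ltW.
  have p0 : 0 <= p n.+1%:R by exact: normal_pdf_ge0.
  rewrite ger0_norm; last by rewrite mulr_ge0// exprn_ge0.
  have n0 : 0 < n.+1%:R :> R by [].
  rewrite pE mulrCA /c -[leRHS]mulrA; apply: ler_wpM2l; first exact: normal_peak_ge0.
  set y := (v *+ 2)^-1 * n.+1%:R ^+ 2.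
  have v20 : 0 < v *+ 2 by rewrite mulrn_wgt0.
  have y0 : 0 < y by rewrite mulr_gt0 ?invr_gt0 ?exprn_gt0.
  have hy : y ^+ k.+1 / (k.+1)`!%:R <= expR y.
    by apply: le_trans (expR_ge1Dxn k (ltW y0)); rewrite lerDr.
  have hy2 : expR (- y) <= (k.+1)`!%:R * y ^- k.+1.
    rewrite expRN -[leRHS]invrK lef_pV2 ?posrE ?expR_gt0//.
      by rewrite invfM invrK mulrC.
    by rewrite invr_gt0 mulr_gt0 ?invr_gt0 ?exprn_gt0// ltr0n fact_gt0.
  rewrite mulNr -/y; apply: le_trans (ler_wpM2l (exprn_ge0 _ (ltW n0)) hy2) _.
  rewrite mulrC -[leLHS]mulrA [leRHS](_ : _ = (k.+1)`!%:R * ((v *+ 2) ^+ k.+1 * n.+1%:R^-1)); last by ring.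
  apply: ler_wpM2l => //.
  rewrite /y exprMn exprVn invfM invrK -mulrA; apply: ler_wpM2l; first by rewrite exprn_ge0// ltW.
  rewrite -exprM mulrC ler_pdivrMr ?exprn_gt0// mulrC ler_pdivlMr// -exprSr.
  by rewrite ler_weXn2l ?ler1n// mul2n -addnn; lia.
- exact: cvg_cst.
- rewrite -[X in _ --> X](mulr0 (v * c)); apply: cvgMr.
  exact: cvg_harmonic.
Unshelve. all: by end_near. Qed.

Let F_odd k (x : R) : F k (- x) = (-1) ^+ k * F k x.
Proof.
have -> : F k (- x) = - v * ((- x) ^+ k * p x) by rewrite /F pE /= sqrrN.
by rewrite (exprNn x) /F; move: ((-1) ^+ k) => e; ring.
Qed.

Let I_cvg m : I (fun x => x ^+ m) @ \oo --> gauss_moment v m.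
Proof.
have bd k : F k n.+1%:R - F k (- n.+1%:R) @[n --> \oo] --> (0 : R).
  rewrite (_ : (fun n => _) = fun n => (1 - (-1) ^+ k) * F k n.+1%:R).
    by rewrite -[X in _ --> X](mulr0 (1 - (-1) ^+ k)); apply: cvgMr; exact: tail.
  by apply/funext => n; rewrite F_odd mulrBl mul1r.
elim/ltn_ind: m => -[|[|m]] IH.
- rewrite /=.
  have mp : measurable_fun setT (fun x => (p x)%:E).
    by apply/measurable_EFinP; exact: measurable_normal_pdf.
  have h : (\int[mu]_(x in ball i) (p x)%:E)%E @[i --> \oo] --> (1%:E : \bar R).
    rewrite -(integral_normal_pdf 0 s) -/p -bigcup_ball.
    apply: ge0_nondecreasing_set_cvg_integral.
    + apply/nondecreasing_seqP => n; apply/subsetPset => x; rewrite /ball/= !in_itv/= -!ler_norml.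
      by move=> /le_trans; apply; rewrite ler_nat.
    + by move=> i; exact: measurable_itv.
    + by move=> i; exact: measurable_funTS.
    + by move=> i x _; rewrite lee_fin normal_pdf_ge0.
  rewrite (_ : I _ = fun n => fine (\int[mu]_(x in ball n) (p x)%:E)%E).
    exact: fine_cvg.
  apply/funext => n; rewrite /I /Rintegral; congr fine.
  by apply: eq_integral => x _; rewrite expr0 mul1r.
- rewrite /= (_ : I _ = fun n => F 0 n.+1%:R - F 0 (- n.+1%:R)); first exact: bd.
  by apply/funext => n; rewrite -FTC !mul0r subr0.
- rewrite (_ : I _ = fun n => (F m.+1 n.+1%:R - F m.+1 (- n.+1%:R))
    + m.+1%:R * v * I (fun x => x ^+ m) n); last first.
    by apply/funext => n; rewrite -FTC subrK.
  rewrite -[X in _ --> X]add0r /=; apply: cvgD; first exact: bd.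
  by apply: cvgMr; exact: IH.
Qed.

(** Monotone convergence on growing intervals handles nonnegative integrands, even powers among
    them. For an odd power, 1 + x^(2k+2) + x^(2k+1) is nonnegative, and the two even moments are
    subtracted afterwards. *)
Lemma normal_moments m :
  (normal_prob 0 s).-integrable setT (EFin \o (fun x : measurableTypeR R => x ^+ m)) /\
  Ex (normal_prob 0 s) (fun x => x ^+ m) = gauss_moment v m.
Proof.
have cX j : continuous (fun x : R => x ^+ j) by move=> x; exact: exprn_continuous.
have key (f : R -> R) (l : R) : continuous f -> (forall x, 0 <= f x) ->
    I f @ \oo --> l ->
  (normal_prob 0 s).-integrable setT (EFin \o f) /\ Ex (normal_prob 0 s) f = l.
  move=> cf f0 Il; have h := integral_cvg cf f0 Il.
  split; last by rewrite /Ex /Rintegral h.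
  apply/integrableP; split.
    by apply/measurable_EFinP; exact: continuous_measurable_fun.
  under eq_integral do rewrite gee0_abs ?lee_fin//.
  by rewrite h ltry.
have even k : (normal_prob 0 s).-integrable setT (EFin \o (fun x : measurableTypeR R => x ^+ k.*2)) /\
  Ex (normal_prob 0 s) (fun x => x ^+ k.*2) = gauss_moment v k.*2.
  by apply: key => // x; rewrite -mul2n exprM exprn_ge0// sqr_ge0.
suff odd_case k : (normal_prob 0 s).-integrable setT (EFin \o (fun x : measurableTypeR R => x ^+ k.*2.+1)) /\
  Ex (normal_prob 0 s) (fun x => x ^+ k.*2.+1) = gauss_moment v k.*2.+1.
  by rewrite -(odd_double_half m); case: (odd m); [exact: odd_case|exact: even].
have [i1 E1] := even 0%N; have [i2 E2] := even k.+1.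
pose g (x : R) := x ^+ 0 + x ^+ k.+1.*2 + x ^+ k.*2.+1.
have [ig Eg] : (normal_prob 0 s).-integrable setT (EFin \o g) /\
   Ex (normal_prob 0 s) g = gauss_moment v 0 + gauss_moment v k.+1.*2 + gauss_moment v k.*2.+1.
  apply: key.
  - by move=> x; apply: cvgD; [apply: cvgD; exact: cX|exact: cX].
  - move=> x; rewrite /g expr0; have [x1|x1] := leP `|x| 1.
      have : `|x ^+ k.*2.+1| <= 1 by rewrite normrX exprn_ile1.
      have : 0 <= x ^+ k.+1.*2 by rewrite -mul2n exprM exprn_ge0// sqr_ge0.
      by rewrite ler_norml => h1 /andP[h2 _]; lra.
    have : `|x ^+ k.*2.+1| <= x ^+ k.+1.*2.
      have -> : x ^+ k.+1.*2 = `|x| ^+ k.*2.+2.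
        by rewrite -normrX ger0_norm ?doubleS// -doubleS -mul2n exprM exprn_ge0// sqr_ge0.
      by rewrite normrX ler_weXn2l// ltW.
    by rewrite ler_norml => /andP[h2 _]; lra.
  - rewrite (_ : I g = fun n => I (fun x => x ^+ 0) n + I (fun x => x ^+ k.+1.*2) n
        + I (fun x => x ^+ k.*2.+1) n).
      by apply: cvgD; [apply: cvgD|]; exact: I_cvg.
    apply/funext => n; rewrite /I /g.
    have mB : measurable (ball n : set (measurableTypeR R)) by exact: measurable_itv.
    have j0 := @integrable_ball _ n (cX 0%N); have j1 := @integrable_ball _ n (cX k.+1.*2).
    have j2 := @integrable_ball _ n (cX k.*2.+1).
    rewrite -RintegralD// -RintegralD//.
      by apply: eq_Rintegral => x _; rewrite !mulrDl.
    apply: (eq_integrable mB _ _ _ (integrableD mB j0 j1)).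
    by move=> x _ /=; rewrite EFinD.
have i3 := integrable_EFinB (integrable_EFinB ig i1) i2.
have gE : (fun x : measurableTypeR R => g x - x ^+ 0 - x ^+ k.+1.*2) = fun x => x ^+ k.*2.+1.
  by apply/funext => x; rewrite /g; ring.
rewrite gE in i3; split => //.
rewrite -gE /Ex RintegralB//; last exact: integrable_EFinB.
rewrite RintegralB// -!/(Ex _ _) Eg E1 E2.
by move: (gauss_moment v k.*2.+1) => x; ring.
Qed.

End Positive.

Lemma gauss_moments (v : R) m : 0 <= v ->
  (gauss v).-integrable setT (EFin \o (fun x : measurableTypeR R => x ^+ m)) /\
  Ex (gauss v) (fun x => x ^+ m) = gauss_moment v m.
Proof.
move=> v0; rewrite /gauss; case: ifPn => [/eqP ->|vn0]; last first.
  by apply: normal_moments; rewrite lt_neqAle eq_sym vn0.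
have mX : measurable_fun setT (fun x : measurableTypeR R => (x ^+ m)%:E).
  by apply/measurable_EFinP.
have h : (\int[\d_(0%R : measurableTypeR R)]_x (x ^+ m)%:E = (gauss_moment 0 m)%:E)%E.
  rewrite integral_dirac// diracT mul1e; congr (_%:E).
  elim/ltn_ind: m {mX} => -[|[|m]] IH /=; rewrite ?expr0 ?expr1//.
  by rewrite mulr0 mul0r exprS mul0r.
split; last by rewrite /Ex /Rintegral h.
apply/integrableP; split => //.
rewrite integral_dirac//; last exact: measurableT_comp.
by rewrite diracT mul1e ltry.
Qed.

End GaussianMoments.

Section GaussianScaling.
Context (R : realType).
Notation mu := (@lebesgue_measure R).

Lemma lebesgue_measure_scale (al : R) (A : set R) : al != 0 -> measurable A ->
  mu A = (`|al|%:E * mu [set x | A (al * x)%R])%E.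
Proof.
move=> al0 mA.
pose sc (y : measurableTypeR R) : measurableTypeR R := al * y.
have msc : measurable_fun setT sc by exact: measurable_funM.
apply: (@lebesgue_measure_unique R (mscale (NngNum (normr_ge0 al)) (pushforward mu sc))) => // _ [[a b] /= _ <-].
rewrite /mscale/= /pushforward/=.
have [al_gt0|al_lt0|/eqP] := ltrgtP al 0; last by rewrite (negPf al0).
- rewrite (_ : sc @^-1` _ = `[b / al, a / al[%classic); last first.
    apply/seteqP; split => y; rewrite /sc/= !in_itv/= ler_ndivrMr// ltr_ndivlMr// [y * al]mulrC.
      by move=> /andP[-> ->].
    by move=> /andP[-> ->].
  rewrite !lebesgue_measure_itv/= !lte_fin ltr_nM2r ?invr_lt0//.
  case: ifPn => _; last by rewrite mule0.
  by rewrite -!EFinB -EFinM ltr0_norm//; congr (_%:E); field.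
- rewrite (_ : sc @^-1` _ = `]a / al, b / al]%classic); last first.
    apply/seteqP; split => y; rewrite /sc/= !in_itv/= ltr_pdivrMr// ler_pdivlMr// [y * al]mulrC.
      by move=> /andP[-> ->].
    by move=> /andP[-> ->].
  rewrite !lebesgue_measure_itv/= !lte_fin ltr_pM2r ?invr_gt0//.
  case: ifPn => _; last by rewrite mule0.
  by rewrite -!EFinB -EFinM gtr0_norm//; congr (_%:E); field.
Qed.

(** Change of variables in the density; when al = 0 or a = 0 both sides are the Dirac mass at 0. *)
Lemma gauss_scale (a al : R) (B : set R) : 0 <= a -> measurable B ->
  gauss a [set x | B (al * x)] = gauss (al ^+ 2 * a) B.
Proof.
move=> a0 mB.
have d0 : gauss 0 [set x : R | B 0] = gauss 0 B.
  by rewrite !gaussE /normal0 eqxx !diracE.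
have [->|aln0] := eqVneq al 0.
  have -> : [set x | B (0 * x)] = [set x : R | B 0].
    by apply/funext => x /=; rewrite mul0r.
  have -> : 0 ^+ 2 * a = 0 by rewrite expr0n mul0r.
  apply: etrans d0; have [B0|nB0] := pselect (B 0).
    have -> : [set x : R | B 0] = setT by apply/seteqP; split.
    exact: etrans (probability_setT (gauss a)) (esym (probability_setT (gauss 0))).
  have -> : [set x : R | B 0] = set0 by apply/seteqP; split.
  exact: etrans (measure0 (gauss a)) (esym (measure0 (gauss 0))).
have [->|an0] := eqVneq a 0.
  rewrite mulr0 !gaussE /normal0 eqxx !diracE; congr (_%:R%:E); congr nat_of_bool.
  apply/idP/idP => /set_mem h; apply/mem_set; first by move: h => /=; rewrite mulr0.
  by rewrite /= mulr0.
have a_gt0 : 0 < a by rewrite lt_neqAle eq_sym an0.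
have al20 : 0 < al ^+ 2 by rewrite exprn_even_gt0.
have c0 : 0 < al ^+ 2 * a by rewrite mulr_gt0.
have c1 : (al ^+ 2 * a == 0) = false by rewrite gt_eqF.
rewrite !gaussE /normal0 (negPf an0) c1 /normal_prob.
pose sc (y : measurableTypeR R) : measurableTypeR R := al * y.
have msc : measurable_fun setT sc by exact: measurable_funM.
have sn (t : R) : 0 < t -> Num.sqrt t != 0 by move=> t0; rewrite gt_eqF// sqrtr_gt0.
have mp : measurable_fun B (fun x => (normal_pdf 0 (Num.sqrt (al ^+ 2 * a)) x)%:E).
  by apply: measurable_funTS; apply/measurable_EFinP; exact: measurable_normal_pdf.
pose pm : {measure set (measurableTypeR R) -> \bar R} :=
  measure_function_pushforward__canonical__measure_function_Measure mu msc.
have muE A : measurable A -> mu A = mscale (NngNum (normr_ge0 al)) pm A.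
  by move=> mA; rewrite (lebesgue_measure_scale aln0 mA).
pose sm : {measure set (measurableTypeR R) -> \bar R} := mscale (NngNum (normr_ge0 al)) pm.
rewrite (@eq_measure_integral _ (measurableTypeR R) R B sm); last first.
  by move=> A mA _; exact: muE.
rewrite /sm ge0_integral_mscale//; last by move=> x _; rewrite lee_fin normal_pdf_ge0.
rewrite /pm ge0_integral_pushforward//; last by move=> x _; rewrite lee_fin normal_pdf_ge0.
rewrite -ge0_integralZl//.
- apply: eq_integral => x _ /=; rewrite -EFinM; congr (_%:E).
  rewrite !normal_pdfE ?sn//; apply: etrans (esym (mulrA _ _ _)); congr (_ * _).
    rewrite /normal_peak !sqr_sqrtr ?ltW//.
    have -> : al ^+ 2 * a * pi *+ 2 = al ^+ 2 * (a * pi *+ 2) by rewrite !mulr2n; ring.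
    by rewrite sqrtrM ?sqr_ge0// sqrtr_sqr invfM mulrA mulfV ?mul1r// normr_eq0.
  rewrite /normal_fun !sqr_sqrtr ?ltW//; congr expR.
  by rewrite /sc !subr0 !mulr2n; field; rewrite !gt_eqF ?addr_gt0.
- by have := (msc) measurableT B mB; rewrite setTI.
- apply: measurable_funTS; apply/measurable_EFinP.
  by apply: measurableT_comp; [exact: measurable_normal_pdf|exact: measurable_funM].
- by move=> x _; rewrite lee_fin normal_pdf_ge0.
Qed.

End GaussianScaling.

(** * Existence of Gaussian vectors with a given covariance matrix *)

Section CenteredNormal.
Context (R : realType).

Definition quad_form m (S : 'M[R]_m) (t : 'rV[R]_m) : R := (t *m S *m t^T) ord0 ord0.

Lemma quad_form_block m (a : R) (b : 'rV[R]_m) (S : 'M[R]_m) (s : R) (u : 'rV[R]_m) :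
  quad_form (block_mx a%:M b b^T S : 'M[R]_(1 + m)) (row_mx s%:M u) =
  s ^+ 2 * a + 2 * s * dotp u b + quad_form S u.
Proof.
have bu : b *m u^T = u *m b^T.
  by rewrite -[LHS]trmxK trmx_mul trmxK; apply/matrixP => i j; rewrite !ord1 mxE.
rewrite /quad_form mul_row_block tr_row_mx mul_row_col tr_scalar_mx mul_mx_scalar.
rewrite !mul_scalar_mx mulmxDl -scalemxAl bu /dotp.
by move: (u *m b^T) (u *m S *m u^T) => p q; rewrite !mxE eqxx mulr1n; ring.
Qed.

Lemma block_scalar_mx m (Sg : 'M[R]_(1 + m)) : Sg^T = Sg ->
  Sg = block_mx (Sg ord0 ord0)%:M (ursubmx Sg) (ursubmx Sg)^T (drsubmx Sg).
Proof.
move=> sym; rewrite -{1}(submxK Sg); congr block_mx; last by rewrite trmx_ursub sym.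
by apply/matrixP => i j; rewrite !ord1 !mxE eqxx mulr1n; congr (Sg _ _); apply/val_inj.
Qed.

Lemma trmx_schur m (a : R) (b : 'rV[R]_m) (S : 'M[R]_m) : S^T = S ->
  (S - a^-1 *: (b^T *m b))^T = S - a^-1 *: (b^T *m b).
Proof. by move=> sS; rewrite linearB linearZ/= trmx_mul trmxK sS. Qed.

Lemma quad_form_schur m (a : R) (b : 'rV[R]_m) (S : 'M[R]_m) (u : 'rV[R]_m) :
  quad_form (S - a^-1 *: (b^T *m b)) u = quad_form S u - a^-1 * dotp u b ^+ 2.
Proof.
have e : u *m (a^-1 *: (b^T *m b)) *m u^T = a^-1 *: ((u *m b^T) *m (u *m b^T)^T).
  by rewrite -scalemxAr -scalemxAl trmx_mul trmxK !mulmxA.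
rewrite /quad_form mulmxBr mulmxBl e /dotp.
by move: (u *m b^T) (u *m S *m u^T) => p q; rewrite !mxE big_ord1 !mxE expr2.
Qed.

Lemma measurable_dotp m (t : 'rV[R]_m) : measurable_fun setT (dotp t : borel R m -> R).
Proof. apply: continuous_measurable_borel; exact: continuous_dotp. Qed.

(** Induction on the dimension. Let the first coordinate have variance a and covariances b with the
    others. The law is that of (g, Y + (g/a) b), where g has law N(0, a) and Y is an independent
    Gaussian vector whose covariance is the Schur complement S - b^T b / a. If a = 0, positivity
    forces b to vanish, and the convention 0^-1 = 0 keeps the formulas valid. *)
Lemma centered_normal_exists m (Sg : 'M[R]_m) : Sg^T = Sg ->
  (forall t, 0 <= quad_form Sg t) ->
  exists nu : probability (borel R m) R, is_centered_normal Sg nu.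
Proof.
elim: m Sg => [|m IH] Sg sym psd.
  exists (\d_(0 : borel R 0) : probability (borel R 0) R); split => // t.
  have q0 : (t *m Sg *m t^T) ord0 ord0 = 0.
    by rewrite mxE big_ord0.
  rewrite q0; split => // B mB; rewrite /normal0 eqxx !diracE; congr (_%:R%:E).
  congr nat_of_bool; apply/idP/idP => /set_mem h; apply/mem_set; move: h => /=; by rewrite mxE big_ord0.
rewrite -[m.+1]/(1 + m)%N in Sg sym psd *.
pose a := Sg ord0 ord0; pose b : 'rV[R]_m := ursubmx Sg; pose S : 'M[R]_m := drsubmx Sg.
have SgE : Sg = block_mx a%:M b b^T S by exact: block_scalar_mx.
have sS : S^T = S by rewrite /S trmx_drsub sym.
have psd' s u : 0 <= s ^+ 2 * a + 2 * s * dotp u b + quad_form S u.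
  by rewrite -quad_form_block -SgE.
have a0 : 0 <= a.
  have := psd' 1 0; rewrite /quad_form mul0mx mul0mx /dotp mul0mx !mxE.
  by rewrite expr1n mul1r mulr0 !addr0.
have ab0 u : a = 0 -> dotp u b = 0.
  move=> az; apply/eqP/negPn/negP => ub.
  (* For a = 0 this first coordinate would give the quadratic form the value -1. *)
  have := psd' (- (quad_form S u + 1) / (2 * dotp u b)) u.
  rewrite az mulr0 add0r (_ : 2 * _ * _ = - (quad_form S u + 1)); last by field.
  lra.
pose S' := S - a^-1 *: (b^T *m b).
have [nu' [_ nu'P]] : exists nu' : probability (borel R m) R, is_centered_normal S' nu'.
  apply: IH => [|u]; first exact: trmx_schur.
  rewrite quad_form_schur.
  (* For a > 0 this first coordinate minimizes the quadratic form, and the minimum is the Schur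
     complement. *)
  have := psd' (- dotp u b * a^-1) u.
  have [az|an0] := eqVneq a 0; first by rewrite az ab0// invr0; lra.
  by rewrite (_ : _ + _ + _ = quad_form S u - a^-1 * dotp u b ^+ 2)//; field.
pose Phi (p : measurableTypeR R * borel R m) : borel R (1 + m) :=
  row_mx (p.1 : R)%:M (p.2 + (p.1 / a : R) *: b).
have mPhi : measurable_fun setT Phi.
  apply: measurable_to_borel => i; case: (split_ordP i) => j ->.
    rewrite (_ : (fun p => _) = fst); first exact: measurable_fst.
    by apply/funext => p; rewrite /Phi row_mxEl !ord1 mxE eqxx mulr1n.
  rewrite (_ : (fun p => _) = fun p : measurableTypeR R * borel R m =>
      (p.2 : 'rV[R]_m) ord0 j + p.1 * (a^-1 * b ord0 j)); last first.
    by apply/funext => p; rewrite /Phi row_mxEr !mxE mulrA.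
  apply: measurable_funD; last by apply: measurable_funM => //; exact: measurable_fst.
  apply: (measurableT_comp (f := fun v : borel R m => (v : 'rV[R]_m) ord0 j)); last exact: measurable_snd.
  by apply: continuous_measurable_borel; exact: continuous_coord.
pose X : {mfun (measurableTypeR R * borel R m)%type >-> borel R (1 + m)} :=
  mfun_Sub (mem_set mPhi : Phi \in mfun).
exists (distribution (gauss a \x nu')%E X); split => // t.
split => [|B mB]; first exact: psd.
pose s : R := t ord0 ord0; pose u : 'rV[R]_m := rsubmx t.
have tE : t = row_mx s%:M u.
  rewrite -[t in LHS]hsubmxK; congr row_mx; apply/matrixP => i j.
  by rewrite !ord1 !mxE eqxx mulr1n /s; congr (t _ _); apply/val_inj.
(* The coefficient of g in <t, Phi(g, Y)> = al g + <u, Y>: a sum of independent centred normals of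
   variances al^2 a and [quad_form S' u]. *)
pose al := s + dotp u b / a.
have dotPhi p : dotp t (Phi p) = al * p.1 + dotp u p.2.
  rewrite /dotp /Phi tE tr_row_mx mul_row_col tr_scalar_mx mxE linearD linearZ mulmxDr/=.
  rewrite -scalemxAr mul_scalar_mx !mxE eqxx mulr1n.
  have -> : \sum_j u ord0 j * b^T j ord0 = dotp u b by rewrite /dotp mxE.
  rewrite /al; move: (\sum_j _) (dotp u b) => x y.
  case: p => p p2 /=; move: (p : R) => g; ring.
have mBg (g : R) : measurable [set y : measurableTypeR R | B (g + y)].
  rewrite -[X in measurable X]setTI.
  by apply: (_ : measurable_fun setT (fun y : measurableTypeR R => g + y)) => //; exact: measurable_funD.
have [q0 _] := nu'P u; rewrite -/(quad_form S' u) in q0.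
have step1 : (distribution (gauss a \x nu')%E X [set v | B (dotp t v)] =
    \int[gauss a]_g gauss (quad_form S' u) [set y | B (al * g + y)%R])%E.
  apply: eq_integral => g _ /=.
  rewrite gaussE; have [_ <-] := nu'P u; last exact: mBg.
  congr (nu' _); apply/seteqP; split => v.
    by move/set_mem; rewrite /X /= dotPhi.
  by move=> h; apply/mem_set; rewrite /X /= dotPhi.
apply: etrans step1 _.
pose sc (y : measurableTypeR R) : measurableTypeR R := al * y.
have msc : measurable_fun setT sc by exact: measurable_funM.
pose pm : {measure set (measurableTypeR R) -> \bar R} :=
  measure_function_pushforward__canonical__measure_function_Measure (gauss a) msc.
have mg := measurable_gauss_translate (quad_form S' u) mB.
have step2 : (\int[gauss a]_g gauss (quad_form S' u) [set y | B (al * g + y)%R] =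
    \int[pm]_x gauss (quad_form S' u) [set y | B (x + y)%R])%E.
  by rewrite ge0_integral_pushforward.
apply: etrans step2 _.
have step3 : (\int[pm]_x gauss (quad_form S' u) [set y | B (x + y)%R] =
    \int[gauss (al ^+ 2 * a)]_x gauss (quad_form S' u) [set y | B (x + y)%R])%E.
  apply: eq_measure_integral => A mA _; exact: gauss_scale.
apply: etrans step3 _.
have al2 : 0 <= al ^+ 2 * a by rewrite mulr_ge0// sqr_ge0.
apply: etrans (gauss_conv al2 q0 mB) _.
rewrite gaussE; congr (normal0 _ B).
rewrite -[RHS]/(quad_form Sg t) tE SgE quad_form_block quad_form_schur /al.
have [az|an0] := eqVneq a 0; first by rewrite az ab0// invr0; ring.
by field.
Qed.

End CenteredNormal.

(** * Absolutely convergent sums as limits of finite sums *)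

Section FiniteApproximation.
Context (R : realType) (T : choiceType).
Implicit Types (g : T -> R) (s : seq T) (B : R).

Lemma esum_bounded g B : (forall x, 0 <= g x) ->
    (forall s, uniq s -> \sum_(x <- s) g x <= B) ->
  [/\ (\esum_(x in setT) (g x)%:E)%E \is a fin_num,
      forall s, uniq s -> \sum_(x <- s) g x <= fine (\esum_(x in setT) (g x)%:E)%E &
      forall e, 0 < e -> exists2 s, uniq s &
        fine (\esum_(x in setT) (g x)%:E)%E - e <= \sum_(x <- s) g x].
Proof.
move=> g0 gB.
have sumE A : finite_set A ->
    (\sum_(x \in A) (g x)%:E)%E = (\sum_(x <- fset_set A) g x)%:E.
  by move=> fA; rewrite fsbig_finite// sumEFin.
have esum_fin : (\esum_(x in setT) (g x)%:E)%E \is a fin_num.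
  rewrite ge0_fin_numE; last by apply: esum_ge0 => x _; rewrite lee_fin.
  apply: le_lt_trans (ltry B); apply: ge_ereal_sup => _ [A [fA _] <-].
  by rewrite sumE// lee_fin gB.
split => // [s us|e e0].
  rewrite -lee_fin fineK//; apply: ereal_sup_ubound; exists [set` s].
    by split => //; exact: finite_seq.
  rewrite sumE; last exact: finite_seq.
  congr (_%:E); apply/perm_big/uniq_perm => // x.
  by rewrite in_fset_set; [apply/idP/idP => h; [exact: set_mem h|exact: mem_set]|exact: finite_seq].
have [_ [A [fA _] <-] h] := ub_ereal_sup_adherent e0 esum_fin.
exists (fset_set A) => //.
by rewrite -lee_fin EFinB fineK// ltW// -sumE.
Qed.

(** The positive and negative parts are each approximated from below by a finite subset; a finite s
    containing both subsets approximates the difference. *)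
Lemma summable_approximation (g : T -> R) B :
    (forall s, uniq s -> \sum_(x <- s) `|g x| <= B) ->
  summable setT (fun x => (g x)%:E) /\
  forall e, 0 < e -> exists2 F, uniq F & forall s, uniq s -> {subset F <= s} ->
    `|fine (\esum_(x in setT) (fun x => (g x)%:E)^\+%E x
            - \esum_(x in setT) (fun x => (g x)%:E)^\-%E x)%E
      - \sum_(x <- s) g x| <= e.
Proof.
move=> gB.
have absE : (fun x => `|(g x)%:E|)%E = (fun x => `|g x|%:E) by [].
pose gp x := Num.max (g x) 0; pose gn x := Num.max (- g x) 0.
have gpE : (fun x => (g x)%:E)^\+%E = fun x => (gp x)%:E.
  by apply/funext => x; rewrite funeposE EFin_max.
have gnE : (fun x => (g x)%:E)^\-%E = fun x => (gn x)%:E.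
  by apply/funext => x; rewrite funenegE -EFinN EFin_max.
have gp0 x : 0 <= gp x by rewrite le_max lexx orbT.
have gn0 x : 0 <= gn x by rewrite le_max lexx orbT.
have gpn x : g x = gp x - gn x.
  by rewrite /gp /gn; case: (leP (g x) 0); case: (leP (- g x) 0) => //; lra.
have gp_le x : gp x <= `|g x| by rewrite ge_max ler_norm normr_ge0.
have gn_le x : gn x <= `|g x| by rewrite ge_max ler_normr lexx orbT normr_ge0.
have gpB s : uniq s -> \sum_(x <- s) gp x <= B.
  by move=> us; apply: le_trans (gB s us); apply: ler_sum.
have gnB s : uniq s -> \sum_(x <- s) gn x <= B.
  by move=> us; apply: le_trans (gB s us); apply: ler_sum.
have [pfin ple pge] := esum_bounded gp0 gpB; have [nfin nle nge] := esum_bounded gn0 gnB.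
split.
  rewrite /summable absE.
  have [fin _ _] := esum_bounded (fun x => normr_ge0 (g x)) gB.
  by rewrite ltey_eq fin.
move=> e e0; have [F1 uF1 hF1] := pge _ e0; have [F2 uF2 hF2] := nge _ e0.
exists (undup (F1 ++ F2)) => [|s us sub]; first exact: undup_uniq.
have mono (h : T -> R) F : (forall x, 0 <= h x) -> uniq F -> {subset F <= s} ->
    \sum_(x <- F) h x <= \sum_(x <- s) h x.
  move=> h0 uF sF; rewrite [leRHS](bigID (mem F))/= -[leLHS]addr0.
  apply: lerD; last exact: sumr_ge0.
  rewrite -[leRHS]big_filter le_eqVlt; apply/orP; left; apply/eqP; apply: perm_big; apply: uniq_perm => //; first exact: filter_uniq.
  by move=> x; rewrite mem_filter; case: (boolP (x \in F)) => //= /sF ->.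
have h1 : \sum_(x <- F1) gp x <= \sum_(x <- s) gp x.
  by apply: mono => // x xF; apply: sub; rewrite mem_undup mem_cat xF.
have h2 : \sum_(x <- F2) gn x <= \sum_(x <- s) gn x.
  by apply: mono => // x xF; apply: sub; rewrite mem_undup mem_cat xF orbT.
rewrite gpE gnE fineB//.
have -> : \sum_(x <- s) g x = \sum_(x <- s) gp x - \sum_(x <- s) gn x.
  by rewrite -sumrB; apply: eq_bigr.
have := ple s us; have := nle s us.
move: (\sum_(x <- s) gp x) (\sum_(x <- s) gn x) h1 h2 hF1 hF2 => x y.
move: (\sum_(x <- F1) gp x) (\sum_(x <- F2) gn x) (fine _) (fine _) => *.
rewrite ler_norml; lra.
Qed.

End FiniteApproximation.

(** * Local scores as bounded, translation equivariant functions of finite range *)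

Section FiniteRangeScores.
Context (R : realType) (d : nat).
Implicit Types (x y : 'rV[int]_d) (mu : set 'rV[int]_d).
Implicit Types (xi : 'rV[int]_d -> set 'rV[int]_d -> R).

Definition finite_range_score k (M : R) xi : Prop :=
  [/\ forall x mu, xi x mu = xi x (mu `&` W x k),
      forall x mu, `|xi x mu| <= M,
      forall x y mu, xi (x + y) (translate y mu) = xi x mu &
      forall x mu, ~ mu x -> xi x mu = 0].

Lemma translateE y mu : translate y mu = [set z | mu (z - y)].
Proof.
apply/seteqP; split => z /=; first by move=> [x mx <-]; rewrite addrK.
by move=> mz; exists (z - y) => //; rewrite subrK.
Qed.

Lemma translateK y : cancel (translate y) (translate (- y)).
Proof. by move=> mu; rewrite !translateE; apply/funext => z /=; rewrite opprK addrK. Qed.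

Definition neighbours k x := [seq x + z | z <- ball_seq d k].

Lemma mem_neighbours k x y : (y \in neighbours k x) = (l1norm (x - y)%R <= k)%N.
Proof.
rewrite l1normC -mem_ball_seq; apply/mapP/idP => [[z zk ->]|yx].
  by rewrite addrC addKr.
by exists (y - x) => //; rewrite addrC subrK.
Qed.

Lemma uniq_neighbours k x : uniq (neighbours k x).
Proof. by rewrite map_inj_uniq ?uniq_ball_seq//; exact: addrI. Qed.

Lemma size_neighbours k x : size (neighbours k x) = wcard d k.
Proof. by rewrite size_map size_ball_seq. Qed.

Lemma neighboursE k x : [set y | y \in neighbours k x] = W x k.
Proof. by apply/funext => y /=; rewrite mem_neighbours. Qed.

Lemma finite_range_local k M xi x : finite_range_score k M xi ->
  local_on (neighbours k x) (xi x).
Proof. by move=> [loc _ _ _] mu; rewrite neighboursE. Qed.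

Lemma finite_range_scoreW k k' (M M' : R) xi : (k <= k')%N -> M <= M' ->
  finite_range_score k M xi -> finite_range_score k' M' xi.
Proof.
move=> kk MM [loc bd tr z]; split => // [x mu|x mu]; last exact: le_trans (bd x mu) MM.
rewrite loc [RHS]loc -setIA; congr (xi x (mu `&` _)).
by apply/seteqP; split => y //= h; [split => //; exact: leq_trans kk|case: h].
Qed.

Lemma local_score_finite_range xi : local_score xi ->
  exists k M, finite_range_score k M xi.
Proof.
move=> [k [h hxi]].
have loc x mu : xi x mu = xi x (mu `&` W x k).
  have Wx : W x k x by rewrite /W/= subrr l1norm0.
  have [h1 h2] := hxi x mu; have [h3 h4] := hxi x (mu `&` W x k).
  have [mx|nmx] := pselect (mu x); first by rewrite h1// h3// -setIA setIid.
  by rewrite h2// h4// => -[].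
have tr x y mu : xi (x + y) (translate y mu) = xi x mu.
  have [h1 h2] := hxi x mu; have [h3 h4] := hxi (x + y) (translate y mu).
  have e : translate y mu (x + y) = mu x by rewrite translateE/= addrK.
  have [mx|nmx] := pselect (mu x); last by rewrite h2// h4// e.
  rewrite h1// h3 ?e//; congr h; rewrite !translateE; apply/funext => z /=.
  have e1 (v : 'rV[int]_d) : v - (z - - v) = - z by rewrite opprK opprD addrCA subrr addr0.
  by rewrite /W/= !e1 !opprK addrA addrK.
exists k; pose s := ball_seq d k.
(* The pattern function h may be unbounded on arbitrary sets, but only patterns inside W_k occur.
   Each of them is a [mask] of the list of points of W_k, so this finite sum dominates all
   values. *)
exists (\sum_(m : (size s).-tuple bool) `|xi 0 [set y | y \in mask m s]|).
split => // [x mu|x mu nmx]; last by have [_ ->] := hxi x mu.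
pose nu := translate (- x) mu.
have -> : xi x mu = xi 0 (nu `&` W 0 k).
  by rewrite -loc -[LHS](tr x (- x)) subrr.
have -> : nu `&` W 0 k = [set y | y \in mask [seq `[<nu z>] | z <- s] s].
  apply/funext => y; rewrite /= -filter_mask mem_filter mem_ball_seq.
  have -> : W 0 k y = (l1norm y <= k)%N by rewrite /W/= sub0r l1normN.
  by apply/propext; split => [[ny ->]|/andP[/asboolP]]//; rewrite andbT; exact/asboolP.
have sz : size [seq `[<nu z>] | z <- s] == size s by rewrite size_map.
by rewrite (bigD1 (Tuple sz))//= lerDl sumr_ge0.
Qed.

Lemma local_scores_finite_range n (xi : 'I_n -> 'rV[int]_d -> set 'rV[int]_d -> R) :
  (forall i, local_score (xi i)) ->
  exists k M, forall i, finite_range_score k M (xi i).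
Proof.
move=> loc; have := fun i => local_score_finite_range (loc i).
move=> /choice[k] /choice[M] h.
exists (\max_i k i)%N, (\sum_i `|M i|) => i; apply: finite_range_scoreW (h i).
  exact: leq_bigmax.
by rewrite (bigD1 i)//= (le_trans (ler_norm _))// lerDl sumr_ge0.
Qed.

End FiniteRangeScores.

(** * Decay of score covariances and the limit matrix *)

Section ScoreCovariances.
Context (R : realType) (d : nat) (disp : measure_display).
Context (Omega : measurableType disp) (Pr : probability Omega R).
Context (calP : {mfun Omega >-> config d}).
Context (C c : nat -> R) (phi : R -> R).
Hypothesis C0 : forall k, 0 < C k /\ 0 < c k.
Hypothesis Cm : {homo C : k l / (k <= l)%N >-> k <= l}.
Hypothesis cm : {homo c : k l / (k <= l)%N >-> l <= k}.
Hypothesis fast : fast_decreasing phi.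
Hypothesis clustering :
  forall (p q : nat) (x : 'I_(p.+1 + q.+1) -> 'rV[int]_d), injective x ->
        (`| Pr (contains calP x)
            - Pr (contains calP (x \o @lshift p.+1 q.+1))
              * Pr (contains calP (x \o @rshift p.+1 q.+1)) |
         <= (C (p.+1 + q.+1)%N
             * phi (c (p.+1 + q.+1)%N * (separation x)%:R))%:E)%E.
Section Decay.
Variables (k : nat) (M : R).
Hypothesis M0 : 0 <= M.

Let local_Cov_le x y F G : local_on (neighbours k x) F -> local_on (neighbours k y) G ->
  (forall mu, `|F mu| <= M) -> (forall mu, `|G mu| <= M) ->
  `|Cov Pr (fun w => F (calP w)) (fun w => G (calP w))| <= 2 * M ^+ 2.
Proof.
move=> lF lG FM GM.
have b1 := local_bounded_rv calP (uniq_neighbours k x) lF FM.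
have b2 := local_bounded_rv calP (uniq_neighbours k y) lG GM.
rewrite /Cov (le_trans (ler_normB _ _))// mulr2n mulrDl mul1r expr2.
apply: lerD.
  apply: Ex_norm_bound => [|w]; first exact: bounded_rvM b1 b2.
  rewrite normrM; exact: (ler_pM (normr_ge0 _) (normr_ge0 _) (FM _) (GM _)).
by rewrite normrM ler_pM//; apply: Ex_norm_bound.
Qed.

(** Fast decay is used with exponent 2d + 1: the power 2d is paid for by the summable
    [lattice_weight], and the remaining one gives the rate 1/(1 + |y - x|) for tails. The supports
    shorten the distance by at most 2k. *)
Lemma local_Cov_decay : exists2 K : R, 0 <= K & forall x y F G,
  local_on (neighbours k x) F -> local_on (neighbours k y) G ->
  (forall mu, `|F mu| <= M) -> (forall mu, `|G mu| <= M) ->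
  `|Cov Pr (fun w => F (calP w)) (fun w => G (calP w))|
    <= K * (lattice_weight R (y - x) / (l1norm (y - x)).+1%:R).
Proof.
pose K := (wcard d k + wcard d k)%N; pose P := (d.*2).+1.
have [phi01 phim _] := fast.
have h := @fast_decreasing_natP R phi (c K) k.*2 P fast (C0 K).2.
have [N _ hN] := cvgr_le _ h _ (@ltr01 R).
(* Beyond T the supports are disjoint and the decay factor is below 1; closer pairs are covered by
   the trivial bound 2 M^2, with T^P in the constant. *)
pose T := (N + k.*2.+2)%N.
exists (3 ^+ K * M * M * C K + 2 * M ^+ 2 * T%:R ^+ P) => [|x y F G lF lG FM GM].
  by rewrite addr_ge0// !mulr_ge0// ?exprn_ge0// ltW// (C0 K).1.
pose s := l1norm (y - x).
have s1 : 0 < s.+1%:R ^+ P :> R by rewrite exprn_gt0.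
suff le1 : `|Cov Pr (fun w => F (calP w)) (fun w => G (calP w))| <= (3 ^+ K * M * M * C K + 2 * M ^+ 2 * T%:R ^+ P) * s.+1%:R ^- P.
  apply: le_trans le1 _; apply: ler_wpM2l.
    by rewrite addr_ge0// !mulr_ge0// ?exprn_ge0// ltW// (C0 K).1.
  by rewrite /P exprSr invfM ler_wpM2r// lattice_weight_lb.
rewrite ler_pdivlMr//.
have [sT|Ts] := ltnP s T.
  apply: ler_wpDl.
    by rewrite !mulr_ge0// ?exprn_ge0// ltW// (C0 K).1.
  apply: ler_pM; [exact: normr_ge0|exact: ltW|exact: local_Cov_le lF lG FM GM|].
  by rewrite lerXn2r ?nnegrE// ler_nat.
apply: ler_wpDr; first by rewrite !mulr_ge0// exprn_ge0.
have Ns : (N <= s)%N by move: Ts; rewrite /T; lia.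
have s0 : (0 < s - k.*2)%N by move: Ts; rewrite /T; lia.
have sep x' y' : x' \in neighbours k x -> y' \in neighbours k y ->
    (s - k.*2 <= l1norm (x' - y')%R)%N.
  rewrite !mem_neighbours => hx hy.
  have t1 := l1norm_sub_triangle x' x y; have t2 := l1norm_sub_triangle y' x' y.
  rewrite [l1norm (x - y)]l1normC -/s in t1; rewrite [l1norm (y' - y)]l1normC in t2.
  rewrite leq_subLR -addnn; move: (l1norm _) (l1norm _) (l1norm _) (l1norm _) hx hy t1 t2.
  by move=> *; lia.
have size_le : (size (neighbours k x : seq 'rV[int]_d) + size (neighbours k y) <= K)%N.
  by rewrite !size_neighbours.
have := clustering_local C0 Cm cm phi01 phim clustering (uniq_neighbours k x)
  (uniq_neighbours k y) lF lG FM GM size_le s0 sep.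
rewrite /decay => le1.
apply: le_trans (ler_wpM2r (ltW s1) le1) _.
rewrite [_ * (C K * _)]mulrA -[leLHS]mulrA -[leRHS]mulr1; apply: ler_wpM2l.
  by rewrite !mulr_ge0// ?exprn_ge0// ltW// (C0 K).1.
rewrite mulrC; exact: (hN s Ns).
Qed.

Lemma sum_local_Cov_tail : exists2 B : R, 0 <= B & forall (x : 'rV[int]_d) F (G : 'rV[int]_d -> _) L (s : seq 'rV[int]_d),
  local_on (neighbours k x) F -> (forall y, local_on (neighbours k y) (G y)) ->
  (forall mu, `|F mu| <= M) -> (forall y mu, `|G y mu| <= M) ->
  uniq s -> (forall y, y \in s -> (L <= l1norm (y - x)%R)%N) ->
  \sum_(y <- s) `|Cov Pr (fun w => F (calP w)) (fun w => G y (calP w))| <= B / L.+1%:R.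
Proof.
have [K K0 hK] := local_Cov_decay; exists (K * 4 ^+ d) => [|x F G L s lF lG FM GM us sL].
  by rewrite mulr_ge0// exprn_ge0.
have lw0 z := ltW (lattice_weight_gt0 R z).
apply: le_trans (_ : \sum_(y <- s) (K / L.+1%:R) * lattice_weight R (y - x) <= _).
  rewrite big_seq [leRHS]big_seq; apply: ler_sum => y ys.
  apply: le_trans (hK x y F (G y) lF (lG y) FM (GM y)) _.
  rewrite -mulrA; apply: ler_wpM2l => //.
  by rewrite mulrC ler_wpM2r// lef_pV2 ?posrE// ler_nat ltnS sL.
rewrite -mulr_sumr mulrAC ler_wpM2r// ler_wpM2l//.
rewrite -(big_map (fun y => y - x) predT (fun z : 'rV[int]_d => lattice_weight R z)) sum_lattice_weight//.
by rewrite map_inj_uniq//; exact: addIr.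
Qed.

End Decay.

Hypothesis stat : stationary Pr calP.

Variables (xi : 'I_d.+1 -> 'rV[int]_d -> set 'rV[int]_d -> R) (k : nat) (M : R).
Hypothesis fr : forall i, finite_range_score k M (xi i).

Definition score_rv i x (w : Omega) : R := xi i x (calP w).

Let xiM i x mu : `|xi i x mu| <= M. Proof. by case: (fr i). Qed.

Let M0 : 0 <= M. Proof. exact: le_trans (normr_ge0 _) (xiM ord0 0 set0). Qed.

Lemma bounded_rv_score i x : bounded_rv (score_rv i x).
Proof.
exact: (local_bounded_rv calP (uniq_neighbours k x) (finite_range_local x (fr i)) (xiM i x)).
Qed.

Definition score_Cov i j z : R := Cov Pr (score_rv i 0) (score_rv j z).

(** Translation by x moves the pair to 0 and y - x; scores are equivariant, and stationarity is
    applied to their product as a single local function. *)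
Lemma score_Cov_stationary i j x y :
  Cov Pr (score_rv i x) (score_rv j y) = score_Cov i j (y - x).
Proof.
have tr l z mu : xi l z (translate x mu) = xi l (z - x) mu.
  by case: (fr l) => _ _ tr _; rewrite -[in LHS](subrK x z) tr.
have E1 l z : Ex Pr (score_rv l z) = Ex Pr (score_rv l (z - x)).
  rewrite -(local_stationary x stat (uniq_neighbours k z) (finite_range_local z (fr l)) (xiM l z)).
  by congr Ex; apply/funext => w; rewrite tr.
rewrite /score_Cov /Cov E1 subrr [Ex _ (score_rv j y)]E1; congr (_ - _).
have loc := local_onM (finite_range_local x (fr i)) (finite_range_local y (fr j)).
have bd mu : `|xi i x mu * xi j y mu| <= M * M by rewrite normrM ler_pM.
rewrite -(local_stationary x stat (undup_uniq _) loc bd).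
by congr Ex; apply/funext => w; rewrite !tr subrr.
Qed.

Let sum_score_Cov_tail : exists2 B : R, 0 <= B & forall i j L s, uniq s ->
  (forall z, z \in s -> (L <= l1norm z)%N) -> \sum_(z <- s) `|score_Cov i j z| <= B / L.+1%:R.
Proof.
have [B B0 hB] := sum_local_Cov_tail k M0; exists B => // i j L s us sL.
apply: (hB 0 (xi i 0) (xi j)) => // [|y|z /sL]; last by rewrite subr0.
  exact: finite_range_local (fr i).
exact: finite_range_local (fr j).
Qed.

(** The rate must not depend on an approximating set F. So s is enlarged by F up to an arbitrary e;
    the added sites lie outside the ball of radius L and contribute at most B/(L+1). *)
Lemma limit_cov_approximation : (forall i j, summable setT (score_cov Pr calP xi i j)) /\
  exists2 B : R, 0 <= B & forall i j L s, uniq s -> {subset ball_seq d L <= s} ->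
  `|limit_cov Pr calP xi i j - \sum_(z <- s) score_Cov i j z| <= B / L.+1%:R.
Proof.
have [B B0 hB] := sum_score_Cov_tail.
have covE i j : score_cov Pr calP xi i j = fun z => (score_Cov i j z)%:E.
  by apply/funext => z; rewrite /score_cov covarianceE_Cov//; exact: bounded_rv_score.
have abs i j s : uniq s -> \sum_(z <- s) `|score_Cov i j z| <= B.
  by move=> us; have := hB i j 0%N s us (fun z _ => leq0n _); rewrite divr1.
split => [i j|]; first by rewrite covE; exact: (summable_approximation (abs i j)).1.
exists B => // i j L s us sub; apply/ler_addgt0Pr => e e0.
have [_ /(_ e e0) [F uF hF]] := summable_approximation (abs i j).
rewrite mxE covE.
have us' : uniq (s ++ [seq z <- F | z \notin s]).
  rewrite cat_uniq us filter_uniq// andbT /=; apply/hasPn => z.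
  by rewrite mem_filter => /andP[].
set S := fine _; set X := \sum_(z <- s) _; pose Y := \sum_(z <- [seq z <- F | z \notin s]) score_Cov i j z.
have hY : `|Y| <= B / L.+1%:R.
  apply: le_trans (ler_norm_sum _ _ _) _; apply: hB => [|z]; first exact: filter_uniq.
  rewrite mem_filter => /andP[zs _]; rewrite leqNgt; apply: contra zs => zL.
  by apply: sub; rewrite mem_ball_seq ltnW.
have h : `|S - (X + Y)| <= e.
  rewrite /S /X /Y -big_cat; apply: hF => // z zF.
  by rewrite mem_cat mem_filter zF andbT orbN.
rewrite (_ : S - X = (S - (X + Y)) + Y); last by ring.
by rewrite [leRHS]addrC (le_trans (ler_normD _ _))// lerD.
Qed.

(** The reflection z -> -z of a ball, together with stationarity, exchanges i and j in the finite
    sums, so both entries are limits of the same sums. *)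
Lemma limit_cov_sym : (limit_cov Pr calP xi)^T = limit_cov Pr calP xi.
Proof.
have [_ [B B0 hB]] := limit_cov_approximation.
apply/matrixP => i j; rewrite [LHS]mxE; apply/eqP; rewrite -subr_eq0 -normr_le0.
apply/ler_addgt0Pr => e e0; rewrite add0r.
pose L := Num.truncn (2 * B / e).
have sumE : \sum_(z <- ball_seq d L) score_Cov j i z = \sum_(z <- ball_seq d L) score_Cov i j z.
  have up : perm_eq (ball_seq d L) [seq - z | z <- ball_seq d L].
    apply: uniq_perm; rewrite ?map_inj_uniq ?uniq_ball_seq//.
    move=> z; rewrite mem_ball_seq; apply/idP/mapP => [zL|[y yL ->]].
      by exists (- z); rewrite ?opprK// mem_ball_seq l1normN.
    by rewrite l1normN -mem_ball_seq.
  rewrite (perm_big _ up) big_map; apply: eq_bigr => z _.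
  by rewrite /score_Cov CovC score_Cov_stationary sub0r opprK.
have := hB i j L _ (uniq_ball_seq d L) (fun _ h => h).
have := hB j i L _ (uniq_ball_seq d L) (fun _ h => h).
rewrite sumE.
have : 2 * B / L.+1%:R <= e.
  rewrite ler_pdivrMr// [leRHS]mulrC -ler_pdivrMr//; apply/ltW; exact: truncnS_gt.
move: (limit_cov _ _ _ i j) (limit_cov _ _ _ j i) (\sum_(z <- _) _) => x y z.
rewrite -mulrA; move: (_ / _) => b hb h1 h2.
move: h1 h2; rewrite !ler_norml => /andP[h1 h2] /andP[h3 h4].
by apply/andP; split; lra.
Qed.

End ScoreCovariances.

(** * Linear statistics and the limit of their variance *)

Section LinearStatistics.
Context (R : realType) (d : nat) (disp : measure_display).
Context (Omega : measurableType disp) (Pr : probability Omega R).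
Context (calP : {mfun Omega >-> config d}).
Context (C c : nat -> R) (phi : R -> R).
Hypothesis d0 : (0 < d)%N.
Hypothesis C0 : forall k, 0 < C k /\ 0 < c k.
Hypothesis Cm : {homo C : k l / (k <= l)%N >-> k <= l}.
Hypothesis cm : {homo c : k l / (k <= l)%N >-> l <= k}.
Hypothesis fast : fast_decreasing phi.
Hypothesis clustering :
  forall (p q : nat) (x : 'I_(p.+1 + q.+1) -> 'rV[int]_d), injective x ->
        (`| Pr (contains calP x)
            - Pr (contains calP (x \o @lshift p.+1 q.+1))
              * Pr (contains calP (x \o @rshift p.+1 q.+1)) |
         <= (C (p.+1 + q.+1)%N
             * phi (c (p.+1 + q.+1)%N * (separation x)%:R))%:E)%E.
Hypothesis stat : stationary Pr calP.

Variables (xi : 'I_d.+1 -> 'rV[int]_d -> set 'rV[int]_d -> R) (k : nat) (M : R).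
Hypothesis fr : forall i, finite_range_score k M (xi i).
Variable t : 'rV[R]_d.+1.

(** Scores are evaluated on the configuration cut to W_n, as in [Hbar]. Inside W_n this affects only
    sites within distance k of the boundary. *)
Definition linear_score n x mu : R := \sum_i t ord0 i * xi i x (mu `&` W 0 n).

Definition centered_linear_score n x mu : R :=
  linear_score n x mu - Ex Pr (fun w => linear_score n x (calP w)).

Let N := \sum_i `|t ord0 i| * M.

Let local_linear_score n x : local_on (neighbours k x) (linear_score n x).
Proof.
move=> mu; apply: eq_bigr => i _; congr (_ * _).
by rewrite (finite_range_local x (fr i)) setIAC.
Qed.

Let linear_score_le n x mu : `|linear_score n x mu| <= N.
Proof.
apply: le_trans (ler_norm_sum _ _ _) _; apply: ler_sum => i _.
by rewrite normrM ler_wpM2l//; case: (fr i).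
Qed.

Let bounded_rv_linear_score n x : bounded_rv (fun w => linear_score n x (calP w)).
Proof.
exact: (local_bounded_rv calP (uniq_neighbours k x) (local_linear_score n x)
  (linear_score_le n x)).
Qed.

Lemma local_centered_linear_score n x : local_on (neighbours k x) (centered_linear_score n x).
Proof. by move=> mu; rewrite /centered_linear_score local_linear_score. Qed.

Lemma centered_linear_score_le n x mu : `|centered_linear_score n x mu| <= N + N.
Proof. by rewrite (le_trans (ler_normB _ _))// lerD//; apply: Ex_norm_bound. Qed.

Lemma bounded_rv_centered_linear_score n x :
  bounded_rv (fun w => centered_linear_score n x (calP w)).
Proof. by apply: bounded_rvB => //; exact: bounded_rv_cst. Qed.

Lemma Ex_centered_linear_score n x : Ex Pr (fun w => centered_linear_score n x (calP w)) = 0.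
Proof. by rewrite ExB//; [rewrite Ex_cst subrr|exact: bounded_rv_cst]. Qed.

Let cov n x y :=
  Cov Pr (fun w => centered_linear_score n x (calP w)) (fun w => centered_linear_score n y (calP w)).

Let cov_limit z := \sum_j (\sum_i t ord0 i * score_Cov Pr calP xi i j z) * t ord0 j.

(** At depth at least k the cut to W_n is invisible, so the covariance depends on y - x only. *)
Let covE n x y : (l1norm x + k <= n)%N -> (l1norm y + k <= n)%N -> cov n x y = cov_limit (y - x).
Proof.
have shift z : (fun w => centered_linear_score n z (calP w)) =
    fun w => linear_score n z (calP w) + - Ex Pr (fun w => linear_score n z (calP w)).
  by [].
move=> xn yn; rewrite /cov !shift.
have bc (e : R) : bounded_rv (fun _ : Omega => e) by exact: bounded_rv_cst.
have bD z : bounded_rv (fun w => linear_score n z (calP w) + - Ex Pr (fun w => linear_score n z (calP w))).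
  exact: bounded_rvD.
rewrite CovDl// [X in _ + X]CovC Cov_cstr// addr0 CovDr// Cov_cstr// addr0.
have inner z : (l1norm z + k <= n)%N ->
    (fun w => linear_score n z (calP w)) = fun w => \sum_i t ord0 i * score_rv calP xi i z w.
  move=> zn; apply/funext => w; apply: eq_bigr => i _; congr (_ * _).
  have [loc _ _ _] := fr i; rewrite loc [RHS]loc -setIA; congr (xi i z (_ `&` _)).
  apply/seteqP; split => u; first by case.
  move=> uz; split => //; rewrite /W/= sub0r l1normN.
  have := l1norm_sub_triangle z u 0; rewrite !subr0 l1normC.
  move: uz zn; rewrite /W/=; move: (l1norm _) (l1norm _) (l1norm _) => *; lia.
rewrite !inner//.
have b i z : bounded_rv (fun w => t ord0 i * score_rv calP xi i z w).
  by apply: bounded_rvZ; exact: (bounded_rv_score calP fr i z).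
rewrite Cov_sumr//; last exact: bounded_rv_sum.
apply: eq_bigr => j _; rewrite Cov_suml// mulr_suml; apply: eq_bigr => i _.
rewrite CovZl ?CovZr//; try exact: (bounded_rv_score calP fr).
by rewrite (score_Cov_stationary stat fr); ring.
Qed.

Let v := quad_form (limit_cov Pr calP xi) t.

Let quad_form_tail : exists2 B : R, 0 <= B & forall L s, uniq s -> {subset ball_seq d L <= s} ->
  `|v - \sum_(z <- s) cov_limit z| <= B / L.+1%:R.
Proof.
have [_ [B B0 hB]] := limit_cov_approximation C0 Cm cm fast clustering fr.
exists (\sum_j (\sum_i `|t ord0 i| * B) * `|t ord0 j|).
  by apply: sumr_ge0 => j _; rewrite mulr_ge0// sumr_ge0// => i _; rewrite mulr_ge0.
move=> L s us sub; rewrite /v /quad_form mxE /cov_limit exchange_big/= -sumrB mulr_suml.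
apply: le_trans (ler_norm_sum _ _ _) _; apply: ler_sum => j _.
rewrite -mulr_suml exchange_big/= !mxE -mulrBl normrM mulrAC; apply: ler_wpM2r => //.
rewrite -sumrB mulr_suml.
apply: le_trans (ler_norm_sum _ _ _) _; apply: ler_sum => i _.
by rewrite -mulr_sumr -mulrBr normrM -mulrA ler_wpM2l// hB.
Qed.

(** At depth k + L the sites y within L of x contribute a partial sum of the series for v, and the
    other sites only a tail. Near the boundary the uniform bound D is enough. *)
Let row_sum : exists2 D : R, 0 <= D &
  (forall n x, `|\sum_(y <- ball_seq d n) cov n x y| <= D) /\
  (forall n x L, (l1norm x + (k + L) <= n)%N ->
     `|\sum_(y <- ball_seq d n) cov n x y - v| <= D / L.+1%:R).
Proof.
have N0 : 0 <= N + N by exact: le_trans (normr_ge0 _) (centered_linear_score_le 0 0 set0).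
have [B1 B10 hB1] := sum_local_Cov_tail C0 Cm cm fast clustering k N0.
have [B2 B20 hB2] := quad_form_tail.
have tail n x L s : uniq s -> (forall y, y \in s -> (L <= l1norm (y - x)%R)%N) ->
    `|\sum_(y <- s) cov n x y| <= B1 / L.+1%:R.
  move=> us sL; apply: le_trans (ler_norm_sum _ _ _) _.
  apply: (hB1 x (centered_linear_score n x) (centered_linear_score n) L s) => //.
  - exact: local_centered_linear_score.
  - by move=> y; exact: local_centered_linear_score.
  - exact: centered_linear_score_le.
  - exact: centered_linear_score_le.
exists (B1 + B2); first exact: addr_ge0.
split => [n x|n x L xn].
  apply: le_trans (tail n x 0%N _ (uniq_ball_seq d n) _) _ => //.
  by rewrite divr1 lerDl.
rewrite (bigID (fun y => (l1norm (x - y)%R <= L)%N))/= addrAC addrC mulrDl.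
apply: le_trans (ler_normD _ _) _; apply: lerD.
  rewrite -big_filter; apply: tail => [|y]; first by rewrite filter_uniq// uniq_ball_seq.
  by rewrite mem_filter -ltnNge l1normC => /andP[/ltnW].
rewrite -big_filter (perm_big (neighbours L x)); last first.
  apply: uniq_perm => [| |y]; [by rewrite filter_uniq// uniq_ball_seq|exact: uniq_neighbours|].
  rewrite mem_filter mem_neighbours mem_ball_seq andbC; apply: andb_idl => yx.
  have := l1norm_sub_triangle x y 0; rewrite !subr0 l1normC; move: yx xn; lia.
rewrite big_map distrC big_seq (eq_bigr cov_limit); last first.
  move=> z; rewrite mem_ball_seq => zL.
  have xz : (l1norm (x + z)%R + k <= n)%N.
    by have := l1norm_triangle x z; move: (l1norm (x + z)) xn zL => *; lia.
  have xk : (l1norm x + k <= n)%N by lia.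
  by rewrite covE// addrC addKr.
by rewrite -big_seq; apply: hB2 => //; exact: uniq_ball_seq.
Qed.

Definition linear_statistic n : Omega -> R := normalized_sum calP centered_linear_score n.

Lemma bounded_rv_linear_statistic n : bounded_rv (linear_statistic n).
Proof.
rewrite /linear_statistic /normalized_sum /partial_sum; apply: bounded_rvZ.
by apply: bounded_rv_sum => x; exact: bounded_rv_centered_linear_score.
Qed.

Lemma Ex_linear_statistic n : Ex Pr (linear_statistic n) = 0.
Proof.
rewrite /linear_statistic /normalized_sum /partial_sum ExZ; last first.
  by apply: bounded_rv_sum => x; exact: bounded_rv_centered_linear_score.
rewrite Ex_sum; last by move=> x; exact: bounded_rv_centered_linear_score.
by rewrite big1 ?mulr0// => x _; exact: Ex_centered_linear_score.
Qed.

Let ExU2 n : Ex Pr (fun w => linear_statistic n w ^+ 2) =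
  (wcard d n)%:R^-1 * \sum_(x <- ball_seq d n) \sum_(y <- ball_seq d n) cov n x y.
Proof.
have b x := bounded_rv_centered_linear_score n x.
have bs : bounded_rv (fun w => \sum_(x <- ball_seq d n) centered_linear_score n x (calP w)).
  exact: bounded_rv_sum.
have -> : Ex Pr (fun w => linear_statistic n w ^+ 2) = Cov Pr (linear_statistic n) (linear_statistic n).
  by rewrite /Cov Ex_linear_statistic mulr0 subr0.
rewrite /linear_statistic /normalized_sum /partial_sum CovZl//; last exact: bounded_rvZ.
rewrite CovZr// mulrA -invfM -expr2 sqr_sqrtr//; congr (_ * _).
rewrite Cov_suml//; apply: eq_bigr => x _.
by rewrite Cov_sumr.
Qed.

(** The variance is the average over W_n of the row sums. For fixed L the rows at depth k + L are
    within D/(L+1) of v, and by [wcard_boundary] the other rows are a fraction O(1/n); L is chosen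
    first, then n grows. *)
Lemma linear_statistic_variance : Ex Pr (fun w => linear_statistic n w ^+ 2) @[n --> \oo] --> v.
Proof.
have [D D0 [hD1 hD2]] := row_sum.
have bound L n : `|v - Ex Pr (fun w => linear_statistic n w ^+ 2)| <=
    D / L.+1%:R + (D + `|v|) * (((k + L) * d.*2 ^ d)%:R / n.+1%:R).
  have w0 : 0 < (wcard d n)%:R :> R by rewrite ltr0n wcard_gt0.
  pose p : pred 'rV[int]_d := fun x => (l1norm x + (k + L) <= n)%N.
  pose J : seq 'rV[int]_d := ball_seq d n.
  have cnt : (n.+1 * count (predC p) J <= (k + L) * d.*2 ^ d * wcard d n)%N.
    have cp : (count p J + count (predC p) J = wcard d n)%N.
      by rewrite count_predC size_ball_seq.
    have [qn|nq] := leqP (k + L) n.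
      have e : count p J = wcard d (n - (k + L)).
        rewrite -size_filter -size_ball_seq; apply/perm_size/uniq_perm => [| |x].
        - by rewrite filter_uniq// uniq_ball_seq.
        - exact: uniq_ball_seq.
        - by rewrite mem_filter !mem_ball_seq /p; lia.
      have := wcard_boundary n (k + L) d0; rewrite -e mulnA.
      by rewrite -{1}cp mulnDr leq_add2l.
    have d1 : (1 <= d.*2 ^ d)%N by rewrite expn_gt0 double_gt0 d0.
    apply: (@leq_trans ((k + L) * wcard d n)); first by apply: leq_mul => //; rewrite -cp leq_addl.
    by rewrite mulnAC leq_pmulr.
  have vE : v = (wcard d n)%:R^-1 * \sum_(x <- J) v.
    by rewrite sumr_const_seq size_ball_seq mulKf// gt_eqF.
  rewrite ExU2 {1}vE -mulrBr -sumrB normrM gtr0_norm ?invr_gt0//.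
  apply: (@le_trans _ _ ((wcard d n)%:R^-1 *
      \sum_(x <- J) (D / L.+1%:R + (D + `|v|) * (predC p x)%:R))).
    apply: ler_wpM2l; first by rewrite invr_ge0 ltW.
    apply: le_trans (ler_norm_sum _ _ _) _; apply: ler_sum => x _.
    rewrite distrC; case: (boolP (p x)) => px /=; rewrite px /=.
      by rewrite mulr0 addr0; exact: hD2.
    rewrite mulr1 (le_trans (ler_normB _ _))// ler_wpDl ?divr_ge0//.
    by rewrite lerD.
  rewrite big_split/= sumr_const_seq size_ball_seq mulrDr mulKf ?gt_eqF// lerD2l.
  rewrite -mulr_sumr mulrCA ler_wpM2l ?addr_ge0//.
  rewrite (_ : \sum_(x <- J) _ = (count (predC p) J)%:R); last first.
    by rewrite -sum1_count natr_sum [RHS]big_mkcond; apply: eq_bigr => x _ /=; case: (p x).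
  rewrite ler_pdivlMr// -mulrA ler_pdivrMl// -!natrM ler_nat.
  by rewrite mulnC [leqRHS]mulnC.
apply/cvgrPdist_le => e e0.
pose L := Num.truncn (2 * D / e).
have DL : D / L.+1%:R <= e / 2.
  rewrite ler_pdivrMr// mulrAC ler_pdivlMr// [D * _]mulrC [leRHS]mulrC -ler_pdivrMr//.
  by apply: ltW; exact: truncnS_gt.
have h : (D + `|v|) * (((k + L) * d.*2 ^ d)%:R / n.+1%:R) @[n --> \oo] --> (0 : R).
  rewrite -[X in _ --> X](mulr0 (D + `|v|)); apply: cvgMr.
  rewrite -[X in _ --> X](mulr0 ((k + L) * d.*2 ^ d)%:R); apply: cvgMr.
  exact: cvg_harmonic.
have e20 : 0 < e / 2 by rewrite divr_gt0.
near=> n; apply: le_trans (bound L n) _.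
rewrite [leRHS](splitr e) lerD//.
by near: n; exact: (cvgr_le _ h _ e20).
Unshelve. all: by end_near. Qed.

End LinearStatistics.

(** * The limit law, the projections of [Hbar], and the conclusion *)

Section CenteredNormalLaw.
Context (R : realType) (m : nat) (S : 'M[R]_m) (nu : probability (borel R m) R).
Hypothesis nuS : is_centered_normal S nu.

(** [is_centered_normal] describes the laws of projections, so moments are transferred through the
    pushforward by [dotp t]. *)
Lemma centered_normal_moments t j :
  nu.-integrable setT (EFin \o (fun v => dotp t v ^+ j)) /\
  Ex nu (fun v => dotp t v ^+ j) = gauss_moment (quad_form S t) j.
Proof.
have [_ /(_ t) [q0 law]] := nuS; rewrite -/(quad_form S t) in q0 law.
have [ig Eg] := gauss_moments j q0.
pose f (x : measurableTypeR R) : \bar R := (x ^+ j)%:E.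
have mf : measurable_fun setT f by exact: (measurable_int _ ig).
have mX : measurable_fun setT (dotp t : borel R m -> measurableTypeR R).
  exact: measurable_dotp.
pose pm : {measure set (measurableTypeR R) -> \bar R} :=
  measure_function_pushforward__canonical__measure_function_Measure nu mX.
have lawE (g : measurableTypeR R -> \bar R) :
    (\int[pm]_x g x = \int[gauss (quad_form S t)]_x g x)%E.
  apply: eq_measure_integral => A mA _; apply: etrans (law A mA) _.
  exact: (congr1 (fun h : set R -> \bar R => h A) (esym (gaussE _))).
have iX : nu.-integrable setT (f \o dotp t).
  apply/integrableP; split; first exact: measurableT_comp.
  have -> : (\int[nu]_v `|(f \o dotp t) v| = \int[pm]_x `|f x|)%E.
    rewrite ge0_integral_pushforward//; exact: measurableT_comp.
  by rewrite lawE; case/integrableP: ig.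
split => //.
rewrite -Eg /Ex /Rintegral; congr fine; rewrite -[RHS]lawE.
by rewrite (integral_pushforward mX mf).
Qed.

Lemma centered_normal_cos t th k :
  `|Ex nu (fun v => cos (dotp t v + th))
    - cos_moment_sum k.*2 th (gauss_moment (quad_form S t))|
  <= (k.*2)`!%:R^-1 * gauss_moment (quad_form S t) k.*2.
Proof.
have h j := (centered_normal_moments t j).2.
rewrite -h; have -> : gauss_moment (quad_form S t) = fun j => Ex nu (fun v => dotp t v ^+ j).
  by apply/funext => j; rewrite h.
apply: Ex_cos_taylor; first exact: measurable_dotp.
by move=> j; exact: (centered_normal_moments t j).1.
Qed.

End CenteredNormalLaw.

Section LinearStatisticsOfHbar.
Context (R : realType) (d : nat) (disp : measure_display).
Context (Omega : measurableType disp) (Pr : probability Omega R).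
Context (calP : {mfun Omega >-> config d}).
Variables (xi : 'I_d.+1 -> 'rV[int]_d -> set 'rV[int]_d -> R) (k : nat) (M : R).
Hypothesis fr : forall i, finite_range_score k M (xi i).
Hypothesis sum_xi : forall i (mu : set 'rV[int]_d), finite_set mu ->
  \sum_(x \in mu) xi i x mu = intrinsic_volume i (cubes mu).

Definition normalized_Hbar n w : 'rV[R]_d.+1 :=
  (Num.sqrt (wcard d n)%:R)^-1
    *: (Hbar R calP n w - mean_vector Pr (Hbar R calP n)).

(** Here intrinsic volumes become sums of local scores. The sum may run over all of W_n because
    scores vanish off the configuration. *)
Lemma HbarE n w i :
  Hbar R calP n w ord0 i = \sum_(x <- ball_seq d n) xi i x (calP w `&` W 0 n).
Proof.
have fin : finite_set (calP w `&` W 0 n) by apply: finite_setIr; exact: finite_W.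
rewrite mxE -sum_xi// (fsbig_widen _ (W 0 n)) => [|x [] //|x [_ nx] /=].
  by rewrite fsbig_finite//; exact: finite_W.
by have [_ _ _ ->] := fr i.
Qed.

(** The Cramer-Wold reduction: centring and normalization commute with the finite sums over sites
    and coordinates. *)
Lemma dotp_normalized_Hbar t n w :
  dotp t (normalized_Hbar n w) = linear_statistic Pr calP xi t n w.
Proof.
have b i x : bounded_rv (fun w => xi i x (calP w `&` W 0 n)).
  have [_ bd _ _] := fr i.
  apply: (local_bounded_rv calP (uniq_neighbours k x) (F := fun mu => xi i x (mu `&` W 0 n))).
    by move=> mu; rewrite (finite_range_local x (fr i)) setIAC.
  by move=> mu; exact: bd.
have bt i x : bounded_rv (fun w => t ord0 i * xi i x (calP w `&` W 0 n)).
  exact: bounded_rvZ.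
have meanE i : mean_vector Pr (Hbar R calP n) ord0 i =
    \sum_(x <- ball_seq d n) Ex Pr (fun w => xi i x (calP w `&` W 0 n)).
  rewrite mxE; under eq_fun do rewrite HbarE.
  by rewrite expectationEx ?Ex_sum//; exact: bounded_rv_sum.
have coordE i : normalized_Hbar n w ord0 i = (Num.sqrt (wcard d n)%:R)^-1 *
    \sum_(x <- ball_seq d n)
      (xi i x (calP w `&` W 0 n) - Ex Pr (fun w => xi i x (calP w `&` W 0 n))).
  by rewrite sumrB -meanE -HbarE /normalized_Hbar !mxE.
rewrite dotpE /linear_statistic /normalized_sum /partial_sum.
under eq_bigr do rewrite coordE mulrCA mulr_sumr.
rewrite -mulr_sumr exchange_big/=; congr (_ * _); apply: eq_bigr => x _.
rewrite /centered_linear_score /linear_score Ex_sum// -sumrB; apply: eq_bigr => i _.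
by rewrite ExZ// mulrBr.
Qed.

End LinearStatisticsOfHbar.

Theorem corollary2p7 (R : realType) (d : nat) (hd : (0 < d)%N)
    (disp : measure_display) (Omega : measurableType disp)
    (Pr : probability Omega R) (calP : {mfun Omega >-> config d})
    (xi : 'I_d.+1 -> 'rV[int]_d -> set 'rV[int]_d -> R) :
  clustering_spin_model Pr calP ->
  (forall i, local_score (xi i)) ->
  (forall i (mu : set 'rV[int]_d), finite_set mu ->
     \sum_(x \in mu) xi i x mu = intrinsic_volume i (cubes mu)) ->
  (forall i j, summable setT (score_cov Pr calP xi i j)) /\
  cvg_to_centered_normal Pr
    (fun n w => (Num.sqrt (wcard d n)%:R)^-1
                *: (Hbar R calP n w - mean_vector Pr (Hbar R calP n)))
    (limit_cov Pr calP xi).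
Proof.

move=> [stat _ [C [c [phi [C0 Cm cm fast clustering]]]]] loc sum_xi.
have [k [M fr]] := local_scores_finite_range loc.
have [summ _] := limit_cov_approximation C0 Cm cm fast clustering fr.
split => //.
set S := limit_cov Pr calP xi; pose U := linear_statistic Pr calP xi.
have bU t n : bounded_rv (U t n) by exact: (bounded_rv_linear_statistic Pr calP fr t n).
have U2 t : Ex Pr (fun w => U t n w ^+ 2) @[n --> \oo] --> quad_form S t.
  exact: (linear_statistic_variance hd C0 Cm cm fast clustering stat fr).
(* The limit matrix is positive semidefinite because its quadratic form is a limit of variances. *)
have psd t : 0 <= quad_form S t.
  rewrite -(cvg_lim _ (U2 t))//; apply: limr_ge; first by apply/cvg_ex; exists (quad_form S t); exact: U2.
  by near=> n; apply: Ex_ge0 => w; exact: sqr_ge0.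
have moments t j : Ex Pr (fun w => U t n w ^+ j) @[n --> \oo] --> gauss_moment (quad_form S t) j.
  apply: (moments_cvg (bU t) _ (U2 t)) => [n|m].
    exact: (Ex_linear_statistic Pr calP fr t n).
  apply: (asymptotic_recursion hd C0 Cm cm fast clustering (A := neighbours k)
    (a := wcard d k) (k := k)).
  - exact: uniq_neighbours.
  - by move=> x; rewrite size_neighbours.
  - by move=> x y; rewrite mem_neighbours.
  - by move=> n x; exact: (local_centered_linear_score Pr calP fr t n x).
  - by move=> n x mu; exact: (centered_linear_score_le Pr calP fr t n x mu).
  - by move=> n x; exact: (Ex_centered_linear_score Pr calP fr t n x).
have [nu nuS] := centered_normal_exists (limit_cov_sym C0 Cm cm fast clustering stat fr) psd.
exists nu; split => //.
have dotE t n w : dotp t (normalized_Hbar Pr calP n w) = U t n w.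
  exact: (dotp_normalized_Hbar Pr calP fr sum_xi t n w).
have coordE i n w : normalized_Hbar Pr calP n w ord0 i = U (delta_mx 0 i) n w.
  by rewrite -dotE dotp_delta.
(* The coordinates are the linear statistics of the unit vectors, so variance convergence bounds
   their second moments, and cosines converge because moments do. *)
apply: (@weak_cvg_criterion _ _ _ _ _ (normalized_Hbar Pr calP)).
- by move=> n i; under eq_fun do rewrite coordE; exact: bU.
- move=> t th; under eq_fun do under eq_fun do rewrite dotE.
  apply: (Ex_cos_cvg (bU t) (moments t)) => l; exact: centered_normal_cos.
- move=> i; exists (quad_form S (delta_mx 0 i) + 1); near=> n.
  under eq_fun do rewrite coordE.
  near: n; apply: (cvgr_le _ (U2 (delta_mx 0 i))).
  by rewrite ltrDl.
- move=> i; under eq_fun do rewrite -dotp_delta.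
  exact: (centered_normal_moments nuS (delta_mx 0 i) 2).1.
Unshelve. all: by end_near. Qed.
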